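(* Let $p>3$ be the characteristic of $\mathbb F$. For every $\underline r\in\mathbb N^{p+2}$, all integers $m,n>2$ and every $\underline t\in\mathbb N^m$, the Lie superalgebra $SKO(p+2,p+3;(p-1)/2,\underline r)$ is not isomorphic to any of the Lie superalgebras of Cartan type $W(m,n;\underline t)$, $H(m,n;\underline t)$, $KO(m,m+1;\underline t)$ or $SHO(m,m;\underline t)$.
   Context: $\mathbb F$ is a field of characteristic $p>3$, $\mathbb N$ the positive integers. For $\underline t\in\mathbb N^m$ put $\pi_i=p^{t_i}-1$; $\mathcal O(m;\underline t)$ is the divided power algebra with basis $x^{(\alpha)}$, $\alpha\in\mathbb N_0^m$, $\alpha_i\le\pi_i$, and $x^{(\alpha)}x^{(\beta)}=\binom{\alpha+\beta}{\alpha}x^{(\alpha+\beta)}$ (zero if some exponent exceeds $\pi_i$); $x_i=x^{(\varepsilon_i)}$. $\mathcal O(m,n;\underline t)=\mathcal O(m;\underline t)\otimes\Lambda(n)$, $\Lambda(n)$ the exterior superalgebra in odd variables $x_{m+1},\dots,x_{m+n}$; $\mathrm p$ is parity (formulas with $\mathrm p(a)$ are for homogeneous $a$, extended linearly). $\partial_r$ is the superderivation of $\mathcal O(m,n;\underline t)$ (parity $\mu(r)=0$ for $r\le m$, $\mu(r)=1$ for $r>m$) with $\partial_r(x^{(\alpha)})=x^{(\alpha-\varepsilon_r)}$ for $r\le m$, $\partial_r(x_s)=\delta_{rs}$. $W(m,n;\underline t)$ is the Lie superalgebra of all $\sum_{r=1}^{m+n}f_r\partial_r$, $f_r\in\mathcal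 O(m,n;\underline t)$. $H(m,n;\underline t)$ (defined for $m=2r$ even): for $i\le r$ let $i'=i+r$, for $r<i\le2r$ let $i'=i-r$, for $i>2r$ let $i'=i$; $\sigma(i)=-1$ for $r<i\le2r$ and $\sigma(i)=1$ otherwise; $D_H(f)=\sum_{i=1}^{m+n}\sigma(i')(-1)^{\mu(i')\mathrm p(f)}\partial_{i'}(f)\partial_i$. $H(m,n;\underline t)$ is the span of all $D_H(f)$ with $f$ a combination of monomials $x^{(\alpha)}x^u$ other than the one of top degree $\sum_i\pi_i+n$. For $N\ge3$ and $\underline t\in\mathbb N^N$, put $i'=i+N$ for $i\le N$, $i'=i-N$ for $N<i\le2N$; $\Delta=\sum_{i=1}^N\partial_i\partial_{i'}$; $\mathfrak D=\sum_{i=1}^{2N}x_i\partial_i$; $T_H(a)=\sum_{i=1}^{2N}(-1)^{\mu(i')\mathrm p(a)}\partial_{i'}(a)\partial_i$ (with $\mu(i)=0$ for $i\le N$, $1$ for $i>N$). $SHO'(N,N;\underline t)=\{T_H(a):a\in\mathcal O(N,N;\underline t),\ \Delta(a)=0\}$, $\overline{SHO}(N,N;\underline t)=[SHO',SHO']$, and $SHO(N,N;\underline t)=[\overline{SHO},\overline{SHO}]$. In $\mathcal O(N,N+1;\underline t)$ put $D_{KO}(a)=T_H(a)+(-1)^{\mathrm p(a)}\partial_{2N+1}(a)\mathfrak D+(\mathfrak D(a)-2a)\partial_{2N+1}$. $KO(N,N+1;\underline t)=\{D_{KO}(a):a\in\mathcal O(N,N+1;\underline t)\}$. For $\lambda\in\mathbb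 F$, $\mathrm{div}_\lambda(a)=(-1)^{\mathrm p(a)}2(\Delta(a)+(\mathfrak D-N\lambda\,\mathrm{id})\partial_{2N+1}(a))$, $SKO''(N,N+1;\lambda,\underline t)=\{D_{KO}(a):\mathrm{div}_\lambda(a)=0\}$, $SKO'=[SKO'',SKO'']$, $SKO(N,N+1;\lambda,\underline t)=[SKO',SKO']$. In the claim $N=p+2$ and $\lambda$ is the image of the integer $(p-1)/2$ in $\mathbb F$. *)

(* Defs.v *)
From HB Require Import structures.
From mathcomp Require Import all_boot all_order all_algebra.

Set Implicit Arguments.
Unset Strict Implicit.
Unset Printing Implicit Defensive.

Import GRing.Theory.
Local Open Scope ring_scope.

Section LinearExtension.
Context (F : fieldType) (B : finType) (V : vectType F).
Implicit Types (g : B -> V) (a : {ffun B -> F^o}).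

Definition basis_elt (w : B) : {ffun B -> F^o} := [ffun w' => (w' == w)%:R].

Definition linext_fun g a : V := \sum_w (a w : F) *: g w.

Fact linext_fun_is_linear g : linear (linext_fun g).
Proof.
move=> c a b; rewrite /linext_fun scaler_sumr -big_split /=.
by apply: eq_bigr => w _; rewrite !ffunE scalerDl scalerA.
Qed.

HB.instance Definition _ g :=
  GRing.isLinear.Build F {ffun B -> F^o} V _ (linext_fun g)
    (linext_fun_is_linear g).

Definition linext g : 'Hom({ffun B -> F^o}, V) := linfun (linext_fun g).

Lemma linext_basis g w : linext g (basis_elt w) = g w.
Proof.
rewrite lfunE /= /linext_fun (bigD1 w) //= ffunE eqxx scale1r big1 ?addr0 //.
by move=> w' /negPf w'w; rewrite ffunE w'w scale0r.
Qed.

End LinearExtension.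

Section DividedPowerSuperalgebra.
Context (F : fieldType) (p m n : nat) (t : 'I_m -> nat).

Definition dpexp := {dffun forall i : 'I_m, 'I_(p ^ t i)}.

(* (alpha, u) stands for x^(alpha) x^u, where x^u is the product of the odd
   variables with index in u, taken in increasing order. *)
Definition supermon := (dpexp * {set 'I_n})%type.

Definition dpO := {ffun supermon -> F^o}.

(* inl i is the even variable x_(i+1), inr j the odd variable x_(m+j+1). *)
Definition svar := ('I_m + 'I_n)%type.

Definition mu (r : svar) : bool := if r is inr _ then true else false.

Definition mon (w : supermon) : dpO := basis_elt F w.

Definition par_mon (w : supermon) : bool := odd #|w.2|.

Definition deg_mon (w : supermon) : nat := (\sum_i w.1 i + #|w.2|)%N.

Definition top_deg : nat := (\sum_i (p ^ t i).-1 + n)%N.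

Definition inversions (u v : {set 'I_n}) : nat :=
  #|[set ij : 'I_n * 'I_n | (ij.1 \in u) && (ij.2 \in v) && (ij.2 < ij.1)%N]|.

(* No monomial w satisfies the exponent condition when some alpha_i + beta_i
   exceeds p ^ t i - 1, so the product then vanishes. *)
Definition mul_mon (w1 w2 : supermon) : dpO :=
  [ffun w : supermon =>
    if [&& [forall i, w.1 i == w1.1 i + w2.1 i :> nat]%N,
           [disjoint w1.2 & w2.2] & w.2 == w1.2 :|: w2.2]
    then (-1) ^+ inversions w1.2 w2.2
         * (\prod_i 'C(w1.1 i + w2.1 i, w1.1 i))%N%:R
    else 0].

(* Left multiplication: lmul f g = f g. *)
Definition lmul : 'Hom(dpO, 'End(dpO)) :=
  linext (fun w1 => linext (fun w2 => mul_mon w1 w2)).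

Definition xvar (r : svar) : dpO :=
  [ffun w : supermon =>
    match r with
    | inl i => [forall k, w.1 k == (k == i) :> nat] && (w.2 == set0)
    | inr j => [forall k, w.1 k == 0 :> nat]%N && (w.2 == [set j])
    end%:R].

Definition ord_sub k (e : 'I_k) (d : nat) : 'I_k :=
  Ordinal (leq_ltn_trans (leq_subr d e) (ltn_ord e)).

Definition lower_exp (i : 'I_m) (e : dpexp) : dpexp :=
  [ffun k => ord_sub (e k) (k == i)].

(* The values on monomials of the left superderivation with
   partial_r(x^(alpha)) = x^(alpha - eps_r) and partial_r(x_s) = delta_rs;
   moving an odd partial_r past the odd variables preceding x_r gives the
   sign. *)
Definition partial_mon (r : svar) (w : supermon) : dpO :=
  match r with
  | inl i => if w.1 i == 0 :> nat then 0 else mon (lower_exp i w.1, w.2)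
  | inr j => if j \in w.2
             then (-1) ^+ #|[set k in w.2 | (k < j)%N]| *: mon (w.1, w.2 :\ j)
             else 0
  end.

Definition partial (r : svar) : 'End(dpO) := linext (partial_mon r).

(* The derivation f D with f in O(m, n; t). *)
Definition fder (f : dpO) (D : 'End(dpO)) : 'End(dpO) := (lmul f \o D)%VF.

Definition proj_par (b : bool) : 'End(dpO) :=
  linext (fun w => if par_mon w == b then mon w else 0).

(* The component of parity d of an endomorphism. *)
Definition end_par (d : bool) (D : 'End(dpO)) : 'End(dpO) :=
  \sum_(b : bool) (proj_par (b (+) d) \o D \o proj_par b)%VF.

Definition end_homog (d : bool) (D : 'End(dpO)) : Prop := end_par d D = D.

Definition sbracket (D E : 'End(dpO)) : 'End(dpO) :=
  \sum_(d : bool) \sum_(e : bool)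
    ((end_par d D \o end_par e E)%VF
     - (-1) ^+ (d && e) *: (end_par e E \o end_par d D)%VF).

Definition derived (L : {vspace 'End(dpO)}) : {vspace 'End(dpO)} :=
  <<[seq sbracket D E | D <- vbasis L, E <- vbasis L]>>%VS.

Fact end_par_is_linear d : linear (end_par d).
Proof.
move=> c D E; rewrite /end_par scaler_sumr -big_split /=.
by apply: eq_bigr => b _; rewrite comp_lfunDr comp_lfunDl comp_lfunZl comp_lfunZr.
Qed.

HB.instance Definition _ d :=
  GRing.isLinear.Build F 'End(dpO) 'End(dpO) _ (end_par d) (end_par_is_linear d).

Lemma sbracketPl c D D' E :
  sbracket (c *: D + D') E = c *: sbracket D E + sbracket D' E.
Proof.
rewrite /sbracket scaler_sumr -big_split; apply: eq_bigr => d _ /=.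
rewrite scaler_sumr -big_split; apply: eq_bigr => e _ /=.
rewrite linearP comp_lfunDl comp_lfunDr -comp_lfunZl -comp_lfunZr.
by rewrite scalerDr scalerBr opprD addrACA !scalerA mulrC.
Qed.

Lemma sbracketPr c D E E' :
  sbracket D (c *: E + E') = c *: sbracket D E + sbracket D E'.
Proof.
rewrite /sbracket scaler_sumr -big_split; apply: eq_bigr => d _ /=.
rewrite scaler_sumr -big_split; apply: eq_bigr => e _ /=.
rewrite linearP comp_lfunDl comp_lfunDr -comp_lfunZl -comp_lfunZr.
by rewrite scalerDr scalerBr opprD addrACA !scalerA mulrC.
Qed.

HB.instance Definition _ D :=
  GRing.isLinear.Build F 'End(dpO) 'End(dpO) _ (sbracket D)
    (fun c E E' => sbracketPr c D E E').

Definition sbracketr E D := sbracket D E.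

HB.instance Definition _ E :=
  GRing.isLinear.Build F 'End(dpO) 'End(dpO) _ (sbracketr E)
    (fun c D D' => sbracketPl c D D' E).

Lemma memv_derived (L : {vspace 'End(dpO)}) D E :
  D \in L -> E \in L -> sbracket D E \in derived L.
Proof.
move=> /coord_vbasis-> /coord_vbasis->; rewrite -[sbracket _ _]/(sbracketr _ _).
rewrite linear_sum; apply: rpred_sum => i _; rewrite linearZ.
apply: rpredZ; rewrite -[X in X \in _]/(sbracket _ _) linear_sum; apply: rpred_sum => j _.
rewrite linearZ; apply: rpredZ.
by apply/memv_span/allpairs_f; exact: memt_nth.
Qed.

Definition Wder (f : {ffun svar -> dpO}) : 'End(dpO) :=
  \sum_r fder (f r) (partial r).

Fact Wder_is_linear : linear Wder.
Proof.
move=> c f g; rewrite /Wder scaler_sumr -big_split /=; apply: eq_bigr => r _.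
by rewrite /fder !ffunE linearP comp_lfunDl comp_lfunZl.
Qed.

HB.instance Definition _ :=
  GRing.isLinear.Build F {ffun svar -> dpO} 'End(dpO) _ Wder Wder_is_linear.

Definition Wspace : {vspace 'End(dpO)} := limg (linfun Wder).

Lemma memW D : reflect (exists f, D = Wder f) (D \in Wspace).
Proof.
apply: (iffP memv_imgP) => [[f _ ->]|[f ->]]; exists f; rewrite ?memvf ?lfunE //.
Qed.

(* For even m: the involution i |-> i' and the sign sigma. *)
Definition dualH (r : svar) : svar :=
  match r with
  | inl i => inl (insubd i (if i < m./2 then i + m./2 else i - m./2)%N)
  | inr j => inr j
  end.

Definition sigmaH (r : svar) : F :=
  if r is inl i then (if (i < m./2)%N then 1 else -1) else 1.

Definition DH : 'Hom(dpO, 'End(dpO)) :=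
  linext (fun w => \sum_(i : svar)
    (sigmaH (dualH i) * (-1) ^+ (mu (dualH i) && par_mon w))
      *: fder (partial (dualH i) (mon w)) (partial i)).

Definition Hspace : {vspace 'End(dpO)} :=
  (DH @: <<[seq mon w | w in [pred w : supermon | deg_mon w != top_deg]]>>)%VS.

End DividedPowerSuperalgebra.

(* The operators below live on O(N, n; t) with N <= n: the variables x_1, ...,
   x_(2N) are indexed by 'I_N + 'I_N, and n is N or N + 1. *)
Section OddContact.
Context (F : fieldType) (p N n : nat) (leNn : (N <= n)%N) (t : 'I_N -> nat).
Local Notation O := (dpO F p n t).

Definition var2N (i : 'I_N + 'I_N) : svar N n :=
  match i with inl k => inl k | inr k => inr (widen_ord leNn k) end.

Definition dual2N (i : 'I_N + 'I_N) : 'I_N + 'I_N :=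
  match i with inl k => inr k | inr k => inl k end.

Definition Delta : 'End(O) :=
  \sum_(k : 'I_N) (partial F p t (var2N (inl k))
                     \o partial F p t (var2N (inr k)))%VF.

Definition Euler : 'End(O) :=
  \sum_(i : 'I_N + 'I_N)
    fder (xvar F p t (var2N i)) (partial F p t (var2N i)).

Definition TH : 'Hom(O, 'End(O)) :=
  linext (fun w => \sum_(i : 'I_N + 'I_N)
    (-1) ^+ (mu (var2N (dual2N i)) && par_mon w)
      *: fder (partial F p t (var2N (dual2N i)) (mon F w))
              (partial F p t (var2N i))).

End OddContact.

Section SHO.
Context (F : fieldType) (p N : nat) (t : 'I_N -> nat).

Definition SHO'space : {vspace 'End(dpO F p N t)} :=
  (TH F p (leqnn N) t @: lker (Delta F p (leqnn N) t))%VS.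

Definition SHObar : {vspace 'End(dpO F p N t)} := derived SHO'space.

Definition SHOspace : {vspace 'End(dpO F p N t)} := derived SHObar.

End SHO.

Section KO.
Context (F : fieldType) (p N : nat) (t : 'I_N -> nat).
Local Notation O := (dpO F p N.+1 t).

Definition partial_last : 'End(O) := partial F p t (inr ord_max).

Definition DKO : 'Hom(O, 'End(O)) :=
  linext (fun w =>
    TH F p (leqnSn N) t (mon F w)
    + (-1) ^+ par_mon w *: fder (partial_last (mon F w))
                                (Euler F p (leqnSn N) t)
    + fder (Euler F p (leqnSn N) t (mon F w) - 2%:R *: mon F w) partial_last).

Definition KOspace : {vspace 'End(O)} := limg DKO.

Definition div_lambda (lambda : F) : 'End(O) :=
  linext (fun w =>
    ((-1) ^+ par_mon w * 2%:R)
      *: (Delta F p (leqnSn N) t (mon F w)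
          + (Euler F p (leqnSn N) t - (N%:R * lambda) *: \1)%VF
              (partial_last (mon F w)))).

Definition SKO''space (lambda : F) : {vspace 'End(O)} :=
  (DKO @: lker (div_lambda lambda))%VS.

Definition SKO'space (lambda : F) : {vspace 'End(O)} :=
  derived (SKO''space lambda).

Definition SKOspace (lambda : F) : {vspace 'End(O)} :=
  derived (SKO'space lambda).

End KO.

(* L1 and L2 carry the bracket and the Z/2-grading of the ambient
   endomorphism superalgebras; isomorphisms are even. *)
Definition lsa_isomorphic (F : fieldType) (p m1 n1 m2 n2 : nat)
    (t1 : 'I_m1 -> nat) (t2 : 'I_m2 -> nat)
    (L1 : {vspace 'End(dpO F p n1 t1)}) (L2 : {vspace 'End(dpO F p n2 t2)}) :
    Prop :=
  exists phi : 'Hom('End(dpO F p n1 t1), 'End(dpO F p n2 t2)),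
    [/\ {in L1 &, injective phi},
        (phi @: L1)%VS = L2,
        forall d D, D \in L1 -> end_homog d D -> end_homog d (phi D)
      & {in L1 &, forall D E, phi (sbracket D E) = sbracket (phi D) (phi E)}].

(* Main.v *)
(* The invariant is the superdimension: an even isomorphism preserves the
   dimensions of the two homogeneous parts. They are equal for W and KO and
   differ by at most 2 for H and SHO, while for SKO they differ by at least 6.

   With d = 0 for SHO and d = d_(2N+1) for SKO, put
   P_k = Delta + (D - k) d where D is the Euler operator; then
   P_k P_(k+2) = 0. The algebras SHO' and SKO'' consist of the contact vector
   fields D_a with P_nu(a) = 0, where nu = N lambda = -1 for SKO, and
   [D_a, D_b] = +- D_c with c = P_(nu+2)(a b) for homogeneous a, b in ker P_nu.
   So the derived algebra of {D_a | a in K} is given by the image under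
   R = P_(nu+2) of the span of the products of elements of K. Since P_nu is
   adjoint to R under the pairing by the coefficient of the top monomial, only
   constants are orthogonal to all products of elements of im R. It follows
   that the products of elements of ker P_nu span everything, and that the
   second derived algebra is {D_a | a in R(U)} with U of codimension at most 1.

   It remains to compare the even and odd parts of im R. Exchanging x_i^(a) and
   x_i^(a+1) x_{i'} shows that the monomials having some pair (x_i, x_{i'}) in
   a state other than x_i^(pi_i) or x_{i'} contribute equally to both. For SHO
   all other monomials are killed by R. For SKO such a monomial, with the
   odd variables x_{i'} for i in A and with x_(2N+1), is mapped by R to
   +-(2|A| - N - 1) times the same monomial without x_(2N+1). As N = p + 2, the
   factor vanishes exactly when |A| = (p + 3) / 2, and the two parts of im R differ by
   binomial(p + 2, (p + 3) / 2) >= p + 2. *)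

Require Import Defs.
From mathcomp Require Import all_boot all_order all_algebra.
From mathcomp Require Import zify ring.

Set Implicit Arguments.
Unset Strict Implicit.
Unset Printing Implicit Defensive.

Import GRing.Theory.
Local Open Scope ring_scope.

(** * Signs of products of odd variables *)

(** SHO and SKO share one treatment, with an odd operator [dl] equal to [0] or to [partial_last].
    The operator [P_k] has order two and [D_a] measures its failure to be a derivation, as for
    Batalin-Vilkovisky operators; the commutator formula then follows formally from
    [P_k P_(k+2) = 0], without coordinates. The value of lambda enters through duality. Integration
    by parts turns [P_k] into [P_(-k)] up to parity, so [P_(nu+2)] has transpose [P_(-nu-2)], which
    for nonzero [dl] is [P_nu] exactly when [nu = -1]; and [(p + 2)(p - 1)/2] is [-1] in the field.
    The same value yields an extremal monomial that contains the last odd variable and is killed by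
    [P_nu]. Its product with its complement is a multiple of the top monomial, so no nonzero
    constant is orthogonal to all products of elements of the kernel. A divided power algebra is in
    general not generated by its variables, so its laws cannot be checked on generators. They are
    proved by induction on degree instead: an element with no constant term whose partial
    derivatives all vanish is zero. *)

Section Inversions.
Variable n : nat.
Implicit Types u v z : {set 'I_n}.

Definition nlt (j : 'I_n) u := #|[set k in u | (k < j)%N]|.
Definition ngt (j : 'I_n) u := #|[set k in u | (j < k)%N]|.

Lemma card_set_sum (T : finType) (P : pred T) : #|[set x | P x]| = (\sum_x P x)%N.
Proof.
by rewrite cardsE -sum1_card big_mkcond; apply: eq_bigr => x _; rewrite unfold_in; case: (P x).
Qed.

Lemma sum_setU u v (f : 'I_n -> nat) : [disjoint u & v] ->
  (\sum_(i in u :|: v) f i = \sum_(i in u) f i + \sum_(i in v) f i)%N.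
Proof. by move=> d; rewrite -bigU //; apply: eq_bigl => i; rewrite !inE. Qed.

Lemma inversionsE u v :
  inversions u v = (\sum_(i in u) \sum_(j in v) (j < i)%N)%N.
Proof.
rewrite /inversions card_set_sum.
rewrite -(pair_bigA _ (fun i j : 'I_n => ((i \in u) && (j \in v) && (j < i) : nat)%N)) /=.
rewrite [RHS]big_mkcond; apply: eq_bigr => i _; case: ifP => iu; last by rewrite big1.
by rewrite [RHS]big_mkcond; apply: eq_bigr => j _; case: ifP.
Qed.

Lemma nltE j u : nlt j u = (\sum_(k in u) (k < j)%N)%N.
Proof. by rewrite /nlt card_set_sum [RHS]big_mkcond; apply: eq_bigr => k _; case: ifP. Qed.

Lemma ngtE j u : ngt j u = (\sum_(k in u) (j < k)%N)%N.
Proof. by rewrite /ngt card_set_sum [RHS]big_mkcond; apply: eq_bigr => k _; case: ifP. Qed.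

Lemma nltU j u v : [disjoint u & v] -> nlt j (u :|: v) = (nlt j u + nlt j v)%N.
Proof. by move=> d; rewrite !nltE sum_setU. Qed.

Lemma inversionsUl u v z :
  [disjoint u & v] -> inversions (u :|: v) z = (inversions u z + inversions v z)%N.
Proof. by move=> d; rewrite !inversionsE sum_setU. Qed.

Lemma inversionsUr u v z :
  [disjoint u & v] -> inversions z (u :|: v) = (inversions z u + inversions z v)%N.
Proof.
move=> d; rewrite !inversionsE -big_split; apply: eq_bigr => i _; exact: sum_setU.
Qed.

Lemma inversions1l j v : inversions [set j] v = nlt j v.
Proof. by rewrite inversionsE big_set1 nltE. Qed.

Lemma inversions1r j u : inversions u [set j] = ngt j u.
Proof. by rewrite inversionsE ngtE; apply: eq_bigr => i _; rewrite big_set1. Qed.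

Lemma nltD1 j u : nlt j (u :\ j) = nlt j u.
Proof.
rewrite /nlt; apply: eq_card => k; rewrite !inE; case: eqP => // ->.
by rewrite ltnn !andbF.
Qed.

Lemma ngtD1 j u : ngt j (u :\ j) = ngt j u.
Proof.
rewrite /ngt; apply: eq_card => k; rewrite !inE; case: eqP => // ->.
by rewrite ltnn !andbF.
Qed.

Lemma nlt_ngt j u : (nlt j u + ngt j u)%N = #|u :\ j|.
Proof.
rewrite -nltD1 -ngtD1 nltE ngtE -big_split -sum1_card; apply: eq_bigr => k.
by rewrite !inE -val_eqE /=; case: ltngtP.
Qed.

Lemma inversionsD1l j u v :
  j \in u -> inversions u v = (nlt j v + inversions (u :\ j) v)%N.
Proof.
move=> ju; rewrite -inversions1l -inversionsUl ?setD1K //.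
by rewrite disjoints1 !inE eqxx.
Qed.

Lemma inversionsD1r j u v :
  j \in v -> inversions u v = (ngt j u + inversions u (v :\ j))%N.
Proof.
move=> ju; rewrite -inversions1r -inversionsUr ?setD1K //.
by rewrite disjoints1 !inE eqxx.
Qed.

Lemma inversionsC u v :
  [disjoint u & v] -> (inversions u v + inversions v u)%N = (#|u| * #|v|)%N.
Proof.
move=> d; rewrite !inversionsE [X in (_ + X)%N]exchange_big -big_split /=.
rewrite -sum_nat_const; apply: eq_bigr => i iu.
rewrite -big_split /= -sum1_card; apply: eq_bigr => j jv.
have: i != j by apply: contraTneq jv => <-; rewrite (disjointFr d).
by rewrite -val_eqE /=; case: ltngtP.
Qed.

Lemma inversions0l v : inversions set0 v = 0%N.
Proof. by rewrite inversionsE big_set0. Qed.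

Variable F : fieldType.

(** The coefficient of [x^z] in the product [x^u x^v] of the exterior algebra. *)
Definition oddmul u v z : F :=
  if [disjoint u & v] && (z == u :|: v) then (-1) ^+ inversions u v else 0.

(** The super Leibniz rule for the odd derivative [partial_j] applied to [x^u x^v], read off at the
    coefficient of [x^z]. *)
Lemma oddmulD1 j u v z : j \notin z ->
  (-1) ^+ nlt j z * oddmul u v (j |: z) =
    (if j \in u then (-1) ^+ nlt j u * oddmul (u :\ j) v z else 0)
  + (-1) ^+ #|u| * (if j \in v then (-1) ^+ nlt j v * oddmul u (v :\ j) z else 0).
Proof.
move=> jz.
have key (w : {set 'I_n}) : (j \notin z) -> (j |: z == w) = (j \in w) && (z == w :\ j).
  move=> _; apply/eqP/andP => [<-|[jw /eqP->]]; last by rewrite setD1K.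
  by rewrite setU11 setU1K.
rewrite /oddmul key // inE.
case: (boolP (j \in u)) => ju; case: (boolP (j \in v)) => jv /=.
- have -> : [disjoint u & v] = false.
    by apply/negP => d; move: jv; rewrite (disjointFr d ju).
  rewrite mulr0.
  have E1 : [disjoint u :\ j & v] = [disjoint u :\ j & v :\ j].
    rewrite -!setI_eq0; congr (_ == set0); apply/setP => k; rewrite !inE.
    by case: eqP.
  have E2 : [disjoint u & v :\ j] = [disjoint u :\ j & v :\ j].
    rewrite -!setI_eq0; congr (_ == set0); apply/setP => k; rewrite !inE.
    by case: eqP; rewrite ?andbF.
  rewrite E1 E2.
  have jN : j \notin u :\ j :|: v :\ j by rewrite !inE eqxx.
  have -> : u :\ j :|: v = j |: (u :\ j :|: v :\ j).
    by apply/setP => k; rewrite !inE; case: eqP => [->|] /=; rewrite ?ju ?jv ?orbT ?orbF.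
  have -> : u :|: v :\ j = j |: (u :\ j :|: v :\ j).
    by apply/setP => k; rewrite !inE; case: eqP => [->|] /=; rewrite ?ju ?jv ?orbT ?orbF.
  have -> : (z == j |: (u :\ j :|: v :\ j)) = false.
    by apply/negP => /eqP E; move: jz; rewrite E setU11.
  by rewrite andbF !mulr0 addr0.
- have -> : [disjoint u & v] = [disjoint u :\ j & v].
    rewrite -!setI_eq0; congr (_ == set0); apply/setP => k; rewrite !inE.
    by case: eqP => // ->; rewrite (negPf jv) andbF.
  have -> : (u :|: v) :\ j = u :\ j :|: v.
    by apply/setP => k; rewrite !inE; case: eqP => // ->; rewrite (negPf jv).
  rewrite mulr0 addr0; case: ifP => [/andP[d /eqP->]|]; last by rewrite !mulr0.
  rewrite nltU // nltD1 (inversionsD1l v ju) !exprD -mulrA; congr (_ * _).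
  by rewrite signrMK.
- have -> : [disjoint u & v] = [disjoint u & v :\ j].
    rewrite -!setI_eq0; congr (_ == set0); apply/setP => k; rewrite !inE.
    by case: eqP => // ->; rewrite (negPf ju).
  have -> : (u :|: v) :\ j = u :|: v :\ j.
    by apply/setP => k; rewrite !inE; case: eqP => // ->; rewrite (negPf ju).
  rewrite add0r; case: ifP => [/andP[d /eqP->]|]; last by rewrite !mulr0.
  rewrite nltU // nltD1 (inversionsD1r u jv) !exprD.
  have <- : (nlt j u + ngt j u)%N = #|u|.
    by rewrite nlt_ngt; apply: eq_card => k; rewrite !inE; case: eqP => // ->; rewrite (negPf ju).
  by rewrite exprD -!mulrA; congr (_ * _); rewrite mulrCA; congr (_ * _); rewrite mulrC.
- by rewrite andbF !mulr0 addr0.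
Qed.

(** The Leibniz rule at a monomial containing [x_j], which no derivative by [x_j] contains. The two
    terms are both nonzero only if [j] lies in [u] and in [v], where they cancel because [x_j] has
    square zero. *)
Lemma oddmulD1_0 j u v z : j \in z ->
    (if j \in u then (-1) ^+ nlt j u * oddmul (u :\ j) v z else 0)
  + (-1) ^+ #|u| * (if j \in v then (-1) ^+ nlt j v * oddmul u (v :\ j) z else 0) = 0.
Proof.
move=> jz; case: (boolP (j \in u)) => ju; case: (boolP (j \in v)) => jv.
- rewrite /oddmul.
  have -> : [disjoint u :\ j & v] = [disjoint u :\ j & v :\ j].
    rewrite -!setI_eq0; congr (_ == set0); apply/setP => k; rewrite !inE.
    by case: eqP.
  have -> : [disjoint u & v :\ j] = [disjoint u :\ j & v :\ j].
    rewrite -!setI_eq0; congr (_ == set0); apply/setP => k; rewrite !inE.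
    by case: eqP; rewrite ?andbF.
  have -> : u :\ j :|: v = u :|: v.
    by apply/setP => k; rewrite !inE; case: eqP => [->|] /=; rewrite ?ju ?jv.
  have -> : u :|: v :\ j = u :|: v.
    by apply/setP => k; rewrite !inE; case: eqP => [->|] /=; rewrite ?ju ?jv.
  case: ifP => _; last by rewrite !mulr0 addr0.
  rewrite (inversionsD1r (u :\ j) jv) (inversionsD1l (v :\ j) ju) ngtD1 nltD1.
  rewrite (cardsD1 j u) ju add1n -(nlt_ngt j u) exprS mulN1r mulNr.
  apply/eqP; rewrite subr_eq0; apply/eqP; rewrite !exprD.
  by rewrite signrMK -!mulrA.
- rewrite mulr0 addr0 /oddmul; case: andP => [[_ /eqP E]|]; last by rewrite mulr0.
  by move: jz; rewrite E !inE eqxx (negPf jv).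
- rewrite add0r /oddmul; case: andP => [[_ /eqP E]|]; last by rewrite !mulr0.
  by move: jz; rewrite E !inE eqxx (negPf ju).
- by rewrite mulr0 addr0.
Qed.

End Inversions.

(* The right-hand sides of the [linear*] lemmas show a coercion of [f] to an
   abstract linear map, on which later rewriting gets stuck. *)
Section LinearFunctions.
Context (F : fieldType) (U V : vectType F).
Implicit Types (f g : 'Hom(U, V)) (a b : U) (c : F).

Lemma lfun_linear f c a b : f (c *: a + b) = c *: f a + f b.
Proof. exact: linearP. Qed.

Lemma lfunD f a b : f (a + b) = f a + f b. Proof. exact: linearD. Qed.
Lemma lfunN f a : f (- a) = - f a. Proof. exact: linearN. Qed.
Lemma lfunB f a b : f (a - b) = f a - f b. Proof. exact: linearB. Qed.
Lemma lfunZ f c a : f (c *: a) = c *: f a. Proof. exact: linearZ. Qed.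
Lemma lfun0 f : f 0 = 0. Proof. exact: linear0. Qed.

Lemma lfun_sum f (I : Type) (r : seq I) (P : pred I) (h : I -> U) :
  f (\sum_(i <- r | P i) h i) = \sum_(i <- r | P i) f (h i).
Proof. exact: linear_sum. Qed.

End LinearFunctions.

Section LinearExtensionTheory.
Context (F : fieldType) (B : finType) (V : vectType F).
Implicit Types (a : {ffun B -> F^o}).

Lemma basis_expand a : a = \sum_w (a w : F) *: basis_elt F w.
Proof.
apply/ffunP => w; rewrite sum_ffunE (bigD1 w) //= !ffunE eqxx.
rewrite big1 ?addr0 => [|w' w'w]; first by rewrite /GRing.scale /= mulr1.
by rewrite !ffunE eq_sym (negPf w'w) /GRing.scale /= mulr0.
Qed.

Lemma basis_ind (P : {ffun B -> F^o} -> Prop) :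
  P 0 -> (forall c a b, P a -> P b -> P ((c : F) *: a + b)) ->
  (forall w, P (basis_elt F w)) -> forall a, P a.
Proof.
move=> P0 Pl Pb a; rewrite [a]basis_expand.
elim/big_rec: _ => // w b _; apply: Pl; exact: Pb.
Qed.

Lemma hom_basis_eq (f g : 'Hom({ffun B -> F^o}, V)) :
  (forall w, f (basis_elt F w) = g (basis_elt F w)) -> f = g.
Proof.
move=> fg; apply/lfunP; apply: basis_ind => [|c a b fa fb|//].
by rewrite !linear0.
by rewrite !lfun_linear fa fb.
Qed.

End LinearExtensionTheory.

(** * Binomial coefficients and divided powers in characteristic p *)

Section DividedPowers.
Context (F : fieldType) (p : nat).
Hypothesis charFp : p \in [pchar F].

(* The coefficient of x^(c) in x^(a) x^(b). *)
Definition dpcoef (a b c : nat) : F := if c == (a + b)%N then 'C(a + b, a)%:R else 0.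

(** From [a C(p^k, a) = p^k C(p^k - 1, a - 1)], since [a < p^k] has p-adic valuation less than
    [k]. *)
Lemma binF0 k a : (0 < a < p ^ k)%N -> ('C(p ^ k, a)%:R : F) = 0.
Proof.
move=> /andP[a0 ak]; have pp := pcharf_prime charFp.
apply/eqP; rewrite -(dvdn_pcharf charFp).
have k0 : (0 < p ^ k)%N by rewrite expn_gt0 prime_gt0.
have E : (a * 'C(p ^ k, a) = p ^ k * 'C((p ^ k).-1, a.-1))%N.
  by rewrite mul_bin_diag prednK.
have C0 : (0 < 'C(p ^ k, a))%N by rewrite bin_gt0 ltnW.
have C1 : (0 < 'C((p ^ k).-1, a.-1))%N by rewrite bin_gt0; lia.
have := congr1 (logn p) E; rewrite !lognM // pfactorK // => El.
have la : (logn p a < k)%N.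
  rewrite ltnNge; apply/negP => lk.
  have := dvdn_leq a0 (dvdn_trans (dvdn_exp2l p lk) (pfactor_dvdnn p a)).
  by rewrite leqNgt ak.
rewrite -[X in (X %| _)%N]expn1 pfactor_dvdn //; lia.
Qed.

(** Pascal's rule as the Leibniz rule for [x^(a) x^(b)]. At the truncation, where the product
    vanishes, the right-hand side is [C(p^k, a)] for some [0 < a < p^k], which is zero by
    [binF0]. *)
Lemma dpcoefS k a b c : (a < p ^ k)%N -> (b < p ^ k)%N -> (c < p ^ k)%N ->
  (if (c.+1 < p ^ k)%N then dpcoef a b c.+1 else 0) =
    (if a is a'.+1 then dpcoef a' b c else 0) + (if b is b'.+1 then dpcoef a b' c else 0).
Proof.
move=> ha hb hc; rewrite /dpcoef; case: a ha => [|a] ha; case: b hb => [|b] hb.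
- by rewrite addn0 /= if_same addr0.
- rewrite add0r !add0n eqSS !bin0; case: ifP => //; case: eqP => // E; lia.
- rewrite addr0 !addn0 eqSS !binn; case: ifP => //; case: eqP => // E; lia.
- have E : 'C(a.+1 + b.+1, a.+1) = ('C(a + b.+1, a) + 'C(a.+1 + b, a.+1))%N.
    by rewrite !addSn !addnS binS addnC.
  have -> : (c.+1 == a.+1 + b.+1)%N = (c == a + b.+1)%N by rewrite addSn eqSS.
  have -> : (c == a.+1 + b)%N = (c == a + b.+1)%N by rewrite addSnnS.
  case: (c =P _) => [cE|_]; last by rewrite if_same addr0.
  rewrite -natrD -E; case: ltnP => // h.
  have -> : (a.+1 + b.+1 = p ^ k)%N by lia.
  by rewrite binF0 // ha.
Qed.

(** Used for the pairing by the top coefficient: complementary divided powers multiply to the top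
    one up to sign, hence never to zero. *)
Lemma bin_predF k a : (a < p ^ k)%N -> ('C((p ^ k).-1, a)%:R : F) = (-1) ^+ a.
Proof.
elim: a => [|a IH] ha; first by rewrite bin0.
have E : 'C(p ^ k, a.+1) = ('C((p ^ k).-1, a.+1) + 'C((p ^ k).-1, a))%N.
  by rewrite -binS prednK //; lia.
have : ('C(p ^ k, a.+1)%:R : F) = 0 by apply: binF0; rewrite ha.
rewrite E natrD IH 1?ltnW // => /eqP; rewrite addr_eq0 => /eqP ->.
by rewrite exprS mulN1r.
Qed.

End DividedPowers.

Section Coordinates.
Context (F : fieldType) (V : vectType F).
Implicit Types (x y : V).

Definition coordv i x : F := coord (vbasis {:V}) i x.

Lemma coordvD i x y : coordv i (x + y) = coordv i x + coordv i y.
Proof. exact: linearD. Qed.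
Lemma coordvN i x : coordv i (- x) = - coordv i x.
Proof. exact: linearN. Qed.
Lemma coordvZ i c x : coordv i (c *: x) = c * coordv i x.
Proof. exact: linearZ. Qed.
Lemma coordv0 i : coordv i 0 = 0.
Proof. exact: linear0. Qed.
Lemma coordv_inj x y : (forall i, coordv i x = coordv i y) -> x = y.
Proof.
move=> h; rewrite (coord_vbasis (memvf x)) (coord_vbasis (memvf y)).
by apply: eq_bigr => i _; rewrite -!/(coordv _ _) h.
Qed.

Definition coordvE := (coordvD, coordvN, coordvZ, coordv0).

End Coordinates.

(* Decides linear identities in a vector space, by coordinates. *)
Ltac vec := apply: coordv_inj => ?; rewrite !coordvE; ring.

Lemma sqr1 (F : fieldType) (s : F) : s * s = 1 -> s = 1 \/ s = - 1.
Proof.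
move/eqP; rewrite -expr2 sqrf_eq1 => /orP[] /eqP; [by left | by right].
Qed.

(** The formal content of the product rule [Pop_lmul]. The term [-2 eps(c) dl(b)] of the contact
    field is what lowers the parameter by 2 on the second factor. *)
Lemma contact_operator_mul (F : fieldType) (V : vectType F) (mul : 'Hom(V, 'End(V)))
    (eps dl E Dl : 'End(V)) (kap : F) (c b Tb Db : V) :
  Dl (mul c b) = mul (Dl c) b + mul (eps c) (Dl b) + Tb ->
  Db = Tb + mul (dl c) (E b) + mul (E (eps c) - 2%:R *: eps c) (dl b) ->
  dl (mul c b) = mul (dl c) b + mul (eps c) (dl b) ->
  (forall x y, E (mul x y) = mul (E x) y + mul x (E y)) ->
  Dl (mul c b) + (E (dl (mul c b)) - kap *: dl (mul c b)) =
    mul (Dl c + (E (dl c) - kap *: dl c)) b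
    + mul (eps c) (Dl b + (E (dl b) - (kap - 2%:R) *: dl b)) + Db.
Proof.
move=> -> -> -> EM; rewrite lfunD !EM !(lfunD, lfunN, lfunZ).
by rewrite !(add_lfunE, opp_lfunE, scale_lfunE); vec.
Qed.

Lemma dim_img_codim (F : fieldType) (V1 V2 : vectType F) (f : 'Hom(V1, V2))
    (A B : {vspace V1}) (k : nat) :
  (A <= B)%VS -> (\dim B <= \dim A + k)%N -> (\dim (f @: B) <= \dim (f @: A) + k)%N.
Proof.
move=> AB hk; have E := addv_diff B A; rewrite (addv_idPl AB) in E.
rewrite -E limgD addnC; apply: leq_trans (dimv_add_leqif _ _) _.
rewrite leq_add2r -(leq_add2l (\dim A)); apply: leq_trans hk.
have := dimv_cap_compl B A; rewrite (capv_idPr AB) => <-.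
by rewrite leq_add2l -(limg_ker_dim f (B :\: A)) leq_addl.
Qed.

Lemma card_involutive (T : finType) (q q' : pred T) (f : T -> T) :
  involutive f -> (forall w, q' (f w) = q w) -> #|q| = #|q'|.
Proof.
move=> fK h; rewrite -(card_image (inv_inj fK) q); apply: eq_card => w.
rewrite -[w in LHS]fK mem_image; last exact: inv_inj.
by rewrite -[in RHS](fK w) -!topredE /= h.
Qed.

(** * The commutator of contact fields, from the axioms of a second-order operator *)

Section AbstractContact.
Context (F : fieldType) (V : vectType F) (mul : 'Hom(V, 'End(V))).
Variables (eps dl : 'End(V)) (P : F -> 'End(V)) (D : 'Hom(V, 'End(V))).
Local Notation "a ** b" := (mul a b) (at level 40, left associativity).
Implicit Types (a b c x y : V).

Hypothesis dl_mul : forall a b, dl (a ** b) = dl a ** b + eps a ** dl b.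
Hypothesis P_shift : forall k k' x, P k x = P k' x - (k - k') *: dl x.
Hypothesis P_P : forall k x, P k (P (k + 2%:R) x) = 0.
Hypothesis P_mul : forall k c b,
  P k (c ** b) = P k c ** b + eps c ** P (k - 2%:R) b + D (eps c) b.

Hypothesis mulA : forall a b c, a ** b ** c = a ** (b ** c).
Hypothesis eps_mul : forall a b, eps (a ** b) = eps a ** eps b.
Hypothesis P_eps : forall k a, P k (eps a) = - eps (P k a).

Variables (nu : F).
Local Notation Q := (P (nu - 2%:R)).
Local Notation R := (P (nu + 2%:R)).

Let mulDl a a' b : (a + a') ** b = a ** b + a' ** b.
Proof. by rewrite lfunD add_lfunE. Qed.
Let mulZl k a b : (k *: a) ** b = k *: (a ** b).
Proof. by rewrite lfunZ scale_lfunE. Qed.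
Let mulNl a b : (- a) ** b = - (a ** b).
Proof. by rewrite lfunN opp_lfunE. Qed.

(** On the kernel of [P nu] the product rule can be solved for [D c]. Contact fields thereby become
    words in [P] and multiplication, to which [P_P] applies. *)
Lemma ker_formula (s : F) c x : s * s = 1 -> eps c = s *: c -> P nu c = 0 ->
  D c x = s *: P nu (c ** x) - c ** Q x.
Proof.
move=> ss hc Pc; rewrite P_mul Pc lfun0 zero_lfunE add0r hc mulZl lfunZ scale_lfunE.
by rewrite scalerDr !scalerA ss !scale1r addrAC subrr add0r.
Qed.

Section Bracket.
Variables (s u sg : F) (a b : V).
Hypotheses (ss : s * s = 1) (uu : u * u = 1) (sgsg : sg * sg = 1).
Hypotheses (ea : eps a = s *: a) (eb : eps b = u *: b).
Hypotheses (Pa : P nu a = 0) (Pb : P nu b = 0).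
Hypothesis Da_der : forall x, D a (b ** x) = D a b ** x + sg *: (b ** D a x).
Hypothesis dla_comm : forall x, b ** (dl a ** x) = sg *: (dl a ** b ** x).

Let QE x : Q x = P nu x + 2%:R *: dl x.
Proof. by rewrite (P_shift _ nu); vec. Qed.
Let RE x : R x = P nu x - 2%:R *: dl x.
Proof. by rewrite (P_shift _ nu); vec. Qed.

(** Obtained by expanding [P nu (R (a ** x)) = 0]. *)
Lemma D_P x : D a (P nu x) = - s *: P nu (D a x) + 2%:R *: P nu (dl a ** x).
Proof.
have QP : Q (P nu x) = 0 by have := P_P (nu - 2%:R) x; rewrite subrK.
rewrite (ker_formula _ ss ea Pa) QP lfun0 subr0.
have h1 : R (a ** x) = s *: D a x - 2%:R *: (dl a ** x) + s *: (a ** P nu x).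
  rewrite RE dl_mul ea mulZl (ker_formula _ ss ea Pa) QE lfunD lfunZ scalerBr scalerA ss.
  by rewrite scale1r; vec.
have := P_P nu (a ** x); rewrite h1 !(lfunD, lfunN, lfunZ) => h2.
have h3 : s *: P nu (a ** P nu x) = - (s *: P nu (D a x) - 2%:R *: P nu (dl a ** x)).
  by apply/eqP; rewrite -addr_eq0 addrC h2.
by rewrite h3; vec.
Qed.

(** By [ker_formula], [Q (D a x)] is [- Q (a ** Q x)], because [Q] kills the image of [P nu]; the
    product rule for [Q] then brings back [D a (Q x)]. *)
Lemma D_Q x : D a (Q x) = - s *: (Q (D a x) + 2%:R *: (dl a ** Q x)).
Proof.
have PP : P (nu - 2%:R - 2%:R) (Q x) = 0 by have := P_P (nu - 2%:R - 2%:R) x; rewrite subrK.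
have h1 : D a x = s *: P nu (a ** x) - a ** Q x := ker_formula x ss ea Pa.
have QPa : Q (P nu (a ** x)) = 0 by have := P_P (nu - 2%:R) (a ** x); rewrite subrK.
rewrite h1 lfunB lfunZ QPa scaler0 sub0r P_mul PP lfun0 addr0 ea.
have -> : Q a = 2%:R *: dl a by rewrite QE Pa add0r.
rewrite !(lfunZ, scale_lfunE).
have -> : forall y z, - s *: (- (2%:R *: y + s *: z) + 2%:R *: y) = (s * s) *: z.
  by move=> y z; vec.
by rewrite ss scale1r.
Qed.

(** The element [R (a ** b)] lies in the kernel of [P nu] as well, so [ker_formula] rewrites all
    three contact fields, and [D_P] and [D_Q] move [D a] inside. *)
Lemma D_bracket x :
  D a (D b x) + s * sg *: D b (D a x) = s *: D (R (a ** b)) x.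
Proof.
have Pc : P nu (R (a ** b)) = 0 by apply: P_P.
have ec : eps (R (a ** b)) = - (s * u) *: R (a ** b).
  apply/eqP; rewrite scaleNr -eqr_oppLR -P_eps eps_mul ea eb mulZl !lfunZ scalerA.
  by rewrite eqxx.
have cE : R (a ** b) = s *: D a b - 2%:R *: (dl a ** b).
  rewrite (ker_formula _ ss ea Pa) QE Pb add0r RE dl_mul ea mulZl lfunZ scalerBr !scalerA ss
    scale1r.
  by vec.
have sc : (- (s * u)) * (- (s * u)) = 1 by rewrite mulrNN mulrACA ss uu mulr1.
rewrite (ker_formula x sc ec Pc) cE (ker_formula x uu eb Pb) (ker_formula (D a x) uu eb Pb).
rewrite lfunB lfunZ D_P !Da_der D_Q !(mulDl, mulNl, mulZl) !(lfunD, lfunN, lfunZ) dla_comm !mulA.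
(* What remains is linear in six vectors, with coefficients that are polynomials in three signs; the
   eight choices of signs are checked separately. *)
move: (P nu (D a b ** x)) (P nu (b ** D a x)) (P nu (dl a ** (b ** x))) (D a b ** Q x)
  (b ** Q (D a x)) (dl a ** (b ** Q x)) => X1 X2 X3 X4 X5 X6.
apply: coordv_inj => i; rewrite !coordvE.
move: (coordv i X1) (coordv i X2) (coordv i X3) (coordv i X4) (coordv i X5) (coordv i X6).
move: ss uu sgsg; clear => ss uu sgsg y1 y2 y3 y4 y5 y6.
case: (sqr1 ss) => ->; case: (sqr1 uu) => ->; case: (sqr1 sgsg) => ->; ring.
Qed.

End Bracket.
End AbstractContact.

(** * The superalgebra O(m, n; t) *)

Section MonomialSpans.
Context (F : fieldType) (p m n : nat) (t : 'I_m -> nat).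
Local Notation O := (dpO F p n t).
Local Notation M := (supermon p n t).
Implicit Types (a b : O) (w : M) (q : pred M) (d : bool).

Definition diagop q : 'End(O) := linext (fun w => if q w then mon F w else 0).

(** As the image of a coordinate projection, so that membership means vanishing of coefficients. *)
Definition mspan q : {vspace O} := limg (diagop q).

Definition Opar d : {vspace O} := mspan (fun w => par_mon w == d).

Lemma mon_ind (P : O -> Prop) :
  P 0 -> (forall c a b, P a -> P b -> P ((c : F) *: a + b)) ->
  (forall w, P (mon F w)) -> forall a, P a.
Proof. exact: basis_ind. Qed.

Lemma mon_coef w w' : mon F w w' = (w' == w)%:R.
Proof. by rewrite ffunE. Qed.

Lemma diagop_mon q w : diagop q (mon F w) = if q w then mon F w else 0.
Proof. exact: linext_basis. Qed.

Lemma diagopE q a w : diagop q a w = if q w then a w else 0.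
Proof.
elim/mon_ind: a => [|c a b IHa IHb|w']; first by rewrite lfun0 ffunE if_same.
  rewrite lfun_linear !ffunE IHa IHb; case: ifP => // _.
  by rewrite /GRing.scale /= mulr0 addr0.
rewrite diagop_mon mon_coef; case: ifP => [qw'|qw'].
  by rewrite mon_coef; case: (w =P w') => [->|_]; rewrite ?qw' ?if_same.
by rewrite ffunE; case: (w =P w') => [->|_]; rewrite ?qw' ?if_same.
Qed.

Lemma mspanP q a : reflect (forall w, ~~ q w -> a w = 0) (a \in mspan q).
Proof.
apply: (iffP memv_imgP) => [[b _ ->] w qw|aq]; first by rewrite diagopE (negPf qw).
exists a; rewrite ?memvf //; apply/ffunP => w; rewrite diagopE.
by case: ifPn => // /aq.
Qed.

Lemma diagop_id q a : a \in mspan q -> diagop q a = a.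
Proof. by move/mspanP=> aq; apply/ffunP => w; rewrite diagopE; case: ifPn => // /aq. Qed.

Lemma mem_mspan_mon q w : (mon F w \in mspan q) = q w.
Proof.
apply/mspanP/idP => [h|qw w' qw']; last first.
  by rewrite mon_coef; case: eqP qw' => // ->; rewrite qw.
apply: contraT => /h/eqP; by rewrite mon_coef eqxx oner_eq0.
Qed.

Lemma mspan_ind q (P : O -> Prop) :
  P 0 -> (forall c a b, P a -> P b -> P ((c : F) *: a + b)) ->
  (forall w, q w -> P (mon F w)) -> forall a, a \in mspan q -> P a.
Proof.
move=> P0 Pl Pb a /mspanP aq; rewrite [a]basis_expand.
elim/big_rec: _ => // w b _ Pbb; case: (boolP (q w)) => [qw|/aq ->].
  by apply: Pl => //; exact: Pb.
by rewrite scale0r add0r.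
Qed.

Lemma mspan_sub q q' : {subset q <= q'} -> (mspan q <= mspan q')%VS.
Proof.
move=> qq'; apply/subvP => a /mspanP aq; apply/mspanP => w qw; apply: aq.
by apply: contra qw; apply: qq'.
Qed.

Lemma eq_mspan q q' : q =1 q' -> mspan q = mspan q'.
Proof. by move=> e; apply/eqP; rewrite eqEsubv !mspan_sub // => w; rewrite -!topredE /= e. Qed.

Lemma mspan_free (q : pred M) : free [seq mon F w | w in q].
Proof.
rewrite /image_mem; have := enum_uniq q; elim: (enum q) => [|w s IH] /=; first by rewrite nil_free.
move=> /andP[ws us]; rewrite free_cons IH // andbT.
apply: contra ws => ws.
have /subvP/(_ _ ws) : (<<[seq mon F x | x <- s]>> <= mspan (mem s))%VS.
  by apply/span_subvP => a /mapP[x xs ->]; rewrite mem_mspan_mon.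
by rewrite mem_mspan_mon.
Qed.

Lemma mspan_span q : mspan q = <<[seq mon F w | w in q]>>%VS.
Proof.
apply/eqP; rewrite eqEsubv; apply/andP; split; apply/subvP => a.
  elim/mspan_ind => [|c b b' hb hb'|w qw]; first exact: rpred0.
    by rewrite rpredD // rpredZ.
  by apply/memv_span/image_f.
apply/subvP/span_subvP => _ /imageP[w qw ->]; by rewrite mem_mspan_mon.
Qed.

Lemma dim_mspan (q : pred M) : \dim (mspan q) = #|q|.
Proof. by rewrite mspan_span (eqnP (mspan_free q)) size_image. Qed.

Lemma mspanU q q' : (mspan q + mspan q')%VS = mspan (predU q q').
Proof.
apply/eqP; rewrite eqEsubv subv_add -andbA; apply/and3P; split.
- by apply: mspan_sub => w; rewrite -!topredE /= => ->.
- by apply: mspan_sub => w; rewrite -!topredE /= => ->; rewrite orbT.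
apply/subvP => a; elim/mspan_ind => [|c b b' hb hb'|w /= /orP[]qw]; first exact: rpred0.
- by rewrite rpredD // rpredZ.
- by apply: subvP (addvSl _ _) _ _; rewrite mem_mspan_mon.
- by apply: subvP (addvSr _ _) _ _; rewrite mem_mspan_mon.
Qed.

Lemma mspanI q q' : (mspan q :&: mspan q')%VS = mspan (predI q q').
Proof.
apply/vspaceP => a; rewrite memv_cap; apply/andP/mspanP => [[/mspanP h /mspanP h'] w|h].
  by rewrite /= negb_and => /orP[/h|/h'].
by split; apply/mspanP => w qw; apply: h; rewrite /= (negPf qw) ?andbF.
Qed.

Lemma mspan_all q : (forall w, q w) -> mspan q = fullv.
Proof. by move=> qT; apply/vspaceP => a; rewrite memvf; apply/mspanP => w; rewrite qT. Qed.

Lemma Opar_proj d a : proj_par F p n t d a \in Opar d.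
Proof. by rewrite /Opar memv_img ?memvf. Qed.

Lemma proj_par_id d a : a \in Opar d -> proj_par F p n t d a = a.
Proof. exact: diagop_id. Qed.

Lemma proj_par_other d a : a \in Opar d -> proj_par F p n t (~~ d) a = 0.
Proof.
move/mspanP=> h; apply/ffunP => w; rewrite [LHS]diagopE ffunE; case: eqP => // E.
by apply: h; rewrite E; case: (d).
Qed.

Lemma proj_par_sum a : proj_par F p n t false a + proj_par F p n t true a = a.
Proof.
apply/ffunP => w; rewrite ffunE [X in X + _]diagopE [X in _ + X]diagopE.
by case: (par_mon w); rewrite ?add0r ?addr0.
Qed.

Lemma mon_Opar w : mon F w \in Opar (par_mon w).
Proof. by rewrite mem_mspan_mon. Qed.

(** The parity automorphism. It states the sign rules of superderivations linearly, for elements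
    that need not be homogeneous. *)
Definition parop : 'End(O) := linext (fun w => (-1) ^+ par_mon w *: mon F w).

Lemma parop_mon w : parop (mon F w) = (-1) ^+ par_mon w *: mon F w.
Proof. exact: linext_basis. Qed.

Lemma parop_Opar d a : a \in Opar d -> parop a = (-1) ^+ d *: a.
Proof.
elim/mspan_ind => [|c b b' hb hb'|w /eqP<-]; first by rewrite lfun0 scaler0.
  by rewrite lfun_linear hb hb' scalerDr !scalerA mulrC.
exact: parop_mon.
Qed.

Lemma paropK a : parop (parop a) = a.
Proof.
elim/mon_ind: a => [|c a b IHa IHb|w]; first by rewrite !lfun0.
  by rewrite !lfun_linear IHa IHb.
by rewrite parop_mon lfunZ parop_mon scalerA -signr_addb addbb scale1r.
Qed.

End MonomialSpans.

Section Coefficients.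
Context (F : fieldType) (p m n : nat) (t : 'I_m -> nat).
Hypotheses (charFp : p \in [pchar F]) (t_gt0 : forall i, (0 < t i)%N).
Local Notation O := (dpO F p n t).
Local Notation M := (supermon p n t).
Local Notation "a ** b" := (lmul F p n t a b) (at level 40, left associativity).
Local Notation eps := (parop F p n t).
Local Notation d_ := (partial F p t).
Implicit Types (a b : O) (w : M) (i : 'I_m) (j : 'I_n).

Let p_gt1 : (1 < p)%N := prime_gt1 (pcharf_prime charFp).

Lemma pt_gt1 i : (1 < p ^ t i)%N.
Proof. by rewrite -(exp1n (t i)) ltn_exp2r. Qed.

Lemma supermon_eqP (w w' : M) :
  (forall i, w.1 i = w'.1 i :> nat) -> w.2 = w'.2 -> w = w'.
Proof.
case: w w' => [e u] [e' u'] /= ee' ->; congr (_, _).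
by apply/ffunP => i; apply/val_inj/ee'.
Qed.

Lemma supermon_eqE (w w' : M) :
  (w == w') = [forall i, w.1 i == w'.1 i :> nat] && (w.2 == w'.2).
Proof.
apply/eqP/andP => [->|[/forallP h /eqP h2]]; first by split=> //; apply/forallP.
by apply: supermon_eqP => // i; apply/eqP.
Qed.

Lemma lmulDl a a' b : (a + a') ** b = a ** b + a' ** b.
Proof. by rewrite lfunD add_lfunE. Qed.
Lemma lmulZl c a b : (c *: a) ** b = c *: (a ** b).
Proof. by rewrite lfunZ scale_lfunE. Qed.
Lemma lmulNl a b : (- a) ** b = - (a ** b).
Proof. by rewrite lfunN opp_lfunE. Qed.
Lemma lmulBl a a' b : (a - a') ** b = a ** b - a' ** b.
Proof. by rewrite lmulDl lmulNl. Qed.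
Lemma lmul0l b : 0 ** b = 0.
Proof. by rewrite lfun0 zero_lfunE. Qed.
Lemma lmul_suml (I : Type) (r : seq I) (P : pred I) (f : I -> O) b :
  (\sum_(i <- r | P i) f i) ** b = \sum_(i <- r | P i) f i ** b.
Proof. by rewrite lfun_sum sum_lfunE. Qed.

Lemma lmul_mon w1 w2 : mon F w1 ** mon F w2 = mul_mon F w1 w2.
Proof. by rewrite /lmul !linext_basis. Qed.

Lemma mul_mon_coef w1 w2 w : mul_mon F w1 w2 w =
  oddmul F w1.2 w2.2 w.2 * \prod_i dpcoef F (w1.1 i) (w2.1 i) (w.1 i).
Proof.
rewrite ffunE /oddmul; case: (boolP (_ && (w.2 == _))) => h; last first.
  by rewrite andbF mul0r.
rewrite andbT; case: (boolP [forall i, _]) => /= [/forallP h2|].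
  by rewrite natr_prod; congr (_ * _); apply: eq_bigr => i _; rewrite /dpcoef h2.
rewrite negb_forall => /existsP[i hi]; rewrite (bigD1 i) //= /dpcoef (negPf hi).
by rewrite mul0r mulr0.
Qed.

(** At the maximal exponent the default of [insubd] leaves the exponent unchanged, hence the bound
    assumed in [raise_expE]. *)
Definition raise_exp i (e : dpexp p t) : dpexp p t :=
  [ffun k => insubd (e k) (e k + (k == i))%N].

Lemma raise_expE i (e : dpexp p t) k : (e i + 1 < p ^ t i)%N ->
  raise_exp i e k = (e k + (k == i))%N :> nat.
Proof.
move=> h; rewrite ffunE val_insubd; case: eqP => [->|_]; first by rewrite h.
by rewrite addn0 ltn_ord.
Qed.

Lemma lower_expE i (e : dpexp p t) k : lower_exp i e k = (e k - (k == i))%N :> nat.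
Proof. by rewrite ffunE. Qed.

Lemma partial_mon_basis r w : d_ r (mon F w) = partial_mon F r w.
Proof. exact: linext_basis. Qed.

Lemma partial_evenE i a w :
  d_ (inl i) a w = if (w.1 i + 1 < p ^ t i)%N then a (raise_exp i w.1, w.2) else 0.
Proof.
elim/mon_ind: a => [|c a b IHa IHb|w']; first by rewrite lfun0 !ffunE if_same.
  rewrite lfun_linear !ffunE IHa IHb; case: ifP => // _.
  by rewrite /GRing.scale /= mulr0 addr0.
rewrite partial_mon_basis /= mon_coef.
case: eqP => [w0|w0].
  rewrite ffunE; case: ifP => // h; case: eqP => // E.
  by move: w0; rewrite -E /= raise_expE // eqxx addn1.
rewrite mon_coef; case: ifP => h.
  congr (_%:R); congr nat_of_bool; apply/eqP/eqP => [wE|E].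
    have h2 : (lower_exp i w'.1 i + 1 < p ^ t i)%N by move: h; rewrite wE.
    rewrite wE; apply: supermon_eqP => [k|//]; rewrite raise_expE // lower_expE.
    by case: eqP => [->|]; lia.
  apply: supermon_eqP => [k|]; last by rewrite -E.
  by rewrite lower_expE -E /= raise_expE //; lia.
case: eqP => // E; move: h; rewrite E /= lower_expE eqxx subn1 addn1 prednK ?lt0n ?ltn_ord //.
  by apply/eqP.
Qed.

Lemma partial_oddE j a w :
  d_ (inr j) a w = if j \in w.2 then 0 else (-1) ^+ nlt j w.2 * a (w.1, j |: w.2).
Proof.
elim/mon_ind: a => [|c a b IHa IHb|w']; first by rewrite lfun0 !ffunE mulr0 if_same.
  rewrite lfun_linear !ffunE IHa IHb; case: ifP => // _; rewrite /GRing.scale /=.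
    by rewrite mulr0 addr0.
  by ring.
rewrite partial_mon_basis /= mon_coef.
case: ifP => jw'; last first.
  rewrite ffunE; case: ifP => // jw; case: eqP; rewrite ?mulr0 // => E.
  by move: jw'; rewrite -E /= setU11.
rewrite ffunE mon_coef /GRing.scale /=; case: ifP => jw.
  by case: eqP; rewrite ?mulr0 // => E; move: jw; rewrite E /= !inE eqxx.
have -> : (w == (w'.1, w'.2 :\ j)) = ((w.1, j |: w.2) == w').
  apply/eqP/eqP => [->/=|<- /=]; first by rewrite setD1K //; case: (w').
  by rewrite setU1K ?jw //; case: (w).
case: eqP; rewrite ?mulr0 // => <- /=; congr (_ * _); congr (_ ^+ _).
by rewrite -[#|_|]/(nlt j (j |: w.2)) -nltD1 setU1K ?jw.
Qed.

Lemma addO_coef a b w : (a + b) w = a w + b w.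
Proof. by rewrite ffunE. Qed.

Lemma scaleO_coef (c : F) a w : (c *: a) w = c * a w.
Proof. by rewrite ffunE. Qed.

Definition twist (b : bool) : 'End(O) := if b then eps else \1%VF.

(** Coefficients of a product of monomials factor into an odd part and one factor for each even
    variable. Only the factor that [r] concerns changes: [dpcoefS] handles an even [r], [oddmulD1]
    and [oddmulD1_0] an odd one. *)
Lemma partial_lmul_mon r w1 w2 :
  d_ r (mon F w1 ** mon F w2) =
    d_ r (mon F w1) ** mon F w2 + twist (mu r) (mon F w1) ** d_ r (mon F w2).
Proof.
rewrite lmul_mon; case: r => [i|j] /=; apply/ffunP => w.
  rewrite partial_evenE !partial_mon_basis /= id_lfunE.
  have L1 : ((if w1.1 i == 0 :> nat then 0 else mon F (lower_exp i w1.1, w1.2)) ** mon F w2) w =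
    oddmul F w1.2 w2.2 w.2 * ((if (w1.1 i : nat) is a.+1 then dpcoef F a (w2.1 i) (w.1 i) else 0)
     * \prod_(k | k != i) dpcoef F (w1.1 k) (w2.1 k) (w.1 k)).
    case: eqP => [->|w0]; first by rewrite lmul0l ffunE mul0r mulr0.
    rewrite lmul_mon mul_mon_coef (bigD1 i) //= lower_expE eqxx.
    case: (nat_of_ord (w1.1 i)) w0 => // a _; rewrite subn1 /=; congr (_ * (_ * _)).
    by apply: eq_bigr => k /negPf ki; rewrite lower_expE ki subn0.
  have L2 : (mon F w1 ** (if w2.1 i == 0 :> nat then 0 else mon F (lower_exp i w2.1, w2.2))) w =
    oddmul F w1.2 w2.2 w.2 * ((if (w2.1 i : nat) is a.+1 then dpcoef F (w1.1 i) a (w.1 i) else 0)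
     * \prod_(k | k != i) dpcoef F (w1.1 k) (w2.1 k) (w.1 k)).
    case: eqP => [->|w0]; first by rewrite lfun0 ffunE mul0r mulr0.
    rewrite lmul_mon mul_mon_coef (bigD1 i) //= lower_expE eqxx.
    case: (nat_of_ord (w2.1 i)) w0 => // a _; rewrite subn1 /=; congr (_ * (_ * _)).
    by apply: eq_bigr => k /negPf ki; rewrite lower_expE ki subn0.
  rewrite addO_coef L1 L2 -mulrDr -mulrDl -(dpcoefS charFp (ltn_ord (w1.1 i))
    (ltn_ord (w2.1 i)) (ltn_ord (w.1 i))) addn1.
  case: ifP => h; last by rewrite mul0r mulr0.
  rewrite mul_mon_coef (bigD1 i) //= raise_expE ?addn1 // eqxx addn1.
  congr (_ * (_ * _)); apply: eq_bigr => k /negPf ki.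
  by rewrite raise_expE ?addn1 // ki addn0.
rewrite partial_oddE !partial_mon_basis /= parop_mon lmulZl addO_coef.
have L1 : ((if j \in w1.2 then (-1) ^+ #|[set k in w1.2 | (k < j)%N]|
  *: mon F (w1.1, w1.2 :\ j) else 0) ** mon F w2) w =
   (if j \in w1.2 then (-1) ^+ nlt j w1.2 * oddmul F (w1.2 :\ j) w2.2 w.2 else 0) *
    \prod_k dpcoef F (w1.1 k) (w2.1 k) (w.1 k).
  case: ifP => _; last by rewrite lmul0l ffunE mul0r.
  by rewrite lmulZl lmul_mon ffunE mul_mon_coef /GRing.scale /= mulrA.
have L2 : (mon F w1 ** (if j \in w2.2 then (-1) ^+ #|[set k in w2.2 | (k < j)%N]|
  *: mon F (w2.1, w2.2 :\ j) else 0)) w =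
   (if j \in w2.2 then (-1) ^+ nlt j w2.2 * oddmul F w1.2 (w2.2 :\ j) w.2 else 0) *
    \prod_k dpcoef F (w1.1 k) (w2.1 k) (w.1 k).
  case: ifP => _; last by rewrite lfun0 ffunE mul0r.
  by rewrite lfunZ lmul_mon ffunE mul_mon_coef /GRing.scale /= mulrA.
rewrite L1 [X in _ = _ + X]ffunE L2 /GRing.scale /= mulrA -mulrDl /par_mon signr_odd.
case: ifPn => jw; last by rewrite -oddmulD1 // mul_mon_coef /= mulrA.
by rewrite oddmulD1_0 // mul0r.
Qed.

End Coefficients.

(** * Unit, associativity and supercommutativity, by induction on degree *)

Section AlgebraLaws.
Context (F : fieldType) (p m n : nat) (t : 'I_m -> nat).
Hypotheses (charFp : p \in [pchar F]) (t_gt0 : forall i, (0 < t i)%N).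
Local Notation O := (dpO F p n t).
Local Notation M := (supermon p n t).
Local Notation "a ** b" := (lmul F p n t a b) (at level 40, left associativity).
Local Notation eps := (parop F p n t).
Local Notation d_ := (partial F p t).
#[local] Opaque fun_of_lfun mon lmul partial parop.
Implicit Types (a b c : O) (w : M) (i : 'I_m) (j : 'I_n) (r : svar m n).

Lemma pt_gt0 i : (0 < p ^ t i)%N.
Proof. exact: ltnW (pt_gt1 charFp t_gt0 i). Qed.

Definition monone : M := ([ffun i => Ordinal (pt_gt0 i)], set0).
Local Notation one := (mon F monone).

Lemma moneE i : monone.1 i = 0%N :> nat.
Proof. by rewrite ffunE. Qed.

Lemma deg_mon0 w : (deg_mon w == 0%N) = (w == monone).
Proof.
rewrite /deg_mon addn_eq0 cards_eq0 supermon_eqE sum_nat_eq0.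
by congr (_ && _); apply: eq_forallb => i; rewrite moneE.
Qed.

Lemma partial_mon_form r w : exists (c : F) w',
  d_ r (mon F w) = c *: mon F w' /\
  (c != 0 -> (deg_mon w' < deg_mon w)%N /\ par_mon w' = par_mon w (+) mu r).
Proof.
rewrite partial_mon_basis; case: r => [i|j] /=.
  case: eqP => w0; first by exists 0, w; rewrite scale0r eqxx.
  exists 1, (lower_exp i w.1, w.2); rewrite scale1r; split=> // _; rewrite addbF; split=> //.
  rewrite /deg_mon /= ltn_add2r (bigD1 i) //= [X in (_ < X)%N](bigD1 i) //=.
  rewrite lower_expE eqxx subn1 -addSn prednK ?lt0n; last exact/eqP.
  rewrite leq_add2l; apply: leq_sum => k _; by rewrite lower_expE leq_subr.
case: ifP => jw; last by exists 0, w; rewrite scale0r eqxx.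
exists ((-1) ^+ #|[set k in w.2 | (k < j)%N]|), (w.1, w.2 :\ j); split=> // _.
by rewrite /deg_mon /par_mon /= (cardsD1 j w.2) jw add1n addnS ltnS addbT negbK.
Qed.

(** Every monomial other than [1] contains some variable, and its coefficient is then, up to sign, a
    coefficient of the derivative by that variable. *)
Lemma partial_eq0 c : (forall r, d_ r c = 0) -> c = c monone *: one.
Proof.
move=> h; apply/ffunP => w; rewrite ffunE mon_coef /GRing.scale /=.
case: eqP => [->|/eqP w1]; rewrite ?mulr1 // mulr0.
move: w1; rewrite supermon_eqE negb_and => /orP[|].
  rewrite negb_forall => /existsP[i]; rewrite moneE => wi.
  have : d_ (inl i) c (lower_exp i w.1, w.2) = 0 by rewrite h ffunE.
  rewrite (partial_evenE charFp).
  have lt1 : (lower_exp i w.1 i + 1 < p ^ t i)%N.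
    by rewrite lower_expE eqxx subn1 addn1 prednK ?lt0n ?ltn_ord.
  rewrite lt1 => E; rewrite -[RHS]E; congr (fun_of_fin c _); apply: supermon_eqP => // k.
  rewrite /= raise_expE // lower_expE; case: eqP => [->|_]; last by rewrite subn0 addn0.
  by rewrite subn1 addn1 prednK ?lt0n.
move=> /set0Pn[j jw].
have : d_ (inr j) c (w.1, w.2 :\ j) = 0 by rewrite h ffunE.
rewrite partial_oddE /= !inE eqxx /= => /eqP.
by rewrite mulf_eq0 signr_eq0 /= setD1K // -surjective_pairing => /eqP.
Qed.

Lemma partial_eq0_cst c : (forall r, d_ r c = 0) -> c monone = 0 -> c = 0.
Proof. by move=> h c0; rewrite (partial_eq0 h) c0 scale0r. Qed.

Lemma partial_lmul r a b :
  d_ r (a ** b) = d_ r a ** b + twist F p n t (mu r) a ** d_ r b.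
Proof.
elim/mon_ind: a => [|x a a' IHa IHa'|w].
- by rewrite !(lmul0l, lfun0) addr0.
- rewrite !(lmulDl, lmulZl, lfunD, lfunZ) IHa IHa' scalerDr.
  by rewrite -!addrA; congr (_ + _); rewrite addrCA.
elim/mon_ind: b => [|x b b' IHb IHb'|w'].
- by rewrite !lfun0 addr0.
- rewrite !lfun_linear IHb IHb' scalerDr.
  by rewrite -!addrA; congr (_ + _); rewrite addrCA.
exact: partial_lmul_mon.
Qed.

Lemma lmul_cst a b : (a ** b) monone = a monone * b monone.
Proof.
elim/mon_ind: a => [|x a a' IHa IHa'|w].
- by rewrite lmul0l ffunE mul0r.
- by rewrite lmulDl lmulZl !ffunE IHa IHa' /GRing.scale /= mulrDl mulrA.
elim/mon_ind: b => [|x b b' IHb IHb'|w'].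
- by rewrite lfun0 ffunE mulr0.
- by rewrite lfun_linear !(addO_coef, scaleO_coef) IHb IHb' mulrDr mulrCA.
rewrite lmul_mon mul_mon_coef !mon_coef.
case: (monone =P w) => [<-|w1] /=; last first.
  rewrite mul0r; apply/eqP; rewrite mulf_eq0; apply/orP.
  have: w != monone by apply/eqP => E; apply: w1.
  rewrite supermon_eqE negb_and => /orP[|w20].
    rewrite negb_forall => /existsP[i]; rewrite moneE => wi; right.
    apply/prodf_eq0; exists i => //; rewrite /dpcoef moneE [0%N == _]eq_sym addn_eq0.
    by rewrite (negPf wi).
  left; rewrite /oddmul; case: ifP => // /andP[_]; rewrite eq_sym setU_eq0.
  by move: w20 => /negPf /= ->.
case: (monone =P w') => [<-|w1] /=; last first.
  rewrite mulr0; apply/eqP; rewrite mulf_eq0; apply/orP.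
  have: w' != monone by apply/eqP => E; apply: w1.
  rewrite supermon_eqE negb_and => /orP[|w20].
    rewrite negb_forall => /existsP[i]; rewrite moneE => wi; right.
    apply/prodf_eq0; exists i => //; rewrite /dpcoef moneE [0%N == _]eq_sym addn_eq0.
    by rewrite (negPf wi) andbF.
  left; rewrite /oddmul; case: ifP => // /andP[_]; rewrite eq_sym setU_eq0.
  by move: w20 => /negPf /= ->; rewrite andbF.
rewrite mulr1 /oddmul -setI_eq0 setI0 setU0 !eqxx inversions0l mul1r big1 // => i _.
by rewrite /dpcoef moneE bin0.
Qed.

Lemma partial_one r : d_ r one = 0.
Proof.
by rewrite partial_mon_basis; case: r => [i|j] /=; rewrite ?moneE ?inE ?eqxx.
Qed.

Lemma parop_one : eps one = one.
Proof. by rewrite parop_mon /par_mon cards0 scale1r. Qed.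

Lemma deg_ind (P : M -> Prop) :
  (forall w, (forall w', (deg_mon w' < deg_mon w)%N -> P w') -> P w) -> forall w, P w.
Proof.
move=> h w; have [k] := ubnP (deg_mon w); elim: k w => // k IH w lw.
by apply: h => w' lw'; apply: IH; apply: leq_trans lw' _.
Qed.

Lemma lmul1l a : one ** a = a.
Proof.
elim/mon_ind: a => [|x a a' IHa IHa'|w]; first by rewrite lfun0.
  by rewrite lfun_linear IHa IHa'.
 elim/deg_ind: w => w IH.
apply/eqP; rewrite -subr_eq0; apply/eqP/partial_eq0_cst => [r|]; last first.
  by rewrite !ffunE lmul_cst !mon_coef eqxx mul1r subrr.
rewrite lfunB partial_lmul partial_one lmul0l add0r.
have -> : twist F p n t (mu r) one = one by case: (mu r); rewrite /= ?parop_one ?id_lfunE.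
have [c [w' [-> h]]] := partial_mon_form r w.
rewrite lfunZ; case: (eqVneq c 0) => [->|/h[dw _]]; first by rewrite !scale0r subr0.
by rewrite IH // subrr.
Qed.

Lemma lmul1r a : a ** one = a.
Proof.
elim/mon_ind: a => [|x a a' IHa IHa'|w]; first by rewrite lmul0l.
  by rewrite lmulDl lmulZl IHa IHa'.
 elim/deg_ind: w => w IH.
apply/eqP; rewrite -subr_eq0; apply/eqP/partial_eq0_cst => [r|]; last first.
  by rewrite !ffunE lmul_cst !mon_coef eqxx mulr1 subrr.
rewrite lfunB partial_lmul partial_one lfun0 addr0.
have [c [w' [-> h]]] := partial_mon_form r w.
rewrite lmulZl; case: (eqVneq c 0) => [->|/h[dw _]]; first by rewrite !scale0r subr0.
by rewrite IH // subrr.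
Qed.

Lemma lmul_parop a b : eps (a ** b) = eps a ** eps b.
Proof.
elim/mon_ind: a => [|x a a' IHa IHa'|w1]; first by rewrite !(lmul0l, lfun0).
  by rewrite !(lmulDl, lmulZl, lfun_linear) IHa IHa'.
elim/mon_ind: b => [|x b b' IHb IHb'|w2]; first by rewrite !lfun0.
  by rewrite !lfun_linear IHb IHb'.
rewrite !parop_mon lmulZl lfunZ lmul_mon scalerA.
apply/ffunP => w; rewrite scaleO_coef.
have -> : eps (mul_mon F w1 w2) w = (-1) ^+ par_mon w * mul_mon F w1 w2 w.
  elim/mon_ind: (mul_mon F w1 w2) => [|x b b' IHb IHb'|w'].
  - by rewrite lfun0 ffunE mulr0.
  - by rewrite lfun_linear !ffunE IHb IHb' /GRing.scale /= mulrDr mulrCA.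
  rewrite parop_mon ffunE mon_coef /GRing.scale /=.
  by case: eqP => [->|]; rewrite ?mulr0.
rewrite mul_mon_coef /oddmul /par_mon.
case: andP => [[d /eqP->]|]; last by rewrite !(mul0r, mulr0).
congr (_ * _); rewrite cardsU (disjoint_setI0 d) cards0 subn0 oddD.
by rewrite signr_addb.
Qed.

Lemma partial_parop r a : d_ r (eps a) = (-1) ^+ mu r *: eps (d_ r a).
Proof.
elim/mon_ind: a => [|x a a' IHa IHa'|w]; first by rewrite !lfun0 scaler0.
  by rewrite !lfun_linear IHa IHa' scalerDr !scalerA mulrC.
rewrite parop_mon lfunZ.
have [c [w' [-> h]]] := partial_mon_form r w.
rewrite lfunZ parop_mon; case: (eqVneq c 0) => [->|/h[_ ->]]; first by rewrite !(scale0r, scaler0).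
rewrite !scalerA; congr (_ *: _); rewrite signr_addb; case: (par_mon w); case: (mu r) => /=; ring.
Qed.

(** By the Leibniz rule each derivative of the associator of three monomials is a combination of
    associators of smaller total degree, and the constant terms agree. *)
Lemma lmulA a b c : a ** b ** c = a ** (b ** c).
Proof.
elim/mon_ind: a => [|x a a' IHa IHa'|w1]; first by rewrite !lmul0l.
  by rewrite !(lmulDl, lmulZl, lfun_linear) IHa IHa'.
elim/mon_ind: b => [|x b b' IHb IHb'|w2]; first by rewrite !(lmul0l, lfun0).
  by rewrite !(lmulDl, lmulZl, lfun_linear) IHb IHb'.
elim/mon_ind: c => [|x c c' IHc IHc'|w3]; first by rewrite !lfun0.
  by rewrite !lfun_linear IHc IHc'.
have [k] := ubnP (deg_mon w1 + deg_mon w2 + deg_mon w3)%N.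
elim: k w1 w2 w3 => // k IH w1 w2 w3 lk.
apply/eqP; rewrite -subr_eq0; apply/eqP/partial_eq0_cst => [r|]; last first.
  by rewrite !ffunE !lmul_cst mulrA subrr.
rewrite lfunB (partial_lmul r (_ ** _) (mon F w3)) (partial_lmul r (mon F w1) (mon F w2)).
rewrite (partial_lmul r (mon F w1) (_ ** _)) (partial_lmul r (mon F w2) (mon F w3)).
have [c1 [v1 [-> h1]]] := partial_mon_form r w1.
have [c2 [v2 [-> h2]]] := partial_mon_form r w2.
have [c3 [v3 [-> h3]]] := partial_mon_form r w3.
have [s1 E1] : exists s : F, twist F p n t (mu r) (mon F w1) = s *: mon F w1.
  by case: (mu r); [exists ((-1) ^+ par_mon w1); rewrite /= parop_mon | exists 1;
    rewrite /= id_lfunE scale1r].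
have [s2 [E2 E3]] : exists s : F, twist F p n t (mu r) (mon F w2) = s *: mon F w2 /\
   twist F p n t (mu r) (mon F w1 ** mon F w2) = (s1 * s) *: (mon F w1 ** mon F w2).
  case: (mu r) E1 => /= E1; last first.
    exists 1; rewrite !id_lfunE scale1r mulr1; split=> //.
    by rewrite -lmulZl -E1 id_lfunE.
  exists ((-1) ^+ par_mon w2); split; first exact: parop_mon.
  by rewrite lmul_parop E1 parop_mon lmulZl lfunZ scalerA.
have H1 : c1 *: (mon F v1 ** mon F w2 ** mon F w3) = c1 *: (mon F v1 ** (mon F w2 ** mon F w3)).
  case: (eqVneq c1 0) => [->|/h1[d _]]; first by rewrite !scale0r.
  congr (_ *: _).
  apply: IH.
  clear -d lk; lia.
have H2 : c2 *: (mon F w1 ** mon F v2 ** mon F w3) = c2 *: (mon F w1 ** (mon F v2 ** mon F w3)).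
  case: (eqVneq c2 0) => [->|/h2[d _]]; first by rewrite !scale0r.
  congr (_ *: _).
  apply: IH.
  clear -d lk; lia.
have H3 : c3 *: (mon F w1 ** mon F w2 ** mon F v3) = c3 *: (mon F w1 ** (mon F w2 ** mon F v3)).
  case: (eqVneq c3 0) => [->|/h3[d _]]; first by rewrite !scale0r.
  congr (_ *: _).
  apply: IH.
  clear -d lk; lia.
move: (mon F w1) (mon F w2) (mon F w3) (mon F v1) (mon F v2) (mon F v3) E1 E2 E3 H1 H2 H3.
move=> x1 x2 x3 y1 y2 y3 E1 E2 E3 H1 H2 H3.
rewrite E1 E2 E3 lmulDl lfunD !lmulZl !lfunZ scale_lfunE H1 H2 H3.
by rewrite -!scalerA !addrA subrr.
Qed.

Lemma lmulC_mon w1 w2 :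
  mon F w1 ** mon F w2 = (-1) ^+ (par_mon w1 && par_mon w2) *: (mon F w2 ** mon F w1).
Proof.
rewrite !lmul_mon; apply/ffunP => w; rewrite scaleO_coef !mul_mon_coef mulrA.
congr (_ * _); last first.
  apply: eq_bigr => i _; rewrite /dpcoef addnC; case: ifP => // _.
  by rewrite -bin_sub ?leq_addl // addnK.
rewrite /oddmul disjoint_sym setUC; case: andP => [[d _]|]; last by rewrite mulr0.
rewrite -oddM -inversionsC 1?disjoint_sym // signr_odd exprD -mulrA -expr2.
by rewrite sqrr_sign mulr1.
Qed.

Lemma lmulC d e a b : a \in Opar F p n t d -> b \in Opar F p n t e ->
  a ** b = (-1) ^+ (d && e) *: (b ** a).
Proof.
elim/mspan_ind => [|x a1 a2 IH1 IH2|w1 /eqP<-] hb; first by rewrite lmul0l lfun0 scaler0.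
  by rewrite lmulDl lmulZl lfun_linear IH1 // IH2 // scalerDr !scalerA mulrC.
elim/mspan_ind: hb => [|x b1 b2 IH1 IH2|w2 /eqP<-]; first by rewrite lmul0l lfun0 scaler0.
  by rewrite lmulDl lmulZl lfun_linear IH1 // IH2 // scalerDr !scalerA mulrC.
exact: lmulC_mon.
Qed.

Lemma lmul_Opar d e a b : a \in Opar F p n t d -> b \in Opar F p n t e ->
  a ** b \in Opar F p n t (d (+) e).
Proof.
elim/mspan_ind => [|x a1 a2 IH1 IH2|w1 /eqP<-] hb; first by rewrite lmul0l rpred0.
  by rewrite lmulDl lmulZl rpredD ?IH2 // rpredZ ?IH1.
elim/mspan_ind: hb => [|x b1 b2 IH1 IH2|w2 /eqP<-]; first by rewrite lfun0 rpred0.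
  by rewrite lfun_linear rpredD // rpredZ.
rewrite lmul_mon; apply/mspanP => w; rewrite mul_mon_coef /oddmul.
case: andP => [[d' /eqP E]|]; last by rewrite mul0r.
by rewrite /par_mon E cardsU (disjoint_setI0 d') cards0 subn0 oddD eqxx.
Qed.

End AlgebraLaws.

(** * The pairing given by the coefficient of the top monomial *)

Section Duality.
Context (F : fieldType) (p m n : nat) (t : 'I_m -> nat).
Hypotheses (charFp : p \in [pchar F]) (t_gt0 : forall i, (0 < t i)%N).
Local Notation O := (dpO F p n t).
Local Notation M := (supermon p n t).
Local Notation "a ** b" := (lmul F p n t a b) (at level 40, left associativity).
Local Notation d_ := (partial F p t).
#[local] Opaque mon lmul partial parop.
Implicit Types (a b c : O) (w : M) (i : 'I_m) (j : 'I_n) (r : svar m n).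

Lemma partial_comm r s a : d_ r (d_ s a) = (-1) ^+ (mu r && mu s) *: d_ s (d_ r a).
Proof.
apply/ffunP => w; rewrite scaleO_coef; case: r s => [i|j] [k|l] /=; rewrite ?mul1r.
- have [->|ik] := eqVneq i k; first by [].
  have key x y : y != x -> d_ (inl x) (d_ (inl y) a) w =
      if (w.1 x + 1 < p ^ t x)%N && (w.1 y + 1 < p ^ t y)%N
      then a (raise_exp y (raise_exp x w.1), w.2) else 0.
    move=> /negPf xy; rewrite !(partial_evenE charFp); case: ifP => h //.
    by rewrite raise_expE // xy addn0.
  rewrite !key // 1?eq_sym // andbC; case: ifP => // /andP[h1 h2].
  congr (fun_of_fin a _); apply: supermon_eqP => // x.
  have h3 : (raise_exp i w.1 k + 1 < p ^ t k)%N.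
    by rewrite raise_expE // eq_sym (negPf ik) addn0.
  have h4 : (raise_exp k w.1 i + 1 < p ^ t i)%N.
    by rewrite raise_expE // (negPf ik) addn0.
  by rewrite /= (raise_expE _ h3) (raise_expE _ h4) (raise_expE _ h1) (raise_expE _ h2) addnAC.
- rewrite (partial_evenE charFp) !partial_oddE (partial_evenE charFp).
  by case: (_ < _)%N; case: (l \in _); rewrite ?mulr0.
- rewrite (partial_evenE charFp) !partial_oddE (partial_evenE charFp).
  by case: (_ < _)%N; case: (j \in _); rewrite ?mulr0.
rewrite !partial_oddE /= !inE; have [->|jl] := eqVneq j l.
  by rewrite ?eqxx /=; case: ifP => _; rewrite !mulr0.
rewrite /=; case: ifPn => h1; case: ifPn => h2; rewrite ?mulr0 //.
rewrite !nltU ?disjoints1 // setUCA !nltE !big_set1 -!nltE !exprD.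
have -> : (l < j)%N = ~~ (j < l)%N.
  by rewrite -leqNgt ltn_neqAle val_eqE eq_sym jl.
by case: (j < l)%N => /=; ring.
Qed.

Definition xmon r : M := match r with
  | inl i => (raise_exp i (monone n charFp t_gt0).1, set0) | inr j =>
    ((monone n charFp t_gt0).1, [set j]) end.

Lemma xvarE r : xvar F p t r = mon F (xmon r).
Proof.
apply/ffunP => w; rewrite ffunE mon_coef supermon_eqE; case: r => [i|j] /=.
  congr (_%:R); congr nat_of_bool; congr (_ && _).
  apply: eq_forallb => k; rewrite raise_expE ?moneE ?add0n ?addn1 //.
  by rewrite (pt_gt1 charFp).
congr (_%:R); congr nat_of_bool; congr (_ && _).
by apply: eq_forallb => k; rewrite moneE.
Qed.

Lemma par_xmon r : par_mon (xmon r) = mu r.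
Proof. by case: r => [i|j]; rewrite /par_mon /= ?cards0 ?cards1. Qed.

Lemma partial_xvar r s : d_ r (xvar F p t s) = (r == s)%:R *: mon F (monone n charFp t_gt0).
Proof.
rewrite xvarE partial_mon_basis; case: r s => [i|j] [k|l] /=.
- rewrite raise_expE ?moneE ?addn1 ?(pt_gt1 charFp) // add0n -[inl i == inl k]/(i == k).
  have [->|_] := eqVneq i k; last by rewrite scale0r.
  rewrite scale1r; congr mon; apply: supermon_eqP => // x.
  by rewrite /= lower_expE raise_expE ?moneE ?addn1 ?(pt_gt1 charFp) // add0n subnn.
- by rewrite ffunE /= scale0r.
- by rewrite inE scale0r.
rewrite inE -[inr j == inr l]/(j == l).
have [->|_] := eqVneq j l; last by rewrite scale0r.
rewrite scale1r -[#|_|]/(nlt l [set l]) -nltD1 setDv /nlt.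
have -> : [set k in (set0 : {set 'I_n}) | (k < l)%N] = set0 :> {set 'I_n} by apply/setP => x;
  rewrite !inE.
by rewrite cards0 scale1r.
Qed.

Lemma xvar_lmul_even i a w : (xvar F p t (inl i) ** a) w =
  if (0 < w.1 i)%N then (w.1 i)%:R * a (lower_exp i w.1, w.2) else 0.
Proof.
elim/mon_ind: a => [|c a b IHa IHb|w'].
- by rewrite lfun0 !ffunE mulr0 if_same.
- rewrite lfun_linear !(addO_coef, scaleO_coef) IHa IHb; case: ifP => _.
    by ring.
  by rewrite mulr0 addr0.
rewrite xvarE lmul_mon mul_mon_coef mon_coef /= /oddmul -setI_eq0 set0I eqxx set0U inversions0l /=.
have E k : dpcoef F (raise_exp i (monone n charFp t_gt0).1 k) (w'.1 k) (w.1 k) =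
  if w.1 k == ((k == i) + w'.1 k)%N :> nat then (if k == i then (w.1 k)%:R else 1) else 0.
  rewrite /dpcoef raise_expE ?moneE ?addn1 ?(pt_gt1 charFp) // add0n; case: eqP => // ->.
  by case: (k == i); rewrite ?bin1 ?bin0.
under eq_bigr do rewrite E; rewrite supermon_eqE /=.
case: (w.2 == w'.2) => /=; rewrite ?andbT ?andbF ?mulr0 ?mul0r ?if_same // mul1r.
case: (boolP [forall k, _]) => [/forallP h|].
  rewrite (bigD1 i) //= eqxx; have := h i; rewrite lower_expE eqxx => hi.
  case: (posnP (w.1 i)) => wi; first by rewrite wi /= mul0r.
  have -> : (w.1 i == (true + w'.1 i)%N :> nat) by rewrite -(eqP hi) subnKC.
  rewrite big1 // => k ki; have := h k; rewrite lower_expE (negPf ki) subn0.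
  by move/eqP->; rewrite add0n eqxx.
rewrite negb_forall => /existsP[k hk]; rewrite mulr0 if_same (bigD1 k) //=.
rewrite lower_expE in hk; case: eqP => [E'|]; last by rewrite mul0r.
by move: hk; rewrite E' addKn eqxx.
Qed.

Lemma xvar_lmul_odd j a w : (xvar F p t (inr j) ** a) w =
  if j \in w.2 then (-1) ^+ nlt j w.2 * a (w.1, w.2 :\ j) else 0.
Proof.
elim/mon_ind: a => [|c a b IHa IHb|w'].
- by rewrite lfun0 !ffunE mulr0 if_same.
- rewrite lfun_linear !(addO_coef, scaleO_coef) IHa IHb; case: ifP => _.
    by ring.
  by rewrite mulr0 addr0.
rewrite xvarE lmul_mon mul_mon_coef mon_coef /= /oddmul inversions1l disjoints1.
have E k : dpcoef F ((monone n charFp t_gt0).1 k) (w'.1 k) (w.1 k) = (w.1 k == w'.1 k :> nat)%:R.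
  by rewrite /dpcoef moneE add0n bin0; case: eqP.
under eq_bigr do rewrite E; rewrite supermon_eqE /=.
have -> : \prod_k (w.1 k == w'.1 k :> nat)%:R = [forall k, w.1 k == w'.1 k :> nat]%:R :> F.
  case: (boolP [forall k, _]) => [/forallP h|].
    by rewrite big1 // => k _; rewrite h.
  by rewrite negb_forall => /existsP[k hk]; rewrite (bigD1 k) //= (negPf hk) mul0r.
case: (boolP (j \in w'.2)) => jw' /=.
  rewrite mul0r; case: ifP => // jw; rewrite [_ == w'.2](_ : _ = false) ?andbF ?mulr0 //.
  by apply/negP => /eqP E'; move: jw'; rewrite -E' !inE eqxx.
have -> : (w.2 == [set j] :|: w'.2) = (j \in w.2) && (w.2 :\ j == w'.2).
  apply/eqP/andP => [->|[jw /eqP <-]]; last by rewrite setD1K.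
  by rewrite !inE eqxx setU1K.
case: (j \in w.2) => /=; last by rewrite mul0r.
case: eqP => [E'|]; last by rewrite andbF mul0r mulr0.
by rewrite andbT -E' nltD1.
Qed.

Definition topmon : M :=
  ([ffun i => Ordinal (eq_leq (prednK (pt_gt0 charFp t_gt0 i)))], setT).

Lemma topmonE i : topmon.1 i = (p ^ t i).-1 :> nat.
Proof. by rewrite ffunE. Qed.

Lemma partial_top r a : d_ r a topmon = 0.
Proof.
case: r => [i|j]; first by rewrite (partial_evenE charFp) topmonE addn1 prednK ?ltnn
  ?(pt_gt0 charFp).
by rewrite partial_oddE /= inE.
Qed.

Definition compl_mon w : M :=
  ([ffun i => ord_sub (topmon.1 i) (w.1 i)], ~: w.2).

Lemma compl_monE w i : (compl_mon w).1 i = ((p ^ t i).-1 - w.1 i)%N :> nat.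
Proof. by rewrite ffunE /= ffunE. Qed.

(** Among all monomials only [w] multiplies [compl_mon w] into the top degree component with a
    nonzero coefficient, and by [bin_predF] that coefficient is a sign. *)
Lemma lmul_compl a w : exists2 s : F, s != 0 & (a ** mon F (compl_mon w)) topmon = s * a w.
Proof.
have le i (w0 : M) : (w0.1 i <= (p ^ t i).-1)%N by rewrite -ltnS prednK ?ltn_ord // (pt_gt0 charFp).
pose s : F := (-1) ^+ inversions w.2 (~: w.2) * \prod_i (-1) ^+ w.1 i.
exists s.
  by rewrite /s mulf_neq0 ?signr_eq0 //; apply/prodf_neq0 => i _; rewrite signr_eq0.
elim/mon_ind: a => [|c a b IHa IHb|w'].
- by rewrite lmul0l !ffunE mulr0.
- by rewrite lmulDl lmulZl !(addO_coef, scaleO_coef) IHa IHb; ring.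
rewrite lmul_mon mul_mon_coef mon_coef; have [<-|ww'] := eqVneq w w'.
  rewrite mulr1 /s; congr (_ * _).
    by rewrite /oddmul /= -setI_eq0 setICr setUCr !eqxx.
  apply: eq_bigr => i _; rewrite compl_monE topmonE /dpcoef subnKC ?le // eqxx.
  by rewrite bin_predF // -ltnS prednK ?(pt_gt0 charFp) // ltnS le.
rewrite mulr0; move: ww'; rewrite supermon_eqE negb_and => /orP[|w2].
  rewrite negb_forall => /existsP[i hi]; rewrite (bigD1 i) //= {1}/dpcoef.
  rewrite topmonE compl_monE; case: eqP => [E|]; last by rewrite mul0r mulr0.
  by have := le i w; have := le i w'; move: hi; rewrite E; lia.
rewrite /oddmul /=; case: ifP => [/andP[d /eqP E]|]; last by rewrite mul0r.
case/eqP: w2; apply/setP => k; have /setP/(_ k) := E; rewrite !inE => Ek.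
case: (boolP (k \in w'.2)) => kw; first by have := disjointFr d kw; rewrite inE => /negbFE.
by move: Ek; rewrite (negPf kw) /= => /esym/negPf.
Qed.

Lemma mon_compl_neq0 w : (mon F w ** mon F (compl_mon w)) topmon != 0.
Proof. by have [s s0 ->] := lmul_compl (mon F w) w; rewrite mon_coef eqxx mulr1. Qed.

Lemma lmul_nondeg a : (forall b, (a ** b) topmon = 0) -> a = 0.
Proof.
move=> h; apply/ffunP => w; rewrite ffunE; have [s s0 E] := lmul_compl a w.
by move: (h (mon F (compl_mon w))) => /eqP; rewrite E mulf_eq0 (negPf s0) => /eqP.
Qed.

End Duality.

(** For the square of [Delta]: exchanging the two summation indices costs one sign, from the odd
    derivatives. In odd characteristic the square is therefore zero. *)
Lemma sum_comm_anticomm (F : fieldType) (V : vectType F) (I : finType)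
    (A B : I -> 'End(V)) x :
  (forall k l y, A k (A l y) = A l (A k y)) ->
  (forall k l y, A k (B l y) = B l (A k y)) ->
  (forall k l y, B k (B l y) = - B l (B k y)) ->
  \sum_k A k (B k (\sum_l A l (B l x))) = - \sum_k A k (B k (\sum_l A l (B l x))).
Proof.
move=> AA AB BB.
have e1 : \sum_k A k (B k (\sum_l A l (B l x))) = \sum_k \sum_l A k (B k (A l (B l x))).
  by apply: eq_bigr => k _; rewrite !lfun_sum.
rewrite {1}e1 exchange_big /= e1 -sumrN; apply: eq_bigr => l _.
rewrite -sumrN; apply: eq_bigr => k _.
by rewrite -AB AA BB !lfunN AB.
Qed.

(** * Contact operators *)

Section ContactOperators.
Context (F : fieldType) (p N n : nat) (leNn : (N <= n)%N) (t : 'I_N -> nat).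
Hypotheses (charFp : p \in [pchar F]) (p_gt2 : (2 < p)%N) (t_gt0 : forall i, (0 < t i)%N).
Local Notation O := (dpO F p n t).
Local Notation M := (supermon p n t).
Local Notation "a ** b" := (lmul F p n t a b) (at level 40, left associativity).
Local Notation eps := (parop F p n t).
Local Notation Opr := (Opar F p n t).
Local Notation d_ := (partial F p t).
Local Notation X := (var2N leNn).
Local Notation E := (Euler F p leNn t).
Local Notation Dl := (Delta F p leNn t).
Local Notation top := (topmon n charFp t_gt0).
#[local] Opaque mon lmul partial parop.
Implicit Types (a b c x y : O) (w : M) (k l : 'I_N) (i : 'I_N + 'I_N).

Lemma oppO_coef a w : (- a) w = - a w.
Proof. by rewrite ffunE. Qed.

Lemma zeroO_coef w : (0 : O) w = 0.
Proof. by rewrite ffunE. Qed.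

Lemma sumO_coef (I : Type) (r : seq I) (P : pred I) (f : I -> O) w :
  (\sum_(i <- r | P i) f i) w = \sum_(i <- r | P i) f i w.
Proof. by elim/big_rec2: _ => [|i x y _ <-]; rewrite ?zeroO_coef ?addO_coef. Qed.

Definition coefE := (addO_coef, scaleO_coef, oppO_coef, zeroO_coef).

Lemma two_neq0 : (2%:R : F) != 0.
Proof.
rewrite -(dvdn_pcharf charFp); apply/negP => /(dvdn_leq (isT : (0 < 2)%N)).
by rewrite leqNgt p_gt2.
Qed.

Lemma parop_coef a w : eps a w = (-1) ^+ par_mon w * a w.
Proof.
elim/mon_ind: a => [|c a b IHa IHb|w'].
- by rewrite lfun0 !coefE mulr0.
- by rewrite lfun_linear !coefE IHa IHb; ring.
by rewrite parop_mon !coefE mon_coef; case: eqP => [->|]; rewrite ?mulr0.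
Qed.

Lemma eq_opp0 (v : F) : v = - v -> v = 0.
Proof.
move/eqP; rewrite -subr_eq0 opprK -mulr2n -mulr_natl mulf_eq0 (negPf two_neq0).
by move/eqP.
Qed.

Lemma eq_oppO a : a = - a -> a = 0.
Proof.
move=> h; apply/ffunP => w; rewrite zeroO_coef; apply: eq_opp0.
by rewrite {1}h oppO_coef.
Qed.

(** Parity as an eigenvalue of [eps], which is legitimate since [1] and [-1] differ. Parity claims
    about an operator reduce to how it commutes with [eps]. *)
Lemma OparP (d : bool) a : reflect (eps a = (-1) ^+ d *: a) (a \in Opr d).
Proof.
apply: (iffP idP) => [/parop_Opar //|h]; apply/mspanP => w hw.
have /ffunP/(_ w) := h; rewrite parop_coef !coefE.
have -> : (-1) ^+ par_mon w = - (-1) ^+ d :> F.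
  by move: hw; case: (par_mon w); case: (d) => //= _; rewrite ?expr0 ?expr1 ?opprK.
rewrite mulNr => /esym/eq_opp0/eqP.
by rewrite mulf_eq0 signr_eq0 => /eqP.
Qed.

Lemma partial_Opar r d a : a \in Opr d -> d_ r a \in Opr (d (+) mu r).
Proof.
move/parop_Opar=> h; apply/OparP.
have := partial_parop r a; rewrite h lfunZ => /(congr1 (fun v => (-1) ^+ mu r *: v)).
by rewrite !scalerA -!signr_addb addbb scale1r addbC => <-.
Qed.

(** The eigenvalue of the Euler operator: the degree in [x_1, ..., x_(2N)], which ignores the
    variable [x_(2N+1)] present when [n = N + 1]. *)
Definition deg2 w : nat := (\sum_k w.1 k + \sum_k (widen_ord leNn k \in w.2))%N.

Lemma xvar_partial r a w : (xvar F p t r ** d_ r a) w =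
  (match r with inl i => w.1 i | inr j => (j \in w.2 : nat) end)%:R * a w.
Proof.
case: r => [i|j].
  rewrite (xvar_lmul_even charFp t_gt0); case: posnP => [->|wi]; first by rewrite mul0r.
  have h : (lower_exp i w.1 i + 1 < p ^ t i)%N.
    by rewrite lower_expE eqxx subn1 addn1 prednK ?ltn_ord.
  rewrite (partial_evenE charFp) /= h; congr (_ * fun_of_fin a _).
  apply: supermon_eqP => // x; rewrite /= raise_expE // lower_expE.
  by case: eqP => [->|_]; [rewrite subn1 addn1 prednK | rewrite subn0 addn0].
rewrite (xvar_lmul_odd charFp t_gt0); case: (boolP (j \in w.2)) => jw; last by rewrite mul0r.
rewrite partial_oddE /= !inE eqxx /= nltD1 signrMK mul1r setD1K //.
by rewrite -surjective_pairing.
Qed.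

Lemma EulerE a : E a = \sum_i xvar F p t (X i) ** d_ (X i) a.
Proof. by rewrite /Euler sum_lfunE; apply: eq_bigr => i _; rewrite comp_lfunE. Qed.

Lemma sum_2N (V : nmodType) (f : 'I_N + 'I_N -> V) :
  \sum_i f i = \sum_k (f (inl k) + f (inr k)).
Proof. by rewrite big_sumType big_split. Qed.

Lemma Euler_coef a w : E a w = (deg2 w)%:R * a w.
Proof.
rewrite EulerE sumO_coef (eq_bigr _ (fun i _ => xvar_partial (X i) a w)) -mulr_suml.
by rewrite big_sumType /= -!natr_sum -natrD.
Qed.

Lemma Euler_mon w : E (mon F w) = (deg2 w)%:R *: mon F w.
Proof.
apply/ffunP => w'; rewrite Euler_coef !coefE mon_coef.
by case: eqP => [->|]; rewrite ?mulr0.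
Qed.

Lemma partial_Euler i a : d_ (X i) (E a) = E (d_ (X i) a) + d_ (X i) a.
Proof.
apply/ffunP => w; rewrite !coefE Euler_coef; case: i => k /=.
  rewrite !(partial_evenE charFp) Euler_coef; case: ifP => h; last by rewrite mulr0 addr0.
  have -> : deg2 (raise_exp k w.1, w.2) = (deg2 w).+1.
    rewrite /deg2 /= -addSn; congr addn.
    rewrite (bigD1 k) //= [X in X.+1](bigD1 k) //= raise_expE // eqxx addn1 addSn.
    congr (_ + _).+1; apply: eq_bigr => x /negPf xk; by rewrite raise_expE // xk addn0.
  by rewrite -natr1; ring.
rewrite !partial_oddE Euler_coef; case: ifPn => h; first by rewrite mulr0 addr0.
have -> : deg2 (w.1, widen_ord leNn k |: w.2) = (deg2 w).+1.
  rewrite /deg2 /= -addnS; congr addn.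
  rewrite (bigD1 k) //= [X in X.+1](bigD1 k) //= !inE eqxx (negPf h) /= add1n add0n.
  congr S; apply: eq_bigr => x xk; rewrite !inE.
  by rewrite -val_eqE /= val_eqE (negPf xk).
by rewrite -natr1; ring.
Qed.

Lemma Euler_parop a : E (eps a) = eps (E a).
Proof. by apply/ffunP => w; rewrite Euler_coef !parop_coef Euler_coef mulrCA. Qed.

Lemma Euler_Opar d a : a \in Opr d -> E a \in Opr d.
Proof. by move/parop_Opar=> h; apply/OparP; rewrite -Euler_parop h lfunZ. Qed.

Lemma xvar_Opar r : xvar F p t r \in Opr (mu r).
Proof. by rewrite (xvarE charFp t_gt0) -(par_xmon charFp t_gt0 r) mon_Opar. Qed.

Lemma twist_Opar (e d : bool) a : a \in Opr d ->
  twist F p n t e a = (-1) ^+ (e && d) *: a.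
Proof. by case: e => ha; rewrite /= ?id_lfunE ?scale1r // (parop_Opar ha). Qed.

Lemma lmul_superC d e f b x : f \in Opr d -> b \in Opr e ->
  f ** (b ** x) = (-1) ^+ (d && e) *: (b ** (f ** x)).
Proof.
move=> hf hb.
by rewrite -!(lmulA charFp t_gt0) (lmulC hf hb) lmulZl.
Qed.

(* A derivation [f ** A _] with [A] a superderivation of parity [e]. *)
Lemma fder_superder (A : 'End(O)) (e d z : bool) f b x :
  (forall a c, A (a ** c) = A a ** c + twist F p n t e a ** A c) ->
  f \in Opr d -> b \in Opr z ->
  f ** A (b ** x) = f ** A b ** x + (-1) ^+ ((d (+) e) && z) *: (b ** (f ** A x)).
Proof.
move=> hA hf hb; rewrite hA lfunD (twist_Opar e hb) lmulZl lfunZ.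
rewrite (lmul_superC _ hf hb) (lmulA charFp t_gt0) scalerA -signr_addb.
by congr (_ + (-1) ^+ _ *: _); case: d {hf}; case: e {hA}; case: z {hb}.
Qed.

Lemma Euler_der a b : E (a ** b) = E a ** b + twist F p n t false a ** E b.
Proof.
rewrite /= id_lfunE; elim/mon_ind: a => [|c a a' IHa IHa'|w].
- by rewrite !(lmul0l, lfun0) addr0.
- rewrite !(lmulDl, lmulZl, lfun_linear) IHa IHa' scalerDr.
  by rewrite -!addrA; congr (_ + _); rewrite addrCA.
rewrite [in LHS]EulerE Euler_mon lmulZl EulerE lfun_sum -[X in _ = X + _]addr0 -addrA.
have hw := mon_Opar F w.
rewrite (eq_bigr (fun i => xvar F p t (X i) ** d_ (X i) (mon F w) ** b
   + mon F w ** (xvar F p t (X i) ** d_ (X i) b))).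
  rewrite big_split /= -lmul_suml -EulerE Euler_mon lmulZl add0r; congr (_ + _).
move=> i _; rewrite (fder_superder _ (partial_lmul charFp (X i)) (xvar_Opar _) hw).
by rewrite addbb scale1r.
Qed.

Lemma Euler_mul a b : E (a ** b) = E a ** b + a ** E b.
Proof. by rewrite Euler_der /= id_lfunE. Qed.

(* The properties shared by [dl = 0], the case of SHO, and
   [dl = partial_last F p t], the case of KO and SKO. *)
Record odd_direction (dl : 'End(O)) : Prop := OddDirection {
  dl_mul : forall a b, dl (a ** b) = dl a ** b + eps a ** dl b;
  dl_eps : forall a, dl (eps a) = - eps (dl a);
  dl_dl : forall a, dl (dl a) = 0;
  dl_partial : forall i a, dl (d_ (X i) a) = (-1) ^+ mu (X i) *: d_ (X i) (dl a);
  dl_xvar : forall i, dl (xvar F p t (X i)) = 0;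
  dl_top : forall a, dl a top = 0;
  dl_ker : forall a, (forall i, d_ (X i) a = 0) -> dl a = 0 -> forall r, d_ r a = 0;
  dl_mon : forall w, exists (c : F) w',
    [/\ dl (mon F w) = c *: mon F w', w'.1 = w.1 &
        forall k, (widen_ord leNn k \in w'.2) = (widen_ord leNn k \in w.2)]
}.

Section Direction.
Variables (dl : 'End(O)) (dlP : odd_direction dl).

Lemma dl_Euler a : dl (E a) = E (dl a).
Proof.
rewrite !EulerE lfun_sum; apply: eq_bigr => i _.
rewrite (dl_mul dlP) (dl_xvar dlP) lmul0l add0r (dl_partial dlP) lfunZ.
by rewrite (parop_Opar (xvar_Opar _)) lmulZl scalerA -signr_addb addbb scale1r.
Qed.

Lemma dl_Opar d a : a \in Opr d -> dl a \in Opr (~~ d).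
Proof.
move/parop_Opar=> h; apply/OparP.
have := dl_eps dlP a; rewrite h lfunZ => /eqP; rewrite eq_sym eqr_oppLR => /eqP ->.
by case: d {h}; rewrite ?expr0 ?expr1 ?scaleN1r ?scale1r ?opprK.
Qed.

(* [Pop kap] is [Delta] for [dl = 0]; for [dl = partial_last F p t] it is
   [div_lambda lambda] with [kap = N lambda], up to the parity sign and the
   factor 2. *)
Definition Pop (kap : F) : 'End(O) := (Dl + ((E - kap *: \1) \o dl))%VF.

Lemma PopE kap a : Pop kap a = Dl a + (E (dl a) - kap *: dl a).
Proof. by rewrite add_lfunE comp_lfunE add_lfunE opp_lfunE scale_lfunE id_lfunE. Qed.

#[local] Opaque Pop Euler.

Lemma Delta_sum a : Dl a = \sum_k d_ (X (inl k)) (d_ (X (inr k)) a).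
Proof. by rewrite /Delta sum_lfunE; apply: eq_bigr => k _; rewrite comp_lfunE. Qed.

#[local] Opaque Delta.

Lemma Delta_Euler a : Dl (E a) = E (Dl a) + 2%:R *: Dl a.
Proof.
rewrite !Delta_sum lfun_sum scaler_sumr -big_split; apply: eq_bigr => k _ /=.
by rewrite (partial_Euler (inr k)) lfunD (partial_Euler (inl k)) -addrA -mulr2n scaler_nat.
Qed.

Lemma dl_Delta a : dl (Dl a) = - Dl (dl a).
Proof.
rewrite !Delta_sum lfun_sum -sumrN; apply: eq_bigr => k _.
by rewrite !(dl_partial dlP) lfunZ /= expr0 expr1 scale1r scaleN1r.
Qed.

Lemma Delta_Delta a : Dl (Dl a) = 0.
Proof.
apply: eq_oppO; rewrite !Delta_sum; apply: sum_comm_anticomm => k l x.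
- by rewrite (partial_comm charFp) /= expr0 scale1r.
- by rewrite (partial_comm charFp) /= expr0 scale1r.
- by have := partial_comm charFp (X (inr k)) (X (inr l)) x; rewrite expr1 scaleN1r.
Qed.

(** [Delta] has square zero, anticommutes with [dl] and lowers the Euler degree by 2; the shift of
    the parameter compensates for this drop. *)
Lemma Pop_Pop kap a : Pop kap (Pop (kap + 2%:R) a) = 0.
Proof.
rewrite !PopE !lfunD !lfunN !lfunZ Delta_Delta Delta_Euler dl_Delta dl_Euler (dl_dl dlP).
rewrite !(lfun0, lfunN).
by apply/ffunP => w; rewrite !coefE; ring.
Qed.

(* [TH] for [dl = 0] and [DKO] for [dl = partial_last F p t]. *)
Definition Dop : 'Hom(O, 'End(O)) := linext (fun w =>
    TH F p leNn t (mon F w)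
    + (-1) ^+ par_mon w *: fder (dl (mon F w)) E
    + fder (E (mon F w) - 2%:R *: mon F w) dl).

Lemma THE a b : TH F p leNn t a b =
  \sum_k (d_ (X (inr k)) (eps a) ** d_ (X (inl k)) b + d_ (X (inl k)) a ** d_ (X (inr k)) b).
Proof.
elim/mon_ind: a => [|c a a' IHa IHa'|w].
- rewrite lfun0 zero_lfunE big1 // => k _; by rewrite !(lfun0, zero_lfunE) addr0.
- rewrite lfunD lfunZ add_lfunE scale_lfunE IHa IHa' scaler_sumr -big_split.
  apply: eq_bigr => k _; rewrite !(lfun_linear, lmulDl, lmulZl, add_lfunE, scale_lfunE).
  by apply/ffunP => w; rewrite !coefE; ring.
rewrite /TH linext_basis sum_lfunE sum_2N; apply: eq_bigr => k _.
by rewrite /= !scale_lfunE !comp_lfunE expr0 scale1r parop_mon !(lfunZ, lmulZl).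
Qed.

#[local] Opaque TH.

Lemma DopE a b : Dop a b = TH F p leNn t a b + dl (eps a) ** E b
  + (E a - 2%:R *: a) ** dl b.
Proof.
elim/mon_ind: a => [|c a a' IHa IHa'|w].
- by rewrite !(lfun0, zero_lfunE) scaler0 subr0 !(lfun0, zero_lfunE) !addr0.
- rewrite (lfun_linear Dop) add_lfunE scale_lfunE IHa IHa' {IHa IHa'}.
  rewrite (lfun_linear (TH F p leNn t)) add_lfunE scale_lfunE.
  rewrite (lfun_linear eps) (lfun_linear dl) (lfun_linear E).
  rewrite !(lmulBl, lmulDl, lmulZl).
  by apply/ffunP => w; rewrite !coefE; ring.
rewrite /Dop linext_basis !add_lfunE scale_lfunE !comp_lfunE parop_mon !(lfunZ, lmulZl).
by [].
Qed.

End Direction.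
End ContactOperators.

(** * Commutators of contact vector fields *)

Section ContactBracket.
Context (F : fieldType) (p N n : nat) (leNn : (N <= n)%N) (t : 'I_N -> nat).
Hypotheses (charFp : p \in [pchar F]) (p_gt2 : (2 < p)%N) (t_gt0 : forall i, (0 < t i)%N).
Local Notation O := (dpO F p n t).
Local Notation M := (supermon p n t).
Local Notation "a ** b" := (lmul F p n t a b) (at level 40, left associativity).
Local Notation eps := (parop F p n t).
Local Notation Opr := (Opar F p n t).
Local Notation d_ := (partial F p t).
Local Notation X := (var2N leNn).
Local Notation E := (Euler F p leNn t).
Local Notation Dl := (Delta F p leNn t).
Variables (dl : 'End(O)) (dlP : odd_direction leNn charFp t_gt0 dl).
#[local] Opaque mon lmul partial parop Euler Delta TH Pop Dop.
Local Notation Pop := (Pop leNn dl).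
Local Notation Dop := (Dop leNn dl).
Implicit Types (a b c x y : O) (w : M) (k l : 'I_N) (i : 'I_N + 'I_N).

Let endD (f : 'End(O)) a b : f (a + b) = f a + f b := lfunD f a b.
Let endB (f : 'End(O)) a b : f (a - b) = f a - f b := lfunB f a b.
Let endN (f : 'End(O)) a : f (- a) = - f a := lfunN f a.
Let endZ (f : 'End(O)) (x : F) a : f (x *: a) = x *: f a := lfunZ f x a.

Lemma Pop_lmul kap c b :
  Pop kap (c ** b) = Pop kap c ** b + eps c ** Pop (kap - 2%:R) b + Dop (eps c) b.
Proof.
have h1 : Dl (c ** b) = Dl c ** b + eps c ** Dl b + TH F p leNn t (eps c) b.
  rewrite -> !Delta_sum, THE, lmul_suml; rewrite (lfun_sum (lmul F p n t (eps c))) -!big_split.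
  apply: eq_bigr => k _; cbn beta.
  rewrite -> (partial_lmul charFp), endD, !(partial_lmul charFp), paropK.
  rewrite /= !id_lfunE -!addrA; congr (_ + _).
  by rewrite addrC -addrA addrC -addrA; congr (_ + _); rewrite addrC.
have h2 : Dop (eps c) b = TH F p leNn t (eps c) b + dl c ** E b + (E (eps c) - 2%:R *: eps c)
  ** dl b.
  by rewrite -> DopE, paropK.
rewrite -> (PopE leNn dl kap (c ** b)), (PopE leNn dl kap c), (PopE leNn dl _ b).
exact: (contact_operator_mul (mul := lmul F p n t) (E := E) kap h1 h2 (dl_mul dlP c b)
  (Euler_mul leNn charFp t_gt0)).
Qed.

Lemma PopB kap kap' a : Pop kap a = Pop kap' a - (kap - kap') *: dl a.
Proof. by rewrite -> !PopE; vec. Qed.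

Lemma Pop_parop kap a : Pop kap (eps a) = - eps (Pop kap a).
Proof.
have DlE : Dl (eps a) = - eps (Dl a).
  rewrite -> !Delta_sum; rewrite (lfun_sum eps) -sumrN; apply: eq_bigr => k _.
  by rewrite -> !partial_parop, endZ, partial_parop; rewrite /= expr0 expr1 scaleN1r scale1r.
rewrite -> !PopE, DlE, (dl_eps dlP), endN, (Euler_parop leNn charFp t_gt0), endD, endB, endZ.
by vec.
Qed.

Lemma Pop_Opar kap (d : bool) a : a \in Opr d -> Pop kap a \in Opr (~~ d).
Proof.
move/parop_Opar=> h; apply/(OparP charFp p_gt2).
have := Pop_parop kap a; rewrite -> h, endZ => /eqP; rewrite eq_sym eqr_oppLR => /eqP ->.
by case: d {h}; rewrite ?expr0 ?expr1 ?scaleN1r ?scale1r ?opprK.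
Qed.

(** The Leibniz rule for a fixed left factor [b], with [sg] standing for the sign exchanged between
    [T] and [b]. *)
Definition is_superder (sg : F) b (T : O -> O) :=
  forall x, T (b ** x) = T b ** x + sg *: (b ** T x).

Lemma is_superderD sg b T T' : is_superder sg b T -> is_superder sg b T' ->
  is_superder sg b (fun x => T x + T' x).
Proof.
move=> h h' x; rewrite -> h, h', lmulDl, endD.
by move: (_ ** _) (_ ** _) (_ ** _) (_ ** _) => *; vec.
Qed.

Lemma is_superder_sum sg b (I : finType) (T : I -> O -> O) :
  (forall s, is_superder sg b (T s)) -> is_superder sg b (fun x => \sum_s T s x).
Proof.
move=> h x; rewrite -> lmul_suml; rewrite (lfun_sum (lmul F p n t b)) scaler_sumr -big_split.
by apply: eq_bigr => s _; apply: h.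
Qed.

Lemma parop_mem (d : bool) a : a \in Opr d -> eps a \in Opr d.
Proof. by move=> ha; rewrite (parop_Opar ha) rpredZ. Qed.

Lemma Euler2_mem (d : bool) a : a \in Opr d -> E a - 2%:R *: a \in Opr d.
Proof. by move=> ha; rewrite rpredB ?rpredZ ?Euler_Opar. Qed.

(** Each summand of [DopE] is a coefficient times a superderivation, of total parity [~~ d], so
    [fder_superder] gives the same sign for all of them. *)
Lemma Dop_der (d z : bool) a b : a \in Opr d -> b \in Opr z ->
  is_superder ((-1) ^+ (~~ d && z)) b (Dop a).
Proof.
move=> ha hb x; have hea := parop_mem ha.
pose T y := TH F p leNn t a y + dl (eps a) ** E y + (E a - 2%:R *: a) ** dl y.
suff h : is_superder ((-1) ^+ (~~ d && z)) b T.
  by have := h x; rewrite /T; rewrite <- !DopE.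
apply: is_superderD; first apply: is_superderD.
- have h : is_superder ((-1) ^+ (~~ d && z)) b (fun y =>
    \sum_k (d_ (X (inr k)) (eps a) ** d_ (X (inl k)) y + d_ (X (inl k)) a ** d_ (X (inr k)) y)).
    apply: is_superder_sum => k; apply: is_superderD => y.
      have := fder_superder charFp t_gt0 y (partial_lmul charFp (X (inl k)))
        (partial_Opar charFp p_gt2 (X (inr k)) hea) hb.
      by rewrite [mu _]/= [mu _]/= addbT addbF.
    have := fder_superder charFp t_gt0 y (partial_lmul charFp (X (inr k)))
      (partial_Opar charFp p_gt2 (X (inl k)) ha) hb.
    by rewrite [mu _]/= [mu _]/= addbT addbF.
  by move=> y; have := h y; rewrite <- !THE.
- move=> y; have := fder_superder charFp t_gt0 y (Euler_der leNn charFp t_gt0)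
  (dl_Opar p_gt2 dlP hea) hb.
  by rewrite addbF.
- move=> y; have := fder_superder (e := true) charFp t_gt0 y (dl_mul dlP) (Euler2_mem ha) hb.
  by rewrite addbT.
Qed.

Lemma Dop_Opar (d z : bool) a b : a \in Opr d -> b \in Opr z -> Dop a b \in Opr (~~ d (+) z).
Proof.
move=> ha hb; have hea := parop_mem ha.
have aux (u v : bool) f g : f \in Opr u -> g \in Opr v -> u (+) v = ~~ d (+) z ->
  f ** g \in Opr (~~ d (+) z).
  by move=> hf hg <-; apply: lmul_Opar.
rewrite -> DopE, THE; apply: rpredD; first apply: rpredD.
- apply: rpred_sum => k _; apply: rpredD.
    apply: aux (partial_Opar charFp p_gt2 _ hea) (partial_Opar charFp p_gt2 _ hb) _.
    by rewrite /= addbT addbF.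
  apply: aux (partial_Opar charFp p_gt2 _ ha) (partial_Opar charFp p_gt2 _ hb) _.
  by rewrite /= addbT addbF addbN addNb.
- exact: aux (dl_Opar p_gt2 dlP hea) (Euler_Opar leNn charFp p_gt2 t_gt0 hb) _.
- by apply: aux (Euler2_mem ha) (dl_Opar p_gt2 dlP hb) _; rewrite addbN addNb.
Qed.

Lemma Dop_bracket nu (d z : bool) a b x : a \in Opr d -> b \in Opr z ->
  Pop nu a = 0 -> Pop nu b = 0 ->
  Dop a (Dop b x) - (-1) ^+ (~~ d && ~~ z) *: Dop b (Dop a x) =
    (-1) ^+ d *: Dop (Pop (nu + 2%:R) (a ** b)) x.
Proof.
move=> ha hb Pa Pb.
have hd := dl_Opar p_gt2 dlP ha.
have comm y : b ** (dl a ** y) = (-1) ^+ (~~ d && z) *: (dl a ** b ** y).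
  rewrite -> (lmul_superC charFp t_gt0 y hb hd), (lmulA charFp t_gt0).
  by rewrite andbC.
have := D_bracket (dl_mul dlP) PopB (Pop_Pop p_gt2 dlP) Pop_lmul (lmulA charFp t_gt0)
  (@lmul_parop F p N n t) Pop_parop (s := (-1) ^+ d) (u := (-1) ^+ z) (sg := (-1) ^+ (~~ d && z))
  _ _ _ (parop_Opar ha) (parop_Opar hb) Pa Pb (Dop_der ha hb) comm x.
rewrite -!signr_addb !addbb => <- //; congr (_ + _); rewrite -scaleNr; congr (_ *: _).
by case: d {ha hd comm}; case: z {hb} => /=; rewrite ?expr0 ?expr1 ?opprK.
Qed.

End ContactBracket.

(** * Derived algebras *)

Section DerivedAlgebra.
Context (F : fieldType) (p N n : nat) (leNn : (N <= n)%N) (t : 'I_N -> nat).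
Hypotheses (charFp : p \in [pchar F]) (p_gt2 : (2 < p)%N) (t_gt0 : forall i, (0 < t i)%N).
Local Notation O := (dpO F p n t).
Local Notation M := (supermon p n t).
Local Notation "a ** b" := (lmul F p n t a b) (at level 40, left associativity).
Local Notation Opr := (Opar F p n t).
Variables (dl : 'End(O)) (dlP : odd_direction leNn charFp t_gt0 dl).
#[local] Opaque mon lmul partial parop Euler Delta TH Pop Dop.
Local Notation Pop := (Pop leNn dl).
Local Notation Dop := (Dop leNn dl).
Implicit Types (a b c x y : O) (w : M) (k l : 'I_N) (i : 'I_N + 'I_N).

Let endD (f : 'End(O)) a b : f (a + b) = f a + f b := lfunD f a b.

(** A pointwise form of [end_homog], to which [end_homogP] shows it equivalent. *)
Definition ehom (d : bool) (A : 'End(O)) :=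
  forall (z : bool) x, x \in Opr z -> A x \in Opr (d (+) z).

Lemma end_parE (d : bool) (A : 'End(O)) x :
  end_par d A x = proj_par F p n t d (A (proj_par F p n t false x))
                + proj_par F p n t (~~ d) (A (proj_par F p n t true x)).
Proof. by rewrite /end_par big_bool add_lfunE !comp_lfunE addrC. Qed.

Lemma ehom_par (d : bool) (A : 'End(O)) : ehom d A -> end_par d A = A.
Proof.
move=> hA; apply/lfunP => x; rewrite end_parE.
have h0 := hA false _ (Opar_proj false x); have h1 := hA true _ (Opar_proj true x).
rewrite addbF in h0; rewrite addbT in h1.
by rewrite (proj_par_id h0) (proj_par_id h1) -lfunD proj_par_sum.
Qed.

Lemma ehom_par_other (d : bool) (A : 'End(O)) : ehom d A -> end_par (~~ d) A = 0.
Proof.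
move=> hA; apply/lfunP => x; rewrite end_parE zero_lfunE.
have h0 := hA false _ (Opar_proj false x); have h1 := hA true _ (Opar_proj true x).
rewrite addbF in h0; rewrite addbT in h1.
by rewrite (proj_par_other h0) (proj_par_other h1) addr0.
Qed.

Lemma end_homogP (d : bool) (A : 'End(O)) : end_homog d A <-> ehom d A.
Proof.
split=> [<- z x hx|]; last exact: ehom_par.
rewrite end_parE; case: z hx => hx.
  by rewrite (proj_par_other hx : proj_par F p n t false x = 0) !lfun0 add0r addbT;
    apply: Opar_proj.
by rewrite (proj_par_other hx : proj_par F p n t true x = 0) !lfun0 addr0 addbF; apply: Opar_proj.
Qed.

Lemma sbracket_homog (d e : bool) (A B : 'End(O)) : ehom d A -> ehom e B ->
  sbracket A B = (A \o B)%VF - (-1) ^+ (d && e) *: (B \o A)%VF.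
Proof.
move=> hA hB.
have pA s : end_par s A = if s == d then A else 0.
  case: eqP => [->|]; first exact: ehom_par.
  by move=> sd; have -> : s = ~~ d; [case: s d sd {hA} => [] [] | exact: ehom_par_other].
have pB s : end_par s B = if s == e then B else 0.
  case: eqP => [->|]; first exact: ehom_par.
  by move=> sd; have -> : s = ~~ e; [case: s e sd {hB} => [] [] | exact: ehom_par_other].
pose G s u := (end_par s A \o end_par u B)%VF - (-1) ^+ (s && u) *: (end_par u B \o end_par s A)%VF.
have GA s u : s != d -> G s u = 0.
  by move=> sd; rewrite /G pA (negPf sd) comp_lfun0l comp_lfun0r scaler0 subr0.
have GB s u : u != e -> G s u = 0.
  by move=> ue; rewrite /G pB (negPf ue) comp_lfun0l comp_lfun0r scaler0 subr0.
have -> : sbracket A B = G true true + G true false + (G false true + G false false).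
  rewrite /sbracket big_bool; congr (_ + _); exact: big_bool.
have <- : G d e = (A \o B)%VF - (-1) ^+ (d && e) *: (B \o A)%VF.
  by rewrite /G pA pB !eqxx.
move: G GA GB {pA pB hA hB} => G GA GB.
case: d GA => GA; case: e GB => GB.
- by rewrite (GB true false) // (GA false true) // (GA false false) // !addr0.
- by rewrite (GB true true) // (GA false true) // (GA false false) // !addr0 add0r.
- by rewrite (GA true true) // (GA true false) // (GB false false) // !addr0 add0r.
- by rewrite (GA true true) // (GA true false) // (GB false true) // !add0r.
Qed.

Lemma Dop_ehom (d : bool) a : a \in Opr d -> ehom (~~ d) (Dop a).
Proof. by move=> ha z x hx; apply: (Dop_Opar p_gt2 dlP ha hx). Qed.

Lemma Dop_sbracket nu (d z : bool) a b : a \in Opr d -> b \in Opr z ->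
  Pop nu a = 0 -> Pop nu b = 0 ->
  sbracket (Dop a) (Dop b) = (-1) ^+ d *: Dop (Pop (nu + 2%:R) (a ** b)).
Proof.
move=> ha hb Pa Pb; rewrite (sbracket_homog (Dop_ehom ha) (Dop_ehom hb)).
apply/lfunP => x; rewrite add_lfunE opp_lfunE !scale_lfunE !comp_lfunE.
exact: (Dop_bracket p_gt2 dlP x ha hb Pa Pb).
Qed.

Definition graded (K : {vspace O}) := forall d a, a \in K -> proj_par F p n t d a \in K.

Definition prodspan (K : {vspace O}) : {vspace O} :=
  <<[seq a ** b | a <- vbasis K, b <- vbasis K]>>%VS.

Lemma mem_prodspan (K : {vspace O}) a b : a \in K -> b \in K -> a ** b \in prodspan K.
Proof.
move=> /coord_vbasis-> /coord_vbasis->.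
rewrite lmul_suml; apply: rpred_sum => i _; rewrite lmulZl; apply: rpredZ.
rewrite (lfun_sum (lmul F p n t _)); apply: rpred_sum => j _.
rewrite lfunZ; apply: rpredZ.
by apply/memv_span/allpairs_f; exact: memt_nth.
Qed.

Lemma prodspan_sub (K W : {vspace O}) :
  (forall a b, a \in K -> b \in K -> a ** b \in W) -> (prodspan K <= W)%VS.
Proof.
move=> h; apply/span_subvP => _ /allpairsP[[a b] [/= ha hb ->]].
by apply: h; apply: vbasis_mem.
Qed.

Lemma proj_par_split (K : {vspace O}) a : graded K -> a \in K ->
  exists a0 a1, [/\ a = a0 + a1, a0 \in K, a1 \in K, a0 \in Opr false & a1 \in Opr true].
Proof.
move=> gK ha; exists (proj_par F p n t false a), (proj_par F p n t true a).
by rewrite proj_par_sum !gK ?Opar_proj.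
Qed.

Lemma proj_par_hom (d e : bool) a : a \in Opr e -> proj_par F p n t d a = if d == e then a else 0.
Proof.
move=> ha; case: eqP => [->|]; first exact: proj_par_id.
by move=> de; have -> : d = ~~ e; [case: d e de {ha} => [] [] | exact: proj_par_other].
Qed.

Lemma graded_prodspan (K : {vspace O}) : graded K -> graded (prodspan K).
Proof.
move=> gK d.
suff /subvP h : (prodspan K <= proj_par F p n t d @^-1: prodspan K)%VS.
  by move=> a /h; rewrite -memv_preim.
apply: prodspan_sub => a b aK bK; rewrite -memv_preim.
have [a0 [a1 [-> a0K a1K a0h a1h]]] := proj_par_split gK aK.
have [b0 [b1 [-> b0K b1K b0h b1h]]] := proj_par_split gK bK.
have hom (u v : bool) a' b' : a' \in K -> b' \in K -> a' \in Opr u -> b' \in Opr v ->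
    proj_par F p n t d (a' ** b') \in prodspan K.
  move=> aK' bK' ha hb; rewrite (proj_par_hom d (lmul_Opar ha hb)).
  by case: eqP => _; rewrite ?rpred0 // mem_prodspan.
rewrite lmulDl !(lfunD (lmul F p n t _)) !(lfunD (proj_par F p n t d)).
by rewrite !rpredD //; [apply: (hom false false)|apply: (hom false true)|apply:
  (hom true false)|apply: (hom true true)].
Qed.

Lemma derived_Dop nu (K : {vspace O}) : graded K -> (K <= lker (Pop nu))%VS ->
  derived (Dop @: K)%VS = (Dop @: (Pop (nu + 2%:R) @: prodspan K))%VS.
Proof.
move=> gK /subvP hK.
have kerK a : a \in K -> Pop nu a = 0 by move/hK; rewrite memv_ker => /eqP.
have hom (d z : bool) a b : a \in K -> b \in K -> a \in Opr d -> b \in Opr z ->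
    sbracket (Dop a) (Dop b) = (-1) ^+ d *: Dop (Pop (nu + 2%:R) (a ** b)).
  by move=> aK bK ha hb; apply: Dop_sbracket ha hb (kerK _ aK) (kerK _ bK).
have DopD a b : Dop (a + b) = Dop a + Dop b by exact: lfunD.
have sbDl (A A' B : 'End(O)) : sbracket (A + A') B = sbracket A B + sbracket A' B.
  by have := sbracketPl 1 A A' B; rewrite !scale1r.
have sbDr (A B B' : 'End(O)) : sbracket A (B + B') = sbracket A B + sbracket A B'.
  by have := sbracketPr 1 A B B'; rewrite !scale1r.
have memR a b : a \in K -> b \in K ->
    Dop (Pop (nu + 2%:R) (a ** b)) \in (Dop @: (Pop (nu + 2%:R) @: prodspan K))%VS.
  by move=> aK bK; rewrite !memv_img // mem_prodspan.
apply/eqP; rewrite eqEsubv; apply/andP; split.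
  apply/span_subvP => _ /allpairsP[[A B] [/= /vbasis_mem hA /vbasis_mem hB ->]].
  have [a aK ->] := memv_imgP hA; have [b bK ->] := memv_imgP hB.
  have [a0 [a1 [-> a0K a1K a0h a1h]]] := proj_par_split gK aK.
  have [b0 [b1 [-> b0K b1K b0h b1h]]] := proj_par_split gK bK.
  rewrite -> !DopD; rewrite (sbDl (Dop a0) (Dop a1)) (sbDr (Dop a0) (Dop b0))
    (sbDr (Dop a1) (Dop b0)).
  rewrite -> (hom _ _ _ _ a0K b0K a0h b0h), (hom _ _ _ _ a0K b1K a0h b1h).
  rewrite -> (hom _ _ _ _ a1K b0K a1h b0h), (hom _ _ _ _ a1K b1K a1h b1h).
  apply: rpredD; apply: rpredD; apply: rpredZ; exact: memR.
apply/subvP => _ /memv_imgP[_ /memv_imgP[c hc ->] ->].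
suff h : (prodspan K <= (Dop \o Pop (nu + 2%:R)) @^-1: derived (Dop @: K))%VS.
  by move/subvP: h => /(_ c hc); rewrite -memv_preim comp_lfunE.
apply: prodspan_sub => a b aK bK; rewrite -memv_preim comp_lfunE.
have [a0 [a1 [-> a0K a1K a0h a1h]]] := proj_par_split gK aK.
have [b0 [b1 [-> b0K b1K b0h b1h]]] := proj_par_split gK bK.
(* The sign in the bracket formula is invertible, so each of these fields is itself a bracket up to
   sign. *)
have hom' (d z : bool) a' b' : a' \in K -> b' \in K -> a' \in Opr d -> b' \in Opr z ->
    Dop (Pop (nu + 2%:R) (a' ** b')) \in derived (Dop @: K)%VS.
  move=> aK' bK' ha hb; have := hom d z a' b' aK' bK' ha hb.
  move=> /(congr1 (fun v => (-1) ^+ d *: v)); rewrite scalerA -signr_addb addbb scale1r => <-.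
  by rewrite rpredZ // memv_derived // memv_img.
rewrite -> lmulDl, !endD, !DopD.
apply: rpredD; apply: rpredD.
- exact: (hom' false false).
- exact: (hom' false true).
- exact: (hom' true false).
- exact: (hom' true true).
Qed.

End DerivedAlgebra.

(** * Integration by parts and the orthogonal of the products *)

Section Orthogonality.
Context (F : fieldType) (p N n : nat) (leNn : (N <= n)%N) (t : 'I_N -> nat).
Hypotheses (charFp : p \in [pchar F]) (p_gt2 : (2 < p)%N) (t_gt0 : forall i, (0 < t i)%N).
Local Notation O := (dpO F p n t).
Local Notation M := (supermon p n t).
Local Notation "a ** b" := (lmul F p n t a b) (at level 40, left associativity).
Local Notation eps := (parop F p n t).
Local Notation Opr := (Opar F p n t).
Local Notation d_ := (partial F p t).
Local Notation X := (var2N leNn).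
Local Notation E := (Euler F p leNn t).
Local Notation Dl := (Delta F p leNn t).
Local Notation top := (topmon n charFp t_gt0).
Variables (dl : 'End(O)) (dlP : odd_direction leNn charFp t_gt0 dl).
#[local] Opaque mon lmul partial parop Euler Delta TH Pop Dop.
Local Notation Pop := (Pop leNn dl).
Local Notation Dop := (Dop leNn dl).
Implicit Types (a b c x y : O) (w : M) (k l : 'I_N) (i : 'I_N + 'I_N).

Let endD (f : 'End(O)) a b : f (a + b) = f a + f b := lfunD f a b.
Let endB (f : 'End(O)) a b : f (a - b) = f a - f b := lfunB f a b.
Let endN (f : 'End(O)) a : f (- a) = - f a := lfunN f a.
Let endZ (f : 'End(O)) (x : F) a : f (x *: a) = x *: f a := lfunZ f x a.

Local Notation one := (mon F (monone n charFp t_gt0)).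
Local Notation xv i := (xvar F p t (X i)).

Let mulBl a a' b : (a - a') ** b = a ** b - a' ** b := lmulBl a a' b.
Let mulDl a a' b : (a + a') ** b = a ** b + a' ** b := lmulDl a a' b.
Let mulZl (z : F) a b : (z *: a) ** b = z *: (a ** b) := lmulZl z a b.

Let end0 (f : 'End(O)) : f 0 = 0 := lfun0 f.
Let mul0l a : 0 ** a = 0 := lmul0l a.

(** Each pair [(x_k, x_{k'})] contributes [(p ^ t k - 1) + 1] to the Euler degree of the top
    monomial, which is zero in the field because [t k > 0]. *)
Lemma Euler_top a : E a top = 0.
Proof.
rewrite (Euler_coef leNn charFp t_gt0) /deg2.
have -> : (\sum_k top.1 k + \sum_k (widen_ord leNn k \in top.2))%:R = 0 :> F.
  rewrite natrD !natr_sum -big_split big1 // => k _ /=.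
  rewrite ffunE in_setT /= natr1 prednK ?(pt_gt0 charFp) // natrX.
  by rewrite (pcharf0 charFp) expr0n eqn0Ngt t_gt0.
by rewrite mul0r.
Qed.

Lemma top_partial_even i f u : mu (X i) = false -> (f ** d_ (X i) u) top = - (d_ (X i) f ** u) top.
Proof.
move=> hi; have := partial_top charFp t_gt0 (X i) (f ** u).
rewrite -> (partial_lmul charFp); rewrite hi /= id_lfunE addO_coef addrC => /eqP.
by rewrite addr_eq0 => /eqP.
Qed.

Lemma top_odd (A : 'End(O)) f u : (forall a b, A (a ** b) = A a ** b + eps a ** A b) ->
  (forall a, A a top = 0) -> (f ** A u) top = - (A (eps f) ** u) top.
Proof.
move=> hA htop; have := htop (eps f ** u).
rewrite -> hA, paropK; rewrite addO_coef addrC => /eqP.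
by rewrite addr_eq0 => /eqP.
Qed.

Lemma top_Delta f u : (f ** Dl u) top = (Dl (eps f) ** u) top.
Proof.
rewrite -> !Delta_sum, lmul_suml; rewrite (lfun_sum (lmul F p n t f)) !sumO_coef.
apply: eq_bigr => k _.
rewrite (top_partial_even (i := inl k)) // (top_odd _ _ (partial_lmul charFp (X (inr k))));
  last first.
  by move=> a; apply: partial_top.
rewrite opprK.
have -> : eps (d_ (X (inl k)) f) = d_ (X (inl k)) (eps f).
  by rewrite partial_parop /= expr0 scale1r.
have -> // : d_ (X (inr k)) (d_ (X (inl k)) (eps f)) = d_ (X (inl k)) (d_ (X (inr k)) (eps f)).
by rewrite (partial_comm charFp) /= expr0 scale1r.
Qed.

Lemma top_Euler f u : (f ** E u) top = - (E f ** u) top.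
Proof.
have := Euler_top (f ** u); rewrite -> (Euler_mul leNn charFp t_gt0).
by rewrite addO_coef addrC => /eqP; rewrite addr_eq0 => /eqP.
Qed.

(* Integration by parts: [a top] is the integral of [a], and the integral of a
   derivative vanishes. *)
Lemma top_Pop kap f v : (f ** Pop kap v) top = (Pop (- kap) (eps f) ** v) top.
Proof.
have hdl u : (f ** dl u) top = - (dl (eps f) ** u) top.
  exact: top_odd (dl_mul dlP) (dl_top dlP).
have hE : (f ** E (dl v)) top = (E (dl (eps f)) ** v) top.
  rewrite top_Euler (top_odd _ _ (dl_mul dlP) (dl_top dlP)) opprK.
  by rewrite -(Euler_parop leNn charFp t_gt0) (dl_Euler dlP).
rewrite -> !PopE, mulDl, mulBl, mulZl, endD, endB, endZ.
rewrite !addO_coef !oppO_coef !scaleO_coef top_Delta hE hdl.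
ring.
Qed.

(* By [top_Pop], the transpose of [Pop (nu + 2)] under [(f ** g) top] is
   [Pop (- (nu + 2))] up to signs; this is [Pop nu] if [dl = 0] or [nu = -1]. *)
Variable nu : F.
Hypothesis nu_adj : forall f, Pop (- (nu + 2%:R)) f = Pop nu f.
Local Notation Rim := (limg (Pop (nu + 2%:R))).

Lemma Rim_ker : (Rim <= lker (Pop nu))%VS.
Proof.
apply/subvP => _ /memv_imgP[a _ ->]; rewrite memv_ker.
by apply/eqP; apply: (Pop_Pop p_gt2 dlP).
Qed.

Lemma Pop_proj kap (d : bool) a :
  Pop kap (proj_par F p n t d a) = proj_par F p n t (~~ d) (Pop kap a).
Proof.
have h0 := Pop_Opar p_gt2 dlP kap (Opar_proj false a : _ \in Opr false).
have h1 := Pop_Opar p_gt2 dlP kap (Opar_proj true a : _ \in Opr true).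
rewrite -[in RHS](proj_par_sum a).
rewrite -> endD, endD, (proj_par_hom (~~ d) h0), (proj_par_hom (~~ d) h1).
by case: d; [exact: esym (add0r _) | exact: esym (addr0 _)].
Qed.

(** Since [c] is orthogonal to [b ** Pop (nu + 2) v] for every [v], integration by parts makes
    [Pop nu (eps (c ** b))] orthogonal to everything. *)
Lemma perp_ker c : (forall a, a \in prodspan Rim -> (c ** a) top = 0) ->
  forall b, b \in Rim -> Pop nu (c ** b) = 0.
Proof.
move=> hc b hb.
suff h : Pop nu (eps (c ** b)) = 0.
  have := Pop_parop dlP nu (c ** b).
  by rewrite h => /eqP; rewrite eq_sym oppr_eq0 => /eqP /(congr1 eps); rewrite paropK lfun0.
apply: (lmul_nondeg (charFp := charFp) (t_gt0 := t_gt0)) => v.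
rewrite -nu_adj -top_Pop (lmulA charFp t_gt0); apply: hc.
by apply: mem_prodspan hb _; rewrite memv_img ?memvf.
Qed.

Hypothesis N_gt1 : (1 < N)%N.

Lemma partial_xv i j : d_ (X i) (xv j) = (i == j)%:R *: one.
Proof.
rewrite (partial_xvar charFp t_gt0); congr (_%:R *: _); congr nat_of_bool.
by case: i => k; case: j => l.
Qed.

Lemma Pop_xv kap i : Pop kap (xv i) = 0.
Proof.
rewrite -> PopE, Delta_sum, (dl_xvar dlP), end0; rewrite scaler0 subr0 addr0.
rewrite big1 // => k _; rewrite -> partial_xv, endZ.
by rewrite (partial_one charFp t_gt0 (X (inl k))) scaler0.
Qed.

Lemma Euler_xv i : E (xv i) = xv i.
Proof.
rewrite -> EulerE; rewrite (bigD1 i) // big1 => [|j ji].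
  by rewrite Monoid.mulm1 partial_xv eqxx scale1r (lmul1r charFp t_gt0).
by rewrite partial_xv (negPf ji) scale0r lfun0.
Qed.

(* A preimage of [1] under each [Pop kap]; its product with a variable away from
   the pair [k] is a preimage of that variable. *)
Definition pairmon k := xv (inl k) ** xv (inr k).

Lemma partial_pairmon i k : i != inl k -> i != inr k -> d_ (X i) (pairmon k) = 0.
Proof.
move=> h1 h2; rewrite /pairmon; rewrite -> (partial_lmul charFp), !partial_xv.
by rewrite (negPf h1) (negPf h2) !scale0r lmul0l lfun0 addr0.
Qed.

Lemma dl_pairmon k : dl (pairmon k) = 0.
Proof.
by rewrite /pairmon; rewrite -> (dl_mul dlP), !(dl_xvar dlP), mul0l, end0; rewrite addr0.
Qed.

Lemma partial_pairmon_odd k : d_ (X (inr k)) (pairmon k) = xv (inl k).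
Proof.
rewrite /pairmon; rewrite -> (partial_lmul charFp), !partial_xv.
have hx := xvar_Opar charFp t_gt0 (X (inl k)).
by rewrite (negPf (isT : inr k != inl k)) eqxx scale0r lmul0l add0r scale1r
  (lmul1r charFp t_gt0) (parop_Opar hx) /= expr0 scale1r.
Qed.

Lemma parop_pairmon k : eps (pairmon k) = - pairmon k.
Proof.
rewrite /pairmon; rewrite -> lmul_parop.
have hx := xvar_Opar charFp t_gt0 (X (inl k)).
have hy := xvar_Opar charFp t_gt0 (X (inr k)).
by rewrite (parop_Opar hx) (parop_Opar hy) /= expr0 scale1r expr1 scaleN1r lfunN.
Qed.

Lemma Pop_pairmon kap k : Pop kap (pairmon k) = one.
Proof.
rewrite -> PopE, dl_pairmon, Delta_sum.
rewrite lfun0 scaler0 subr0 addr0 (bigD1 k) // big1 => [|l lk].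
  by rewrite Monoid.mulm1 partial_pairmon_odd partial_xv eqxx scale1r.
have h : (inr l : 'I_N + 'I_N) != inr k by apply: contra lk => /eqP[->].
by rewrite (partial_pairmon (i := inr l) isT h) lfun0.
Qed.

Lemma Pop_pairmon_xv kap k i : i != inl k -> i != inr k ->
  Pop kap (pairmon k ** xv i) = xv i.
Proof.
move=> ik ik'; rewrite -> (Pop_lmul dlP), Pop_pairmon, (lmul1l charFp t_gt0), Pop_xv, end0 => //.
rewrite addr0 -[RHS]addr0; congr (_ + _).
rewrite -> DopE, THE, paropK, dl_pairmon, (dl_xvar dlP), mul0l, end0.
rewrite !addr0 big1 // => l _.
rewrite !partial_xv; case: (eqVneq l k) => [->|lk].
  have -> : (inl k == i) = false by apply/negbTE; rewrite eq_sym.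
  have -> : (inr k == i) = false by apply/negbTE; rewrite eq_sym.
  by rewrite !scale0r !lfun0 addr0.
rewrite parop_pairmon; rewrite -> endN.
have h1 : (inl l : 'I_N + 'I_N) != inl k by apply: contra lk => /eqP[->].
have h2 : (inr l : 'I_N + 'I_N) != inr k by apply: contra lk => /eqP[->].
by rewrite (partial_pairmon (i := inr l) isT h2) (partial_pairmon (i := inl l) h1 isT) oppr0
  !lmul0l addr0.
Qed.

Lemma one_Rim : one \in Rim.
Proof. by rewrite -(Pop_pairmon (nu + 2%:R) (Ordinal (ltnW N_gt1))) memv_img ?memvf. Qed.

Lemma xv_Rim i : xv i \in Rim.
Proof.
have [k [k1 k2]] : exists k : 'I_N, i != inl k /\ i != inr k.
  pose k0 : 'I_N := Ordinal (ltnW N_gt1); pose k1 : 'I_N := Ordinal N_gt1.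
  have k01 : k0 != k1 by [].
  case: i => l; (case: (eqVneq l k0) => [->|lk]; [exists k1 | exists k0]); split => //;
    by apply/eqP => -[] /eqP; rewrite ?(negPf k01) ?(negPf lk).
by rewrite -(Pop_pairmon_xv (nu + 2%:R) k1 k2) memv_img ?memvf.
Qed.

(** The hypothesis says that each derivative of [c] by one of the first [2N] variables is, up to
    sign, [dl c] times the dual variable. Applying [dl] shows that [dl c] is a constant [kap].
    Computing the mixed derivative of [c] along one pair in both orders gives [kap = - kap], so all
    derivatives of [c] vanish. *)
Lemma Dop_xv_const c : (forall i, Dop (eps c) (xv i) = 0) -> exists k : F, c = k *: one.
Proof.
move=> Dx.
have DxE i : Dop (eps c) (xv i) =
    (match i with inl k => d_ (X (inr k)) c | inr k => d_ (X (inl k)) (eps c) end)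
    + dl c ** xv i.
  rewrite -> DopE, paropK, Euler_xv, (dl_xvar dlP), end0, THE, paropK; rewrite addr0; congr (_ + _).
  case: i => k; rewrite (bigD1 k) // big1 => [|l lk].
  - by rewrite Monoid.mulm1 !partial_xv eqxx scale1r scale0r (lmul1r charFp t_gt0) lfun0 addr0.
  - have h : (inl l == inl k :> 'I_N + 'I_N) = false by apply/negbTE; apply: contra lk => /eqP[->].
    by rewrite !partial_xv h !scale0r !lfun0 addr0.
  - by rewrite Monoid.mulm1 !partial_xv eqxx scale1r scale0r (lmul1r charFp t_gt0) lfun0 add0r.
  - have h : (inr l == inr k :> 'I_N + 'I_N) = false by apply/negbTE; apply: contra lk => /eqP[->].
    by rewrite !partial_xv h !scale0r !lfun0 addr0.
have Do k : d_ (X (inr k)) c = - (dl c ** xv (inl k)).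
  by have := DxE (inl k); rewrite Dx => /esym/eqP; rewrite addr_eq0 => /eqP.
have De k : d_ (X (inl k)) (eps c) = - (dl c ** xv (inr k)).
  by have := DxE (inr k); rewrite Dx => /esym/eqP; rewrite addr_eq0 => /eqP.
have dlx i : dl (dl c ** xv i) = 0.
  by rewrite -> (dl_mul dlP), (dl_dl dlP), (dl_xvar dlP), mul0l, end0; rewrite addr0.
have dd i : d_ (X i) (dl c) = 0.
  case: i => k.
    have := dl_partial dlP (inl k) (eps c).
    rewrite -> De, endN, dlx, (dl_eps dlP), endN, partial_parop.
    rewrite /= expr0 !scale1r oppr0 => /esym/eqP; rewrite oppr_eq0 => /eqP/(congr1 eps).
    by rewrite paropK lfun0.
  have := dl_partial dlP (inr k) c.
  rewrite -> Do, endN, dlx; rewrite /= expr1 scaleN1r oppr0 => /esym/eqP.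
  by rewrite oppr_eq0 => /eqP.
have := partial_eq0 charFp t_gt0 (dl_ker dlP dd (dl_dl dlP c)).
set kap := dl c _ => dc.
pose k0 : 'I_N := Ordinal (ltnW N_gt1).
have De' k : d_ (X (inl k)) c = kap *: xv (inr k).
  have := partial_parop (X (inl k)) c; rewrite /= expr0 scale1r => h.
  have := De k; rewrite /= h dc lmulZl (lmul1l charFp t_gt0) => /(congr1 eps).
  have hy := xvar_Opar charFp t_gt0 (X (inr k)).
  by rewrite paropK lfunN lfunZ (parop_Opar hy) /= expr1 scaleN1r scalerN opprK.
have Do' k : d_ (X (inr k)) c = - (kap *: xv (inl k)).
  by rewrite Do dc lmulZl (lmul1l charFp t_gt0).
have kap0 : kap = 0.
  have := partial_comm charFp (X (inl k0)) (X (inr k0)) c.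
  rewrite [_ && _]/= expr0 scale1r De' Do' lfunN !lfunZ !partial_xv !eqxx scale1r.
  move/(congr1 (fun v : O => v (monone n charFp t_gt0))).
  rewrite !coefE !mon_coef !eqxx !mulr1 => h; apply: (eq_opp0 charFp p_gt2).
  exact: esym h.
exists (c (monone n charFp t_gt0)); apply: (partial_eq0 charFp).
apply: (dl_ker dlP) => [[k|k]|]; rewrite ?De' ?Do' ?dc kap0 ?scale0r ?oppr0 //.
Qed.

(** In [perp_ker], taking [b = 1] gives [Pop nu c = 0]; taking [b] a variable then leaves only the
    contact term in the product rule. *)
Lemma perp_const c : (forall a, a \in prodspan Rim -> (c ** a) top = 0) ->
  exists k : F, c = k *: one.
Proof.
move=> hc; have Pc b := perp_ker hc (b := b).
have Pc1 : Pop nu c = 0 by rewrite -(lmul1r charFp t_gt0 c); apply/Pc/one_Rim.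
have Dx i : Dop (eps c) (xv i) = 0.
  have := Pop_lmul dlP nu c (xv i).
  rewrite -> (Pc _ (xv_Rim i)), Pc1, Pop_xv, end0, mul0l.
  by rewrite !add0r => <-.
exact: Dop_xv_const.
Qed.

End Orthogonality.

(** * The second derived algebra *)

Section DerivedSeries.
Context (F : fieldType) (p N n : nat) (leNn : (N <= n)%N) (t : 'I_N -> nat).
Hypotheses (charFp : p \in [pchar F]) (p_gt2 : (2 < p)%N) (t_gt0 : forall i, (0 < t i)%N).
Local Notation O := (dpO F p n t).
Local Notation M := (supermon p n t).
Local Notation "a ** b" := (lmul F p n t a b) (at level 40, left associativity).
Local Notation Opr := (Opar F p n t).
Local Notation X := (var2N leNn).
Local Notation top := (topmon n charFp t_gt0).
Variables (dl : 'End(O)) (dlP : odd_direction leNn charFp t_gt0 dl).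
#[local] Opaque mon lmul partial parop Euler Delta TH Pop Dop.
Local Notation Pop := (Pop leNn dl).
Local Notation Dop := (Dop leNn dl).
Implicit Types (a b c x y : O) (w : M) (k l : 'I_N) (i : 'I_N + 'I_N).

Local Notation one := (mon F (monone n charFp t_gt0)).

(** Rank and nullity of the map sending [c] to its pairings with a basis of [U], whose kernel is the
    orthogonal of [U]. *)
Lemma dim_perp (U W : {vspace O}) :
  (forall c, (forall a, a \in U -> (c ** a) top = 0) -> c \in W) ->
  (\dim {: O} <= \dim U + \dim W)%N.
Proof.
move=> hW; pose g (w : M) : 'rV[F]_(\dim U) := \row_i (mon F w ** (vbasis U)`_i) top.
pose Psi := linext g.
have PsiE c : Psi c = \row_i (c ** (vbasis U)`_i) top.
  elim/mon_ind: c => [|z a b IHa IHb|w].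
  - by rewrite lfun0; apply/rowP => j; rewrite !mxE lmul0l ffunE.
  - rewrite lfun_linear IHa IHb; apply/rowP => j.
    by rewrite !mxE lmulDl lmulZl !coefE.
  exact: linext_basis.
rewrite -(limg_ker_dim Psi fullv) capfv addnC leq_add //.
  by apply: leq_trans (dimvS (subvf _)) _; rewrite dimvf dim_matrix mul1r.
apply/dimvS/subvP => c; rewrite memv_ker PsiE => /eqP/rowP hc; apply: hW => a aU.
rewrite (coord_vbasis aU) (lfun_sum (lmul F p n t c)) sumO_coef big1 // => i _.
by have := hc i; rewrite !mxE lfunZ scaleO_coef => ->; rewrite mulr0.
Qed.

Section Critical.
Variable nu : F.
Hypothesis nu_adj : forall f, Pop (- (nu + 2%:R)) f = Pop nu f.
Hypothesis N_gt1 : (1 < N)%N.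
Local Notation Rim := (limg (Pop (nu + 2%:R))).
Local Notation U := (prodspan Rim).

Lemma dim_prodspan_Rim : (\dim {: O} <= \dim U + 1)%N.
Proof.
apply: leq_trans (dim_perp (W := <[one]>%VS) _) _.
  move=> c /(perp_const p_gt2 dlP nu_adj N_gt1)[k ->].
  by rewrite rpredZ // memv_line.
by rewrite leq_add2l dim_vline; case: (_ == _).
Qed.

Lemma graded_Rim : graded Rim.
Proof.
move=> d _ /memv_imgP[a _ ->]; rewrite -{1}[d]negbK -(Pop_proj p_gt2 dlP).
by rewrite memv_img ?memvf.
Qed.

Lemma graded_ker kap : graded (lker (Pop kap)).
Proof.
move=> d a; rewrite !memv_ker => /eqP ha.
by rewrite (Pop_proj p_gt2 dlP) ha lfun0.
Qed.

(** The orthogonal already consists of constants, since the kernel contains the image of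
    [Pop (nu + 2)]; the single product [a ** b] excludes the nonzero ones. *)
Lemma prodspan_ker a b : a \in lker (Pop nu) -> b \in lker (Pop nu) -> (a ** b) top != 0 ->
  prodspan (lker (Pop nu)) = fullv.
Proof.
move=> ha hb ab; apply/eqP; rewrite eqEdim subvf /= -[X in (_ <= X)%N]addn0
  -[X in (_ <= _ + X)%N](dimv0 O).
apply: dim_perp => c hc; rewrite memv0.
have sub : (U <= prodspan (lker (Pop nu)))%VS.
  apply: prodspan_sub => x y hx hy; apply: mem_prodspan.
    exact: subvP (Rim_ker p_gt2 dlP nu) _ hx.
  exact: subvP (Rim_ker p_gt2 dlP nu) _ hy.
have [k cE] := perp_const p_gt2 dlP nu_adj N_gt1 (fun x hx => hc x (subvP sub x hx)).
have := hc _ (mem_prodspan ha hb).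
rewrite cE lmulZl (lmul1l charFp t_gt0) scaleO_coef => /eqP;
  rewrite mulf_eq0 (negPf ab) orbF => /eqP ->.
by rewrite scale0r.
Qed.

Lemma derived2_Dop : prodspan (lker (Pop nu)) = fullv ->
  derived (derived (Dop @: lker (Pop nu))) = (Dop @: (Pop (nu + 2%:R) @: U))%VS.
Proof.
move=> hK; rewrite (derived_Dop p_gt2 dlP (@graded_ker nu) (subvv _)) hK.
exact: (derived_Dop p_gt2 dlP (@graded_Rim) (Rim_ker p_gt2 dlP nu)).
Qed.

End Critical.

Definition homogeneous (d : bool) (L : {vspace 'End(O)}) :=
  forall A, A \in L -> ehom d A.

Lemma ehom_disjoint (A : 'End(O)) d : ehom d A -> ehom (~~ d) A -> A = 0.
Proof. by move=> h /ehom_par <-; apply: ehom_par_other. Qed.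

Lemma ehomB (A B : 'End(O)) d : ehom d A -> ehom d B -> ehom d (A - B).
Proof.
move=> hA hB z x hx; rewrite add_lfunE opp_lfunE.
by apply: rpredB; [apply: hA | apply: hB].
Qed.

Lemma mem_homogeneous (L0 L1 : {vspace 'End(O)}) (d : bool) A :
  homogeneous d L0 -> homogeneous (~~ d) L1 -> A \in (L0 + L1)%VS -> ehom d A -> A \in L0.
Proof.
move=> h0 h1 /memv_addP[A0 hA0 [A1 hA1 ->]] hA; suff -> : A1 = 0 by rewrite addr0.
apply: (@ehom_disjoint _ d); last exact: h1.
have -> : A1 = (A0 + A1) - A0 by rewrite addrC addKr.
by apply: ehomB => //; apply: h0.
Qed.

Lemma graded_sum (K : {vspace O}) : graded K ->
  K = (K :&: Opr false + K :&: Opr true)%VS.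
Proof.
move=> gK; apply/eqP; rewrite eqEsubv subv_add !capvSl !andbT; apply/subvP => a ha.
rewrite -(proj_par_sum a); apply: memv_add; by rewrite memv_cap gK ?Opar_proj.
Qed.

End DerivedSeries.

(** * Extremal monomials *)

Section ExtremalMonomials.
Context (F : fieldType) (p N n : nat) (leNn : (N <= n)%N) (t : 'I_N -> nat).
Hypotheses (charFp : p \in [pchar F]) (p_gt2 : (2 < p)%N) (t_gt0 : forall i, (0 < t i)%N).
Local Notation O := (dpO F p n t).
Local Notation M := (supermon p n t).
Local Notation "a ** b" := (lmul F p n t a b) (at level 40, left associativity).
Local Notation Opr := (Opar F p n t).
Local Notation d_ := (partial F p t).
Local Notation X := (var2N leNn).
Local Notation E := (Euler F p leNn t).
Variables (dl : 'End(O)) (dlP : odd_direction leNn charFp t_gt0 dl).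
#[local] Opaque mon lmul partial parop Euler Delta TH Pop Dop.
Local Notation Pop := (Pop leNn dl).
Implicit Types (a b c x y : O) (w : M) (k l : 'I_N) (i : 'I_N).

Local Notation wi := (widen_ord leNn).

(* The factor of [w] in the pair [(x_k, x_{k'})] is [x_k^(p ^ t k - 1)] or
   [x_{k'}], the two monomials that [partial_k partial_{k'}] annihilates and
   does not reach. *)
Definition extremal w k : bool :=
  if wi k \in w.2 then w.1 k == 0 :> nat else w.1 k == (p ^ t k).-1 :> nat.

Definition pivot w : option 'I_N := [pick k | ~~ extremal w k].

(* Along each pair [(x_l, x_{l'})] the monomials [x^(a)] and [x^(a + 1) x_{l'}]
   (with [a + 1] modulo [p ^ t l]) are exchanged. *)
Definition toggle l w : M :=
  if wi l \in w.2
  then ([ffun k => if k == l then ord_pred (w.1 k) else w.1 k], w.2 :\ wi l)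
  else ([ffun k => if k == l then ordS (w.1 k) else w.1 k], wi l |: w.2).

Lemma wi_eq k l : (wi k == wi l) = (k == l).
Proof. by rewrite -val_eqE. Qed.

Lemma toggle_mem l w k : (wi k \in (toggle l w).2) = (wi k \in w.2) (+) (k == l).
Proof.
rewrite /toggle; case: ifPn => hl /=; rewrite !inE wi_eq; case: eqP => [->|] //=; rewrite ?addbF //.
  by rewrite hl.
by rewrite (negPf hl).
Qed.

Lemma toggle_exp l w k : k != l -> (toggle l w).1 k = w.1 k.
Proof. by move=> kl; rewrite /toggle; case: ifP => _ /=; rewrite ffunE (negPf kl). Qed.

Lemma toggle_exp_in l w : wi l \in w.2 -> (toggle l w).1 l = ord_pred (w.1 l).
Proof. by rewrite /toggle => ->; rewrite ffunE eqxx. Qed.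

Lemma toggle_exp_notin l w : wi l \notin w.2 -> (toggle l w).1 l = ordS (w.1 l).
Proof. by rewrite /toggle => /negPf ->; rewrite ffunE eqxx. Qed.

Lemma toggle_set l w : (toggle l w).2 = if wi l \in w.2 then w.2 :\ wi l else wi l |: w.2.
Proof. by rewrite /toggle; case: ifP. Qed.

Lemma toggleK l : involutive (toggle l).
Proof.
move=> w; apply: supermon_eqP => [k|].
  have [->|kl] := eqVneq k l; last by rewrite !toggle_exp.
  case: (boolP (wi l \in w.2)) => hl.
    rewrite toggle_exp_notin ?toggle_mem ?hl ?eqxx // toggle_exp_in //.
    by rewrite ord_predK.
  rewrite toggle_exp_in ?toggle_mem ?(negPf hl) ?eqxx // toggle_exp_notin //.
  by rewrite ordSK.
rewrite [LHS]toggle_set toggle_mem eqxx addbT toggle_set; case: (boolP (wi l \in w.2)) => hl /=.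
  by rewrite setD1K.
by rewrite setU1K.
Qed.

Lemma par_toggle l w : par_mon (toggle l w) = ~~ par_mon w.
Proof.
rewrite /par_mon toggle_set; case: ifPn => hl.
  by rewrite (cardsD1 (wi l) w.2) hl add1n /= negbK.
by rewrite cardsU1 hl.
Qed.

(** The wrap-around matches the two extremal states of a pair: [p ^ t l - 1] without [x_{l'}] is
    exchanged with [0] accompanied by [x_{l'}]. *)
Lemma extremal_toggle l w k : extremal (toggle l w) k = extremal w k.
Proof.
rewrite /extremal toggle_mem; have [->|kl] := eqVneq k l; last by rewrite addbF toggle_exp.
have q_gt0 := pt_gt0 charFp t_gt0 l; have lt := ltn_ord (w.1 l).
rewrite addbT; case: (boolP (wi l \in w.2)) => hl /=.
  rewrite toggle_exp_in //=; case: (posnP (w.1 l)) => [->|a0].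
    by rewrite add0n modn_small ?eqxx // ltn_predL.
  have -> : ((w.1 l + p ^ t l).-1 = (w.1 l).-1 + p ^ t l)%N by rewrite -[in LHS](prednK a0).
  rewrite modnDr modn_small; last by rewrite (leq_ltn_trans (leq_pred _)).
  apply/eqP => E.
  by have := lt; rewrite -(prednK a0) E prednK // ltnn.
rewrite toggle_exp_notin //=; have [E|ne] := eqVneq (w.1 l : nat) (p ^ t l).-1.
  by rewrite E prednK // modnn.
rewrite modn_small // -[X in (_ < X)%N](prednK q_gt0) ltnS ltn_neqAle ne /=.
by rewrite -ltnS prednK.
Qed.

Lemma eq_pivot w w' : (forall k, extremal w k = extremal w' k) -> pivot w = pivot w'.
Proof. by move=> h; apply: eq_pick => k /=; rewrite h. Qed.

Lemma pivot_toggle l w : pivot (toggle l w) = pivot w.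
Proof. by apply: eq_pivot => k; exact: extremal_toggle. Qed.

Lemma pivotP w i : pivot w = Some i -> ~~ extremal w i.
Proof. by rewrite /pivot; case: pickP => // x hx [<-]. Qed.

Lemma pivot_dl w w' : w'.1 = w.1 -> (forall k, (wi k \in w'.2) = (wi k \in w.2)) ->
  pivot w' = pivot w.
Proof. by move=> h1 h2; apply: eq_pivot => k; rewrite /extremal h1 h2. Qed.

(** A term of [Delta] is, up to sign, the toggle at its pair, except at the wrap-around and in the
    absence of [x_{k'}], where it vanishes. *)
Lemma Delta_term k w : d_ (X (inl k)) (d_ (X (inr k)) (mon F w)) =
  if (wi k \in w.2) && (w.1 k != 0 :> nat) then (-1) ^+ nlt (wi k) w.2 *: mon F (toggle k w) else 0.
Proof.
rewrite !partial_mon_basis /=; case: (boolP (wi k \in w.2)) => hk /=; last by rewrite lfun0.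
rewrite lfunZ partial_mon_basis /=; case: eqP => [_|wk] /=; first by rewrite scaler0.
rewrite -/(nlt _ _); congr (_ *: mon F _).
apply: supermon_eqP => [l|]; last by rewrite toggle_set hk.
have [->|lk] := eqVneq l k; last by rewrite toggle_exp //= lower_expE (negPf lk) subn0.
rewrite toggle_exp_in //= lower_expE eqxx subn1.
have a0 : (0 < w.1 k)%N by rewrite lt0n; apply/eqP.
have -> : ((w.1 k + p ^ t k).-1 = (w.1 k).-1 + p ^ t k)%N by rewrite -[in LHS](prednK a0).
by rewrite modnDr modn_small // (leq_ltn_trans (leq_pred _)).
Qed.

Definition nonext w : bool := pivot w != None.
Definition lead w : bool := if pivot w is Some i then wi i \in w.2 else false.

(* On [lead] monomials, [hop] inverts [Pop kap] by undoing the toggle at the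
   pivot, so [Pop kap] is injective there. *)
Definition hop : 'End(O) := linext (fun w =>
  if pivot w is Some i then
    if wi i \in w.2 then 0 else (-1) ^+ nlt (wi i) w.2 *: mon F (toggle i w)
  else 0).

Lemma hop_mon w : hop (mon F w) = if pivot w is Some i then
    if wi i \in w.2 then 0 else (-1) ^+ nlt (wi i) w.2 *: mon F (toggle i w)
  else 0.
Proof. exact: linext_basis. Qed.

Lemma Pop_mon_sum kap w : Pop kap (mon F w) =
  (\sum_k d_ (X (inl k)) (d_ (X (inr k)) (mon F w))) + ((deg2 leNn w)%:R - kap) *: dl (mon F w).
Proof.
rewrite -> PopE, Delta_sum; rewrite -(dl_Euler dlP) (Euler_mon leNn charFp t_gt0) lfunZ.
by rewrite scalerBl.
Qed.

(** The terms of [Delta] away from the pivot, and [dl], keep the odd variable of the pivot pair, so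
    [hop] kills them. The pivot term survives, and its two equal signs cancel. *)
Lemma hop_Pop kap w : lead w -> hop (Pop kap (mon F w)) = mon F w.
Proof.
rewrite /lead; case E: (pivot w) => [i|//] hi.
have [c [w' [dE w1 w2]]] := dl_mon dlP w.
rewrite Pop_mon_sum lfunD !lfunZ dE lfunZ hop_mon (pivot_dl w1 w2) E w2 hi !scaler0 addr0.
rewrite lfun_sum (bigD1 i) // big1 => [|k ki].
  have wi0 : w.1 i != 0 :> nat by have := pivotP E; rewrite /extremal hi.
  rewrite Monoid.mulm1 Delta_term hi wi0 lfunZ hop_mon pivot_toggle E toggle_mem hi eqxx.
  by rewrite toggleK scalerA toggle_set hi nltD1 -expr2 sqrr_sign scale1r.
rewrite Delta_term; case: ifP => _; last by rewrite lfun0.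
by rewrite lfunZ hop_mon pivot_toggle E toggle_mem hi eq_sym (negPf ki) scaler0.
Qed.

Lemma hop_Pop_span kap a : a \in mspan F lead -> hop (Pop kap a) = a.
Proof.
elim/mspan_ind => [|c a1 b1 ha hb|w hw]; first by rewrite !lfun0.
  by rewrite !lfun_linear ha hb.
exact: hop_Pop.
Qed.

Lemma Pop_nonext kap (b : bool) w : nonext w = b ->
  Pop kap (mon F w) \in mspan F (fun w => nonext w == b).
Proof.
move=> hw; rewrite Pop_mon_sum; apply: rpredD.
  apply: rpred_sum => k _; rewrite Delta_term; case: ifP => _; last exact: rpred0.
  by apply: rpredZ; rewrite mem_mspan_mon /nonext pivot_toggle -/(nonext w) hw.
have [c [w' [-> w1 w2]]] := dl_mon dlP w.
by rewrite !rpredZ // mem_mspan_mon /nonext (pivot_dl w1 w2) -/(nonext w) hw.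
Qed.

Lemma Pop_extremal kap w : ~~ nonext w ->
  Pop kap (mon F w) = ((deg2 leNn w)%:R - kap) *: dl (mon F w).
Proof.
move=> hw; rewrite Pop_mon_sum big1 ?add0r // => k _; rewrite Delta_term.
case: ifP => // /andP[hk wk0].
have : extremal w k.
  by move: hw; rewrite /nonext /pivot negbK; case: pickP => // h _; apply/negPn/negbT/h.
by rewrite /extremal hk (negPf wk0).
Qed.

Definition leadp d : pred M := fun w => lead w && (par_mon w == d).
Definition nonextp d : pred M := fun w => nonext w && (par_mon w == d).

Lemma card_nonextp d : #|nonextp d| = (#|leadp d| + #|leadp (~~ d)|)%N.
Proof.
(* The nonextremal monomials lacking the odd variable of their pivot pair; toggling at the pivot
   matches them with the [lead] monomials of the other parity. *)
pose low d : pred M := fun w => [&& nonext w, ~~ lead w & par_mon w == d].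
have -> : #|leadp (~~ d)| = #|low d|.
  apply: (card_involutive (f := fun w => if pivot w is Some i then toggle i w else w)).
    move=> w; case E: (pivot w) => [i|]; last by rewrite E.
    by rewrite pivot_toggle E toggleK.
  move=> w; rewrite /low /leadp /nonext /lead; case E: (pivot w) => [i|]; last by rewrite E.
  by rewrite pivot_toggle E toggle_mem eqxx addbT negbK par_toggle /=; case: (par_mon w); case: (d).
rewrite -[LHS](cardID lead); congr (_ + _)%N; apply: eq_card => w.
  rewrite !inE !unfold_in /nonextp /leadp /nonext /lead.
  by case: (pivot w) => //= i; rewrite andbC.
rewrite !inE !unfold_in /nonextp /low /nonext /lead.
by case: (pivot w) => [i|]; rewrite ?andbF ?andbT //=; case: (wi i \in w.2).
Qed.

Hypothesis N_gt1 : (1 < N)%N.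

(** Toggling at a pair other than the pivot changes the parity and preserves [lead]; a second pair
    exists because [N > 1]. *)
Lemma card_leadp d : #|leadp d| = #|leadp (~~ d)|.
Proof.
pose k0 : 'I_N := Ordinal (ltnW N_gt1); pose k1 : 'I_N := Ordinal N_gt1.
pose other (i : 'I_N) := if i == k0 then k1 else k0.
have otherP i : i != other i.
  by rewrite /other; case: (eqVneq i k0) => [->|].
apply: (card_involutive (f := fun w => if pivot w is Some i then toggle (other i) w else w)).
  move=> w; case E: (pivot w) => [i|]; last by rewrite E.
  by rewrite pivot_toggle E toggleK.
move=> w; rewrite /leadp /lead; case E: (pivot w) => [i|]; last by rewrite E.
rewrite pivot_toggle E toggle_mem (negPf (otherP i)) addbF par_toggle.
by case: (par_mon w); case: (d).
Qed.

Lemma Pop_mspan kap d (b : bool) :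
  (Pop kap @: mspan F (fun w => (nonext w == b) && (par_mon w == d))
     <= mspan F (fun w => (nonext w == b) && (par_mon w == ~~ d)))%VS.
Proof.
apply/subvP => _ /memv_imgP[a0 + ->]; elim/mspan_ind => [|c a1 a2 ha ha'|w /andP[/eqP hw /eqP hd]].
- by rewrite lfun0 rpred0.
- by rewrite lfun_linear rpredD // rpredZ.
rewrite -mspanI memv_cap Pop_nonext //.
by apply: (Pop_Opar p_gt2 dlP); rewrite mem_mspan_mon hd.
Qed.

Lemma dim_Pop_lead kap d : \dim (Pop kap @: mspan F (leadp d)) = #|leadp d|.
Proof.
rewrite -(dim_mspan F); apply: limg_dim_eq; apply/eqP; rewrite -subv0; apply/subvP => a.
rewrite memv_cap memv_ker memv0 => /andP[ha /eqP Pa].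
rewrite -(@hop_Pop_span kap a) ?Pa ?lfun0 //.
by apply: subvP ha; apply: mspan_sub => w; rewrite -!topredE /= => /andP[].
Qed.

Lemma lead_nonext w : lead w -> nonext w.
Proof. by rewrite /lead /nonext; case: (pivot w). Qed.

(* Both [dim (Pop (kap - 2) @: NE (~~ d))] and [dim (Pop kap @: NE d)] are
   bounded below by the [lead] counts; since [Pop (kap - 2) \o Pop kap = 0] and
   the two counts exhaust [dim (NE (~~ d))], the bounds are equalities. *)
Lemma dim_Pop_nonext kap d :
  \dim (Pop kap @: mspan F (fun w => (nonext w == true) && (par_mon w == d))) = #|leadp d|.
Proof.
set NE := fun d : bool => mspan F (fun w => (nonext w == true) && (par_mon w == d)).
have lower kap' d' : (#|leadp d'| <= \dim (Pop kap' @: NE d'))%N.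
  rewrite -(dim_Pop_lead kap'); apply/dimvS/limgS/mspan_sub => w.
  by rewrite -!topredE /= => /andP[/lead_nonext -> ->].
apply/eqP; rewrite eqn_leq lower andbT.
have sub : (Pop kap @: NE d <= NE (~~ d) :&: lker (Pop (kap - 2%:R)))%VS.
  rewrite subv_cap Pop_mspan; apply/subvP => _ /memv_imgP[a _ ->]; rewrite memv_ker.
  by have := Pop_Pop p_gt2 dlP (kap - 2%:R) a; rewrite subrK => ->.
apply: leq_trans (dimvS sub) _.
rewrite -(leq_add2r (\dim (Pop (kap - 2%:R) @: NE (~~ d)))) limg_ker_dim.
apply: (@leq_trans (#|leadp d| + #|leadp (~~ d)|)); last by rewrite leq_add2l lower.
rewrite dim_mspan (@eq_card _ _ (nonextp (~~ d))); last first.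
  by move=> w; rewrite -!topredE /= /nonextp eqb_id.
by rewrite card_nonextp negbK addnC.
Qed.

Lemma dim_Pop_Opar kap d : \dim (Pop kap @: Opr d) = (#|leadp d| +
  \dim (Pop kap @: mspan F (fun w => (nonext w == false) && (par_mon w == d))))%N.
Proof.
rewrite -(dim_Pop_nonext kap) -dimv_disjoint_sum.
  rewrite -limgD mspanU; congr (\dim (_ @: _)); apply: eq_mspan => w /=.
  by case: (nonext w); case: (par_mon w == d).
apply/eqP; rewrite -subv0; apply: subv_trans (capvS (Pop_mspan _ _ _) (Pop_mspan _ _ _)) _.
rewrite mspanI; apply/subvP => a /mspanP ha; rewrite memv0; apply/eqP/ffunP => w.
by rewrite zeroO_coef; apply: ha => /=; case: (nonext w); rewrite ?andbF.
Qed.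

End ExtremalMonomials.

(** * Superdimensions *)

(** Any splitting into an even and an odd subspace serves, so each family can supply a convenient
    one. *)
Definition superdim (F : fieldType) p m n (t : 'I_m -> nat)
    (L : {vspace 'End(dpO F p n t)}) (d0 d1 : nat) : Prop :=
  exists L0 L1, [/\ L = (L0 + L1)%VS, homogeneous false L0, homogeneous true L1,
    \dim L0 = d0 & \dim L1 = d1].

Lemma dim_ffun (F : fieldType) (I : finType) (V : vectType F) :
  dim {ffun I -> V} = (#|I| * dim V)%N.
Proof. by []. Qed.

Section Isomorphism.
Context (F : fieldType) (p m1 n1 m2 n2 : nat) (t1 : 'I_m1 -> nat) (t2 : 'I_m2 -> nat).
Implicit Types (L : {vspace 'End(dpO F p n1 t1)}) (K : {vspace 'End(dpO F p n2 t2)}).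

Lemma homogeneous_cap (n m : nat) (t : 'I_m -> nat) (L0 L1 : {vspace 'End(dpO F p n t)}) :
  homogeneous false L0 -> homogeneous true L1 -> (L0 :&: L1 = 0)%VS.
Proof.
move=> h0 h1; apply/eqP; rewrite -subv0; apply/subvP => A; rewrite memv_cap memv0 => /andP[a0 a1].
by apply/eqP; apply: (ehom_disjoint (h0 _ a0)); exact: h1.
Qed.

(** An even isomorphism embeds each part of [L] in the part of [K] of the same parity, and the total
    dimensions agree, so both embeddings are onto. *)
Lemma iso_superdim L K d0 d1 e0 e1 : lsa_isomorphic L K ->
  superdim L d0 d1 -> superdim K e0 e1 -> d0 = e0 /\ d1 = e1.
Proof.
move=> [phi [inj imL par _]] [L0 [L1 [LE hL0 hL1 <- <-]]] [K0 [K1 [KE hK0 hK1 <- <-]]].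
have dimphi X : (X <= L)%VS -> \dim (phi @: X) = \dim X.
  move=> /subvP XL; apply: limg_dim_eq; apply/eqP; rewrite -subv0; apply/subvP => A.
  rewrite memv_cap memv_ker memv0 => /andP[AX /eqP A0]; apply/eqP.
  by apply: inj; rewrite ?mem0v ?XL // A0 linear0.
have L0L : (L0 <= L)%VS by rewrite LE addvSl.
have L1L : (L1 <= L)%VS by rewrite LE addvSr.
have hphi d A : A \in L -> ehom d A -> ehom d (phi A).
  by move=> AL /end_homogP hA; apply/end_homogP/par.
have s0 : (phi @: L0 <= K0)%VS.
  apply/subvP => _ /memv_imgP[A hA ->].
  apply: (mem_homogeneous hK0 hK1); last by apply: hphi; [apply: (subvP L0L) | apply: hL0].
  by rewrite -KE -imL memv_img // (subvP L0L).
have s1 : (phi @: L1 <= K1)%VS.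
  apply/subvP => _ /memv_imgP[A hA ->].
  apply: (mem_homogeneous hK1 hK0); last by apply: hphi; [apply: (subvP L1L) | apply: hL1].
  by rewrite addvC -KE -imL memv_img // (subvP L1L).
have le0 := dimvS s0; have le1 := dimvS s1; rewrite !dimphi // in le0 le1.
have dL : \dim L = (\dim L0 + \dim L1)%N by rewrite LE dimv_disjoint_sum // homogeneous_cap.
have dK : \dim K = (\dim K0 + \dim K1)%N by rewrite KE dimv_disjoint_sum // homogeneous_cap.
have : \dim L = \dim K by rewrite -imL dimphi.
rewrite dL dK; move: (\dim L0) (\dim L1) (\dim K0) (\dim K1) le0 le1; clear => *; lia.
Qed.

End Isomorphism.

(** * Superdimension of W *)

Section CartanW.
Context (F : fieldType) (p m n : nat) (t : 'I_m -> nat).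
Hypotheses (charFp : p \in [pchar F]) (p_gt2 : (2 < p)%N) (t_gt0 : forall i, (0 < t i)%N).
Hypothesis n_gt0 : (0 < n)%N.
Local Notation O := (dpO F p n t).
Local Notation M := (supermon p n t).
Local Notation "a ** b" := (lmul F p n t a b) (at level 40, left associativity).
Local Notation Opr := (Opar F p n t).
Local Notation d_ := (partial F p t).

Lemma card_par (d : bool) : #|[pred w : M | par_mon w == d]| = #|[pred w : M | par_mon w == ~~ d]|.
Proof.
pose j : 'I_n := Ordinal n_gt0.
pose f (w : M) : M := (w.1, if j \in w.2 then w.2 :\ j else j |: w.2).
apply: (card_involutive (f := f)) => w.
  rewrite /f /=; case: w => e u /=; congr (_, _); case: (boolP (j \in u)) => ju.
    by rewrite !inE eqxx /= setD1K.
  by rewrite !inE eqxx /= setU1K.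
have E : par_mon (f w) = ~~ par_mon w.
  rewrite /f /par_mon /=; case: ifPn => ju.
    by rewrite (cardsD1 j w.2) ju add1n /= negbK.
  by rewrite cardsU1 ju.
by rewrite -[LHS]/(par_mon (f w) == ~~ d) E /=; case: (par_mon w); case: d.
Qed.

Lemma dim_Opar (d : bool) : \dim (Opr d) = #|[pred w : M | par_mon w == false]|.
Proof. by rewrite /Opar (dim_mspan F [pred w : M | par_mon w == d]); case: d;
  rewrite // card_par. Qed.

Lemma dim_O : \dim {: O} = (\dim (Opr false)).*2.
Proof.
have -> : {: O}%VS = (Opr false + Opr true)%VS.
  rewrite /Opar mspanU mspan_all // => w /=; by case: (par_mon w).
rewrite dimv_disjoint_sum ?dim_Opar ?addnn //.
rewrite /Opar mspanI; apply/eqP; rewrite -subv0; apply/subvP => a /mspanP h; rewrite memv0.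
by apply/eqP/ffunP => w; rewrite ffunE; apply: h => /=; case: (par_mon w).
Qed.

Lemma fder_ehom (d e : bool) r f : f \in Opr d -> e = d (+) mu r -> ehom e (fder f (d_ r)).
Proof.
move=> hf -> z x hx; rewrite comp_lfunE.
have := lmul_Opar hf (partial_Opar charFp p_gt2 r hx).
by rewrite addbA addbAC.
Qed.

Lemma Wder_xvar (f : {ffun svar m n -> O}) r : Wder f (xvar F p t r) = f r.
Proof.
rewrite /Wder sum_lfunE (bigD1 r) // big1 => [|s sr].
  by rewrite Monoid.mulm1 comp_lfunE (partial_xvar charFp t_gt0) eqxx scale1r (lmul1r charFp t_gt0).
by rewrite comp_lfunE (partial_xvar charFp t_gt0) (negPf sr) scale0r lfun0.
Qed.

Definition fderl r : 'Hom(O, 'End(O)) := linext (fun w => fder (mon F w) (d_ r)).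

Lemma fderlE r f : fderl r f = fder f (d_ r).
Proof.
elim/mon_ind: f => [|c a b ha hb|w].
- by rewrite lfun0 /fder lfun0 comp_lfun0l.
- by rewrite lfun_linear ha hb /fder lfun_linear comp_lfunDl comp_lfunZl.
exact: linext_basis.
Qed.

Definition Wpart (d : bool) : {vspace 'End(O)} :=
  (\sum_(r : svar m n) fderl r @: Opr (d (+) mu r))%VS.

Lemma homogeneous_sum (I : finType) (L : I -> {vspace 'End(O)}) d :
  (forall i, homogeneous d (L i)) -> homogeneous d (\sum_i L i)%VS.
Proof.
move=> h A /memv_sumP[f hf ->] z x hx; rewrite sum_lfunE; apply: rpred_sum => i _.
by apply: h hx; apply: hf.
Qed.

Lemma homogeneous_Wpart d : homogeneous d (Wpart d).
Proof.
apply: homogeneous_sum => r A /memv_imgP[f hf ->]; rewrite fderlE.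
by apply: fder_ehom hf _; rewrite -addbA addbb addbF.
Qed.

Lemma Wspace_parts : Wspace F p n t = (Wpart false + Wpart true)%VS.
Proof.
apply/eqP; rewrite eqEsubv subv_add; apply/and3P; split.
- apply/subvP => _ /memW[f ->]; apply: rpred_sum => r _.
  rewrite -fderlE -(proj_par_sum (f r)) lfunD.
  have memr (d : bool) a : a \in Opr (d (+) mu r) -> fderl r a \in (Wpart false + Wpart true)%VS.
    move=> ha; have : fderl r a \in Wpart d.
      by apply: subvP (sumv_sup r _ (subvv _)) _ _ => //; rewrite memv_img.
    by case: d ha => _ h; [apply: subvP (addvSr _ _) _ h | apply: subvP (addvSl _ _) _ h].
  apply: rpredD.
    by apply: (memr (mu r)); rewrite addbb Opar_proj.
  by apply: (memr (~~ mu r)); rewrite addNb addbb Opar_proj.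
- apply/subv_sumP => r _; apply/subvP => _ /memv_imgP[f _ ->]; apply/memW.
  exists [ffun s => if s == r then f else 0]; rewrite /Wder (bigD1 r) // big1 => [|s sr].
    by rewrite Monoid.mulm1 ffunE eqxx fderlE.
  by rewrite ffunE (negPf sr) /fder lfun0 comp_lfun0l.
apply/subv_sumP => r _; apply/subvP => _ /memv_imgP[f _ ->]; apply/memW.
exists [ffun s => if s == r then f else 0]; rewrite /Wder (bigD1 r) // big1 => [|s sr].
  by rewrite Monoid.mulm1 ffunE eqxx fderlE.
by rewrite ffunE (negPf sr) /fder lfun0 comp_lfun0l.
Qed.

Lemma dim_Wspace : \dim (Wspace F p n t) = (#|{: svar m n}| * \dim {: O})%N.
Proof.
rewrite /Wspace limg_dim_eq; first by rewrite !dimvf dim_ffun.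
apply/eqP; rewrite -subv0; apply/subvP => f; rewrite memv_cap memv_ker memv0 => /andP[_].
rewrite lfunE /= => /eqP h; apply/eqP/ffunP => r.
by rewrite -(Wder_xvar f) h zero_lfunE ffunE.
Qed.

Lemma dim_Wpart d : (\dim (Wpart d) <= #|{: svar m n}| * \dim (Opr false))%N.
Proof.
apply: leq_trans (dimv_leq_sum _ _ _) _; rewrite -sum_nat_const; apply: leq_sum => r _.
have E : \dim (Opr (d (+) mu r)) = \dim (Opr false) by rewrite !dim_Opar.
by rewrite -E -(limg_ker_dim (fderl r) (Opr (d (+) mu r))) leq_addl.
Qed.

(** Both parts have the same upper bound on their dimension, and the two bounds add up to the
    dimension of the whole, so they are attained. *)
Lemma superdim_Wspace : exists k, superdim (Wspace F p n t) k k.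
Proof.
exists (#|{: svar m n}| * \dim (Opr false))%N, (Wpart false), (Wpart true).
have := dim_Wpart false; have := dim_Wpart true; have := dim_Wspace.
rewrite {1}Wspace_parts dimv_disjoint_sum; last first.
  by apply: homogeneous_cap; exact: homogeneous_Wpart.
rewrite dim_O -muln2 mulnA => E le1 le0.
split; [exact: Wspace_parts | exact: homogeneous_Wpart | exact: homogeneous_Wpart | | ];
  move: (\dim (Wpart false)) (\dim (Wpart true)) (#|{: svar m n}| * \dim (Opr false))%N E le1
    le0; clear => *; lia.
Qed.

End CartanW.

Lemma leq_dim_img (F : fieldType) (V W : vectType F) (f : 'Hom(V, W)) (U : {vspace V}) :
  (\dim (f @: U) <= \dim U)%N.
Proof. by rewrite -(limg_ker_dim f U) leq_addl. Qed.

Lemma geq_dim_img (F : fieldType) (V W : vectType F) (f : 'Hom(V, W)) (U : {vspace V}) v :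
  (lker f <= <[v]>)%VS -> (\dim U <= \dim (f @: U) + 1)%N.
Proof.
move=> h; rewrite -(limg_ker_dim f U) addnC leq_add2l.
apply: leq_trans (dimvS (subv_trans (capvSr _ _) h)) _.
by rewrite dim_vline; case: (_ == _).
Qed.

(** * Superdimension of H *)

Section CartanH.
Context (F : fieldType) (p m n : nat) (t : 'I_m -> nat).
Hypotheses (charFp : p \in [pchar F]) (p_gt2 : (2 < p)%N) (t_gt0 : forall i, (0 < t i)%N).
Hypotheses (n_gt0 : (0 < n)%N) (m_even : ~~ odd m).
Local Notation O := (dpO F p n t).
Local Notation M := (supermon p n t).
Local Notation "a ** b" := (lmul F p n t a b) (at level 40, left associativity).
Local Notation eps := (parop F p n t).
Local Notation Opr := (Opar F p n t).
Local Notation d_ := (partial F p t).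
Local Notation one := (mon F (monone n charFp t_gt0)).
Local Notation DH := (DH F p n t).
Local Notation top := (topmon n charFp t_gt0).

Lemma twist_mon (b : bool) (w : M) : twist F p n t b (mon F w) = (-1) ^+ (b && par_mon w) *:
  mon F w.
Proof. by case: b; rewrite /= ?parop_mon // id_lfunE scale1r. Qed.

Lemma DH_mon (w : M) : DH (mon F w) = \sum_(i : svar m n)
    (sigmaH F (dualH i) * (-1) ^+ (mu (dualH i) && par_mon w))
      *: fder (d_ (dualH i) (mon F w)) (d_ i).
Proof. exact: linext_basis. Qed.

Lemma DH_xvar a (s : svar m n) : DH a (xvar F p t s) =
  sigmaH F (dualH s) *: d_ (dualH s) (twist F p n t (mu (dualH s)) a).
Proof.
elim/mon_ind: a => [|c a b ha hb|w].
- by rewrite !lfun0 zero_lfunE scaler0.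
- by rewrite lfunD lfunZ add_lfunE scale_lfunE ha hb !lfun_linear scalerDr !scalerA mulrC.
rewrite DH_mon sum_lfunE (bigD1 s) // big1 => [|r rs].
  rewrite Monoid.mulm1 scale_lfunE comp_lfunE (partial_xvar charFp t_gt0) eqxx scale1r.
  by rewrite (lmul1r charFp t_gt0) twist_mon lfunZ scalerA.
by rewrite scale_lfunE comp_lfunE (partial_xvar charFp t_gt0) (negPf rs) scale0r lfun0 scaler0.
Qed.

Lemma sigmaH_neq0 (r : svar m n) : sigmaH F r != 0 :> F.
Proof. by case: r => [i|j] /=; [case: ifP|]; rewrite ?oner_neq0 // oppr_eq0 oner_neq0. Qed.

(** For even [m] the default of [insubd] in [dualH] is never reached and [dualH] is an involution;
    the preimage given is the dual index. *)
Lemma dualH_surj (r : svar m n) : exists s, dualH s = r.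
Proof.
case: r => [k|j]; last by exists (inr j).
have hm : (m./2 + m./2 = m)%N by rewrite addnn; have := odd_double_half m; rewrite (negPf m_even).
have lk := ltn_ord k.
case: (ltnP k m./2) => hk.
  have ls : (k + m./2 < m)%N by rewrite -[X in (_ < X)%N]hm ltn_add2r.
  exists (inl (Ordinal ls)); rewrite /=; congr inl; apply: val_inj; rewrite val_insubd /=.
  have -> : (k + m./2 < m./2)%N = false by rewrite ltnNge leq_addl.
  by rewrite addnK lk.
have ls : (k - m./2 < m)%N by rewrite (leq_ltn_trans (leq_subr _ _)).
exists (inl (Ordinal ls)); rewrite /=; congr inl; apply: val_inj; rewrite val_insubd /=.
have -> : (k - m./2 < m./2)%N by rewrite ltn_subLR // hm.
by rewrite subnK // lk.
Qed.

Lemma lker_DH : (lker DH <= <[one]>)%VS.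
Proof.
apply/subvP => a; rewrite memv_ker => /eqP Da.
suff h : forall r, d_ r a = 0 by rewrite (partial_eq0 charFp t_gt0 h) rpredZ // memv_line.
move=> r; have [s <-] := dualH_surj r.
have := DH_xvar a s; rewrite Da zero_lfunE => /esym/eqP.
rewrite scaler_eq0 (negPf (sigmaH_neq0 _)) /= /twist; case: (mu _) => /eqP;
  last by rewrite id_lfunE.
rewrite partial_parop => /eqP; rewrite scaler_eq0 signr_eq0 /= => /eqP/(congr1 eps).
by rewrite paropK lfun0.
Qed.

Lemma DH_ehom d a : a \in Opr d -> ehom d (DH a).
Proof.
elim/mspan_ind => [|c a1 a2 h1 h2|w /eqP hw].
- by move=> z x hx; rewrite lfun0 zero_lfunE rpred0.
- move=> z x hx; rewrite lfunD lfunZ add_lfunE scale_lfunE.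
  by rewrite rpredD ?rpredZ ?h1 ?h2.
rewrite DH_mon => z x hx; rewrite sum_lfunE; apply: rpred_sum => i _.
rewrite scale_lfunE; apply: rpredZ.
have hmu : mu (dualH i) = mu i by case: i.
have := mon_Opar F w; rewrite hw => /(partial_Opar charFp p_gt2 (dualH i)) h.
by apply: (fder_ehom charFp p_gt2 h _ hx); rewrite hmu -addbA addbb addbF.
Qed.

Definition Hdom d : pred M := fun w => (deg_mon w != top_deg p n t) && (par_mon w == d).
Definition Hpart d : {vspace 'End(O)} := (DH @: mspan F (Hdom d))%VS.

Lemma Hspace_parts : Hspace F p n t = (Hpart false + Hpart true)%VS.
Proof.
rewrite /Hpart -limgD mspanU /Hspace -mspan_span; congr (_ @: _)%VS; apply: eq_mspan => w.
by rewrite /= /Hdom; case: (par_mon w); rewrite ?andbT ?andbF ?orbF.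
Qed.

Lemma homogeneous_Hpart d : homogeneous d (Hpart d).
Proof.
move=> A /memv_imgP[a ha ->]; apply: DH_ehom; apply: subvP ha.
by apply: mspan_sub => w; rewrite -!topredE /= => /andP[].
Qed.

Lemma deg_compl (w : M) : (deg_mon (compl_mon charFp t_gt0 w) + deg_mon w)%N = top_deg p n t.
Proof.
rewrite /deg_mon /top_deg addnACA -big_split /=; congr addn.
  apply: eq_bigr => i _; rewrite compl_monE subnK // -ltnS prednK //.
  exact: pt_gt0 charFp t_gt0 i.
by rewrite addnC cardsC card_ord.
Qed.

(** The complement of such a monomial has degree 0 and hence is [1]. So the definition of H leaves
    out a single monomial. *)
Lemma deg_top_eq (w : M) : deg_mon w = top_deg p n t -> w = top.
Proof.
move=> hw; have : deg_mon (compl_mon charFp t_gt0 w) == 0%N.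
  by rewrite -(eqn_add2r (deg_mon w)) deg_compl hw.
rewrite (deg_mon0 charFp t_gt0) => /eqP E; apply: supermon_eqP => [i|].
  have := congr1 (fun v : M => v.1 i : nat) E.
  rewrite compl_monE moneE topmonE => /eqP; rewrite subn_eq0 => h.
  by apply/eqP; rewrite eqn_leq h andbT -ltnS prednK // (pt_gt0 charFp t_gt0).
by have := congr1 snd E => /= /(congr1 (@setC _)); rewrite setCK setC0.
Qed.

Lemma card_Hdom d : (#|Hdom d| <= #|[pred w : M | par_mon w == false]| <= #|Hdom d| + 1)%N.
Proof.
have <- : #|[pred w : M | par_mon w == d]| = #|[pred w : M | par_mon w == false]|.
  by case: d; rewrite // (card_par p t n_gt0).
apply/andP; split; first by apply/subset_leq_card/subsetP => w /andP[].
rewrite -[1%N](card1 top) -cardUI; apply: leq_trans (leq_addr _ _).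
apply/subset_leq_card/subsetP => w; rewrite !inE /Hdom unfold_in => ->; rewrite andbT.
by case: (eqVneq (deg_mon w) (top_deg p n t)) => //= /deg_top_eq ->; rewrite eqxx.
Qed.

(** From the common dimension of the two parts of the function algebra, each part loses at most one
    to the top monomial and at most one to the constants killed by [DH]. *)
Lemma superdim_Hspace :
  exists d0 d1, [/\ superdim (Hspace F p n t) d0 d1, (d0 <= d1 + 2)%N & (d1 <= d0 + 2)%N].
Proof.
exists (\dim (Hpart false)), (\dim (Hpart true)).
have bd d : (\dim (Hpart d) <= #|Hdom d| <= \dim (Hpart d) + 1)%N.
  by rewrite -(dim_mspan F) leq_dim_img (geq_dim_img _ lker_DH).
split.
- by exists (Hpart false), (Hpart true); split;
  [exact: Hspace_parts | exact: homogeneous_Hpart..| |].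
- have := card_Hdom false; have := card_Hdom true; have := bd false; have := bd true.
  by move: (\dim _) (\dim _) #|Hdom false| #|Hdom true| #|_| => *; lia.
have := card_Hdom false; have := card_Hdom true; have := bd false; have := bd true.
by move: (\dim _) (\dim _) #|Hdom false| #|Hdom true| #|_| => *; lia.
Qed.

End CartanH.

Section ContactDimension.
Context (F : fieldType) (p N n : nat) (leNn : (N <= n)%N) (t : 'I_N -> nat).
Hypotheses (charFp : p \in [pchar F]) (p_gt2 : (2 < p)%N) (t_gt0 : forall i, (0 < t i)%N).
Local Notation O := (dpO F p n t).
Local Notation M := (supermon p n t).
Local Notation "a ** b" := (lmul F p n t a b) (at level 40, left associativity).
Local Notation eps := (parop F p n t).
Local Notation Opr := (Opar F p n t).
Local Notation E := (Euler F p leNn t).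
Variables (dl : 'End(O)) (dlP : odd_direction leNn charFp t_gt0 dl).
#[local] Opaque mon lmul partial parop Euler Delta TH Pop Dop.
Local Notation Pop := (Pop leNn dl).
Local Notation Dop := (Dop leNn dl).
Implicit Types (a b c x y : O) (w : M) (k l : 'I_N) (i : 'I_N + 'I_N).

Local Notation one := (mon F (monone n charFp t_gt0)).
Hypothesis N_gt1 : (1 < N)%N.

Lemma lker_Dop : (lker Dop <= <[one]>)%VS.
Proof.
apply/subvP => a; rewrite memv_ker => /eqP Da.
have [i|k E] := Dop_xv_const p_gt2 dlP N_gt1 (c := eps a).
  by rewrite paropK Da zero_lfunE.
by rewrite -(paropK a) E lfunZ parop_one rpredZ // memv_line.
Qed.

Lemma homogeneous_Dop (d : bool) (K : {vspace O}) : (K <= Opr (~~ d))%VS ->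
  homogeneous d (Dop @: K)%VS.
Proof.
move=> /subvP hK _ /memv_imgP[a /hK ha ->]; rewrite -[d]negbK.
exact: (Dop_ehom p_gt2 dlP ha).
Qed.

Section Critical.
Variable nu : F.
Hypothesis nu_adj : forall f, Pop (- (nu + 2%:R)) f = Pop nu f.
Local Notation R := (Pop (nu + 2%:R)).
Local Notation U := (prodspan (limg R)).

Definition DRpart (d : bool) : {vspace 'End(O)} := (Dop @: (R @: (U :&: Opr d)))%VS.

Lemma superdim_DR : superdim (Dop @: (R @: U))%VS (\dim (DRpart false)) (\dim (DRpart true)).
Proof.
have gU : graded U by apply/graded_prodspan/(graded_Rim p_gt2 dlP).
exists (DRpart false), (DRpart true); split=> //.
- by rewrite {1}(graded_sum gU) !limgD.
- apply: homogeneous_Dop; apply/subvP => _ /memv_imgP[a + ->].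
  rewrite memv_cap => /andP[_ ha]; exact: (Pop_Opar p_gt2 dlP _ ha).
- apply: homogeneous_Dop; apply/subvP => _ /memv_imgP[a + ->].
  rewrite memv_cap => /andP[_ ha]; exact: (Pop_Opar p_gt2 dlP _ ha).
Qed.

(** The span [U] of the products has codimension at most 1, and so has its trace on each parity. *)
Lemma dim_R_cap d : (\dim (R @: (U :&: Opr d)) <= \dim (R @: Opr d)
    <= \dim (R @: (U :&: Opr d)) + 1)%N.
Proof.
rewrite dimvS ?limgS ?capvSr //=; apply: dim_img_codim; first exact: capvSr.
have := dimv_sum_cap U (Opr d); have := dim_prodspan_Rim p_gt2 dlP nu_adj N_gt1.
have := dimvS (subvf (U + Opr d)%VS).
by move: (\dim (U + Opr d)) (\dim (U :&: Opr d)) (\dim {: O}) (\dim U) (\dim (Opr d)) => *; lia.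
Qed.

End Critical.
End ContactDimension.

(** * Superdimension of SHO *)

Section CartanSHO.
Context (F : fieldType) (p N : nat) (t : 'I_N -> nat).
Hypotheses (charFp : p \in [pchar F]) (p_gt2 : (2 < p)%N) (t_gt0 : forall i, (0 < t i)%N).
Hypothesis N_gt1 : (1 < N)%N.
Local Notation O := (dpO F p N t).
Local Notation M := (supermon p N t).
Local Notation leNN := (leqnn N).
Local Notation zero := (0%R : 'End(O)).
Local Notation R0 := (Pop leNN zero (0%R + 2%:R)%R).
Local Notation leads := (leadp leNN (t := t) (p := p)).

Lemma odd_direction0 : odd_direction leNN charFp t_gt0 zero.
Proof.
split.
- by move=> a b; rewrite !zero_lfunE lmul0l lfun0 addr0.
- by move=> a; rewrite !zero_lfunE lfun0 oppr0.
- by move=> a; rewrite !zero_lfunE.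
- by move=> i a; rewrite !zero_lfunE lfun0 scaler0.
- by move=> i; rewrite zero_lfunE.
- by move=> a; rewrite zero_lfunE ffunE.
- move=> a h _ [k|j]; first exact: (h (inl k)).
  by have := h (inr j); rewrite /var2N (_ : widen_ord leNN j = j) //; apply: val_inj.
by move=> w; exists 0, w; rewrite zero_lfunE scale0r.
Qed.

Lemma Dop0 : Dop leNN zero = TH F p leNN t.
Proof.
apply: hom_basis_eq => w; rewrite /Dop linext_basis zero_lfunE /fder lfun0 comp_lfun0l.
by rewrite scaler0 comp_lfun0r !addr0.
Qed.

Lemma Pop0 kap : Pop leNN zero kap = Delta F p leNN t.
Proof. by rewrite /Pop comp_lfun0r addr0. Qed.

Lemma superdim_SHOspace : exists d0 d1,
  [/\ superdim (SHOspace F p t) d0 d1, (d0 <= d1 + 2)%N & (d1 <= d0 + 2)%N].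
Proof.
have dlP := odd_direction0.
have nu_adj f : Pop leNN 0 (- (0%R + 2%:R)%R) f = Pop leNN zero 0 f by rewrite !Pop0.
(* The product of all [x_i^(pi_i)]; its complement is the product of all odd variables. [Delta]
   kills both, and they multiply to the top monomial up to sign. *)
pose w0 : M := ((topmon N charFp t_gt0).1, set0).
have kerw (w : M) : (forall k, (widen_ord leNN k \in w.2) && (w.1 k != 0 :> nat) = false) ->
    mon F w \in lker (Pop leNN zero 0%R).
  move=> h; rewrite memv_ker (Pop_mon_sum dlP) zero_lfunE scaler0 addr0.
  by rewrite big1 // => k _; rewrite Delta_term h.
have hK : prodspan (lker (Pop leNN zero 0%R)) = fullv.
  have h1 : mon F w0 \in lker (Pop leNN zero 0%R) by apply: kerw => k; rewrite inE.
  have h2 : mon F (compl_mon charFp t_gt0 w0) \in lker (Pop leNN zero 0%R).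
    by apply: kerw => k; rewrite compl_monE topmonE subnn andbF.
  exact: (prodspan_ker p_gt2 dlP nu_adj N_gt1 h1 h2 (mon_compl_neq0 charFp t_gt0 w0)).
have E : SHOspace F p t = (Dop leNN zero @: (R0 @: prodspan (limg R0)))%VS.
  rewrite -(derived2_Dop p_gt2 dlP hK) /SHOspace /SHObar /SHO'space.
  by rewrite Dop0 Pop0.
have rE d : \dim (R0 @: Opar F p N t d) = #|leads d|.
  rewrite (dim_Pop_Opar p_gt2 dlP) [X in (_ + X)%N](_ : _ = 0%N) ?addn0 //.
  apply/eqP; rewrite dimv_eq0 -subv0; apply/subvP => _ /memv_imgP[a + ->]; rewrite memv0.
  elim/mspan_ind => [|c a1 a2 /eqP h1 /eqP h2|w /andP[/eqP hw _]].
  - by rewrite lfun0.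
  - by rewrite lfun_linear h1 h2 scaler0 addr0.
  by rewrite (Pop_extremal dlP) ?hw // zero_lfunE scaler0.
have leadE : #|leads true| = #|leads false|.
  exact: (card_leadp leNN charFp t_gt0 N_gt1 true).
pose part := DRpart leNN zero 0.
(* One unit of the slack is the codimension of the span of products, the other the constants, which
   [TH] may kill. *)
have bd d : (\dim (part d) <= #|leads false| <= \dim (part d) + 2)%N.
  have <- : \dim (R0 @: Opar F p N t d) = #|leads false|.
    by rewrite rE; case: d.
  have /andP[h1 h2] := dim_R_cap p_gt2 dlP N_gt1 nu_adj d.
  have h3 := leq_dim_img (Dop leNN zero) (R0 @: (prodspan (limg R0) :&: Opar F p N t d)).
  have h4 := geq_dim_img (R0 @: (prodspan (limg R0) :&: Opar F p N t d)) (lker_Dop p_gt2 dlP N_gt1).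
  rewrite (leq_trans h3 h1) /=; apply: leq_trans h2 _.
  by rewrite (_ : 2 = 1 + 1)%N // addnA leq_add2r.
exists (\dim (part false)), (\dim (part true)); split.
- rewrite E. exact: (@superdim_DR _ _ _ _ _ _ charFp p_gt2 t_gt0 _ dlP 0%R).
- have := bd false; have := bd true.
  by move: (\dim _) (\dim _) #|_| => *; lia.
have := bd false; have := bd true.
by move: (\dim _) (\dim _) #|_| => *; lia.
Qed.

End CartanSHO.

(** * Superdimension of KO *)

Section CartanKO.
Context (F : fieldType) (p N : nat) (t : 'I_N -> nat).
Hypotheses (charFp : p \in [pchar F]) (p_gt2 : (2 < p)%N) (t_gt0 : forall i, (0 < t i)%N).
Hypothesis N_gt1 : (1 < N)%N.
Local Notation O := (dpO F p N.+1 t).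
Local Notation M := (supermon p N.+1 t).
Local Notation leNn := (leqnSn N).
Local Notation d_ := (partial F p t).
Local Notation dtau := (partial_last F p t).
Local Notation wi := (widen_ord leNn).
Local Notation Opr := (Opar F p N.+1 t).
Local Notation one := (mon F (monone N.+1 charFp t_gt0)).

Lemma last_cases (j : 'I_N.+1) : j = ord_max \/ exists k, j = wi k.
Proof.
have [jN|] := ltnP j N; last by left; apply/val_inj/eqP; rewrite eqn_leq -ltnS ltn_ord.
by right; exists (Ordinal jN); apply: val_inj.
Qed.

Lemma widen_neq_max k : (wi k == ord_max) = false.
Proof. by rewrite -val_eqE /= ltn_eqF. Qed.

Lemma odd_direction_last : odd_direction leNn charFp t_gt0 dtau.
Proof.
split.
- by move=> a b; rewrite /partial_last (partial_lmul charFp).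
- by move=> a; rewrite /partial_last partial_parop expr1 scaleN1r.
- move=> a; apply: (eq_oppO charFp p_gt2).
  by rewrite /partial_last {1}(partial_comm charFp) expr1 scaleN1r.
- move=> i a; exact: (partial_comm charFp).
- move=> i; rewrite /partial_last (partial_xvar charFp t_gt0).
  case: i => k //=; rewrite ?scale0r //.
  by rewrite -[inr _ == inr _]/(ord_max == wi k) eq_sym widen_neq_max scale0r.
- by move=> a; apply: partial_top.
- move=> a h h' [k|j]; first exact: (h (inl k)).
  by have [->|[k ->]] := last_cases j; [exact: h' | exact: (h (inr k))].
move=> w; rewrite /partial_last partial_mon_basis /=; case: ifP => _; last first.
  by exists 0, w; rewrite scale0r.
exists ((-1) ^+ #|[set k in w.2 | (k < @ord_max N)%N]|), (w.1, w.2 :\ ord_max); split=> // k.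
by rewrite !inE widen_neq_max.
Qed.

Let dlP := odd_direction_last.

Lemma DKOE : DKO F p t = Dop leNn dtau.
Proof. by []. Qed.

(** Only constants could lie in the kernel, and the field of the constant [1] sends [x_(2N+1)] to
    [-2]. *)
Lemma lker_DKO : lker (DKO F p t) = 0%VS.
Proof.
apply/eqP; rewrite -subv0 DKOE; apply/subvP => a ha.
have /vlineP[c aE] := subvP (lker_Dop p_gt2 dlP N_gt1) a ha.
have dl1 : dtau one = 0 by rewrite /partial_last partial_mon_basis /= inE.
have E1 : Euler F p leNn t one = 0.
  by rewrite (Euler_mon leNn charFp t_gt0) /deg2 !big1 ?scale0r // => k _; rewrite ?moneE ?inE.
have tau1 : dtau (xvar F p t (inr ord_max)) = one.
  by rewrite /partial_last (partial_xvar charFp t_gt0) eqxx scale1r.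
have z r : d_ r one = 0.
  by rewrite partial_mon_basis; case: r => [k|k] /=; rewrite ?moneE ?inE ?eqxx.
have D1 : Dop leNn dtau one (xvar F p t (inr ord_max)) = - 2%:R *: one.
  rewrite DopE tau1 parop_one dl1 lmul0l addr0 E1 sub0r (lmul1r charFp t_gt0) scaleNr.
  rewrite THE big1 ?add0r // => k _.
  by rewrite parop_one !z !lmul0l addr0.
move: ha; rewrite memv_ker aE lfunZ => /eqP/lfunP/(_ (xvar F p t (inr ord_max))).
rewrite scale_lfunE D1 zero_lfunE scalerA => /ffunP/(_ (monone N.+1 charFp t_gt0)).
rewrite !coefE mon_coef eqxx mulr1 => /eqP.
rewrite mulf_eq0 oppr_eq0 (negPf (two_neq0 charFp p_gt2)) orbF => /eqP ->.
by rewrite scale0r memv0.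
Qed.

Lemma dim_DKO (K : {vspace O}) : \dim (Dop leNn dtau @: K) = \dim K.
Proof. by apply: limg_dim_eq; rewrite -DKOE lker_DKO capv0. Qed.

Lemma superdim_KOspace : exists k, superdim (KOspace F p t) k k.
Proof.
exists #|[pred w : M | par_mon w == false]|, (Dop leNn dtau @: Opr true)%VS,
  (Dop leNn dtau @: Opr false)%VS.
split.
- rewrite /KOspace DKOE -limgD; congr (_ @: _)%VS.
  by rewrite mspanU mspan_all // => w /=; case: (par_mon w).
- exact: (homogeneous_Dop p_gt2 dlP).
- exact: (homogeneous_Dop p_gt2 dlP).
- by rewrite dim_DKO dim_Opar.
by rewrite dim_DKO dim_Opar.
Qed.

End CartanKO.

Lemma leq_bin n k : (0 < k < n)%N -> (n <= 'C(n, k))%N.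
Proof.
elim: n k => [|n IHn] [|k] //; rewrite ltnS => /= kn.
have [->|kn'] := eqVneq k.+1 n; first by rewrite binSn.
rewrite binS -addn1; apply: leq_add; last by rewrite bin_gt0 -ltnS ltnW.
by apply: IHn; rewrite /= ltn_neqAle kn'.
Qed.

Lemma card_odd_sets (T : finType) (x : T) (d : bool) :
  #|[pred A : {set T} | odd #|A| == d]| = #|[pred A : {set T} | odd #|A| == ~~ d]|.
Proof.
apply: (card_involutive (f := fun A : {set T} => if x \in A then A :\ x else x |: A)) => A.
  by case: (boolP (x \in A)) => xA; rewrite !inE eqxx /= ?setD1K ?setU1K.
rewrite !inE; case: ifPn => xA; last by rewrite cardsU1 xA /=; case: (odd _); case: d.
by rewrite (cardsD1 x A) xA add1n /=; case: (odd _); case: d.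
Qed.

(** * Extremal monomials for SKO *)

Section CartanSKO.
Context (F : fieldType) (p N : nat) (t : 'I_N -> nat).
Hypotheses (charFp : p \in [pchar F]) (p_gt2 : (2 < p)%N) (t_gt0 : forall i, (0 < t i)%N).
Local Notation O := (dpO F p N.+1 t).
Local Notation M := (supermon p N.+1 t).
Local Notation leNn := (leqnSn N).
Local Notation dtau := (partial_last F p t).
Local Notation wi := (widen_ord leNn).
Local Notation eps := (parop F p N.+1 t).
Local Notation Pop := (Pop leNn dtau).
Local Notation E := (Euler F p leNn t).

Let dlP := odd_direction_last charFp p_gt2 t_gt0.

Lemma div_lambdaE (lambda : F) a :
  div_lambda p t lambda a = 2%:R *: Pop (N%:R * lambda) (eps a).
Proof.
elim/mon_ind: a => [|c a b ha hb|w]; first by rewrite !lfun0 scaler0.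
  by rewrite !lfun_linear ha hb scalerDr !scalerA mulrC.
by rewrite /div_lambda linext_basis parop_mon lfunZ scalerA [2%:R * _]mulrC add_lfunE opp_lfunE
  scale_lfunE id_lfunE PopE.
Qed.

Lemma lker_div_lambda (lambda : F) : lker (div_lambda p t lambda) = lker (Pop (N%:R * lambda)).
Proof.
apply/vspaceP => a; rewrite !memv_ker div_lambdaE scaler_eq0 (negPf (two_neq0 charFp p_gt2)) /=.
rewrite (Pop_parop dlP) oppr_eq0; apply/eqP/eqP => [h|->]; last by rewrite lfun0.
by rewrite -[LHS](paropK) h lfun0.
Qed.

(** The extremal monomials of parity [d] that [Pop kap] does not kill. *)
Definition extp (kap : F) d : pred M := fun w =>
  [&& ~~ nonext leNn w, par_mon w == d, ord_max \in w.2 & (deg2 leNn w)%:R != kap].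

(** On extremal monomials [Delta] vanishes, so [Pop kap] only removes [x_(2N+1)] and rescales.
    Coefficients with a nonzero factor can thus be recovered, which yields injectivity on the span
    of [extp kap d]. *)
Lemma Pop_ext_coef kap (a : O) (w : M) : a \in mspan F (fun w : M => nonext leNn w == false) ->
  ord_max \in w.2 ->
  Pop kap a (w.1, w.2 :\ ord_max) =
    ((deg2 leNn w)%:R - kap) * ((-1) ^+ nlt ord_max (w.2 :\ ord_max) * a w).
Proof.
move=> ha hw.
have -> : Pop kap a = E (dtau a) - kap *: dtau a.
  move: ha; elim/mspan_ind => [|c a1 a2 h1 h2|v /eqP hv].
  - by rewrite !lfun0 scaler0 subr0.
  - rewrite !lfun_linear h1 h2 scalerBr scalerDr !scalerA opprD addrACA.
    by rewrite [c * kap]mulrC.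
  rewrite (Pop_extremal dlP) ?hv // -(dl_Euler dlP) (Euler_mon leNn charFp t_gt0) lfunZ.
  by rewrite scalerBl.
rewrite !coefE (Euler_coef leNn charFp t_gt0) -mulrBl /partial_last partial_oddE /= !inE eqxx /=.
rewrite setD1K // -surjective_pairing; congr ((_%:R - _) * _).
rewrite /deg2 /=; congr addn; apply: eq_bigr => k _.
by rewrite !inE widen_neq_max.
Qed.

Lemma dim_Pop_ext kap d :
  \dim (Pop kap @: mspan F (fun w => (nonext leNn w == false) && (par_mon w == d))) = #|extp kap d|.
Proof.
have sub : (mspan F (extp kap d) <= mspan F (fun w =>
  (nonext leNn w == false) && (par_mon w == d)))%VS.
  by apply: mspan_sub => w; rewrite -!topredE /= => /and4P[/negPf -> ->].
have -> : (Pop kap @: mspan F (fun w => (nonext leNn w == false) && (par_mon w == d)))%VS =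
    (Pop kap @: mspan F (extp kap d))%VS.
  apply/eqP; rewrite eqEsubv (limgS _ sub) andbT.
  apply/subvP => _ /memv_imgP[a + ->]; elim/mspan_ind => [|c a1 a2 h1 h2|w /andP[/eqP hw hd]].
  - by rewrite lfun0 rpred0.
  - by rewrite lfun_linear rpredD ?rpredZ.
  have [hx|hx] := boolP (extp kap d w); first by rewrite memv_img // mem_mspan_mon.
  rewrite (Pop_extremal dlP) ?hw //; move: hx; rewrite /extp hw hd /=.
  case: (boolP (ord_max \in w.2)) => hm /=.
    by rewrite negbK => /eqP ->; rewrite subrr scale0r rpred0.
  by rewrite /partial_last partial_mon_basis /= (negPf hm) scaler0 rpred0.
rewrite -(dim_mspan F); apply: limg_dim_eq; apply/eqP; rewrite -subv0; apply/subvP => a.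
rewrite memv_cap memv_ker memv0 => /andP[ha /eqP Pa]; apply/eqP/ffunP => w; rewrite zeroO_coef.
have [hx|hx] := boolP (extp kap d w); last by have /mspanP := ha; exact.
have /and4P[_ _ hm hk] := hx.
have ha' : a \in mspan F (fun w : M => nonext leNn w == false).
  apply: subvP ha; apply: subv_trans sub _; apply: mspan_sub => v.
  by rewrite -!topredE /= => /andP[].
have := Pop_ext_coef kap ha' hm; rewrite Pa zeroO_coef => /esym/eqP.
by rewrite !mulf_eq0 signr_eq0 subr_eq0 (negPf hk) => /eqP.
Qed.

(* The extremal monomials containing the last odd variable correspond to the
   sets [A] of indices [k] at which they contain [x_{k'}]. *)
Definition extmon (A : {set 'I_N}) : M :=
  ([ffun k => if k \in A then (monone N.+1 charFp t_gt0).1 k else (topmon N.+1 charFp t_gt0).1 k],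
   ord_max |: (wi @: A)).

Lemma extmon_mem A k : (wi k \in (extmon A).2) = (k \in A).
Proof.
rewrite !inE widen_neq_max /= mem_imset // => x y /(congr1 val) /= xy; exact: val_inj.
Qed.

Lemma extmon_exp A k : (extmon A).1 k = (if k \in A then 0 else (p ^ t k).-1)%N :> nat.
Proof. by rewrite ffunE; case: ifP => _; rewrite ?moneE ?topmonE. Qed.

Lemma nonextN (w : M) : (forall k, extremal leNn w k) -> ~~ nonext leNn w.
Proof. by move=> h; rewrite /nonext /pivot; case: pickP => // k; rewrite h. Qed.

Lemma extmon_ext A : ~~ nonext leNn (extmon A).
Proof. by apply: nonextN => k; rewrite /extremal extmon_mem extmon_exp; case: (k \in A). Qed.

Lemma extmon_max A : ord_max \in (extmon A).2.
Proof. by rewrite !inE eqxx. Qed.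

Lemma extmon_par A : par_mon (extmon A) = ~~ odd #|A|.
Proof.
rewrite /par_mon cardsU1 card_imset => [|x y /(congr1 val) /= xy]; last exact: val_inj.
suff -> : ord_max \notin [set wi x | x in A] by [].
by apply/imsetP => -[k _ /esym/eqP]; rewrite widen_neq_max.
Qed.

Lemma natp_pred k : ((p ^ t k).-1)%:R = -1 :> F.
Proof.
apply/eqP; rewrite -subr_eq0 opprK natr1 prednK ?(pt_gt0 charFp t_gt0) // natrX.
by rewrite (pcharf0 charFp) expr0n -[t k == 0%N]negbK -lt0n t_gt0.
Qed.

(** A pair indexed by [A] contributes 1, any other pair [p ^ t k - 1], which is [-1] in the
    field. *)
Lemma extmon_deg A : (deg2 leNn (extmon A))%:R = (2 * #|A|)%:R - N%:R :> F.
Proof.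
rewrite /deg2 natrD !natr_sum -big_split /=.
rewrite (eq_bigr (fun k => (2 * (k \in A))%:R - 1)).
  by rewrite sumrB -natr_sum -big_distrr /= -big_mkcond sum1_card /= sumr_const card_ord.
move=> k _; rewrite extmon_mem extmon_exp; case: (k \in A); rewrite ?natp_pred.
  by rewrite muln1 add0r mulr2n addrK.
by rewrite muln0 addr0 sub0r.
Qed.

Lemma extmon_surj (w : M) : ~~ nonext leNn w -> ord_max \in w.2 ->
  extmon [set k | wi k \in w.2] = w.
Proof.
rewrite /nonext /pivot; case: pickP => // h _ hm.
have {}h k : extremal leNn w k by apply/negPn/negbT/h.
apply: supermon_eqP => [k|].
  rewrite extmon_exp inE; have := h k; rewrite /extremal.
  by case: ifP => _ /eqP ->.
apply/setP => j; have [->|[k ->]] := last_cases j; first by rewrite extmon_max.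
by rewrite extmon_mem inE.
Qed.

Lemma card_extp kap d : #|extp kap d| =
  #|[pred A : {set 'I_N} | (odd #|A| == ~~ d) && ((2 * #|A|)%:R - N%:R != kap :> F)]|.
Proof.
have inj : injective extmon.
  move=> A B AB; apply/setP => k; by rewrite -!extmon_mem AB.
rewrite -(card_imset _ inj); apply: eq_card => w.
apply/idP/imsetP => [/and4P[h1 h2 h3 h4]|[A + ->]].
  exists [set k | wi k \in w.2]; last by rewrite extmon_surj.
  rewrite inE -extmon_deg extmon_surj // h4 andbT -[odd _]negbK -extmon_par extmon_surj // (eqP h2).
  by rewrite eqxx.
rewrite inE => /andP[/eqP h1 h2]; rewrite unfold_in /extp extmon_ext extmon_max extmon_par h1
  negbK eqxx.
by rewrite extmon_deg h2.
Qed.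

End CartanSKO.

(** * Superdimension of SKO for N = p + 2 *)

Section SuperdimSKO.
Context (F : fieldType) (p : nat).
Local Notation N := p.+2.
Context (t : 'I_N -> nat).
Hypotheses (charFp : p \in [pchar F]) (p_gt3 : (3 < p)%N) (t_gt0 : forall i, (0 < t i)%N).
Local Notation leNn := (leqnSn N).
Local Notation dtau := (partial_last F p t).
Local Notation Pop := (Pop leNn dtau).
Local Notation h := ((p.+3)./2).
Local Notation exts := (extp (t := t) (p := p) (1 : F)).
Local Notation leads := (leadp leNn (t := t) (p := p)).

Let p_gt2 : (2 < p)%N := ltnW p_gt3.
Let dlP := odd_direction_last charFp p_gt2 t_gt0.

Lemma odd_char : odd p.
Proof. by have := even_prime (pcharf_prime charFp); case=> // E; move: p_gt3; rewrite E. Qed.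

(** This is [nu]: modulo [p] the factor [p + 2] is 2, and twice [(p - 1)/2] is [-1]. *)
Lemma critical_value : N%:R * ((p.-1)./2)%:R = -1 :> F.
Proof.
apply: (mulfI (two_neq0 charFp p_gt2)).
rewrite -!natrM mulnCA -natr1.
have -> : (2 * p.-1./2 = p.-1)%N.
  by rewrite mul2n -[RHS]odd_double_half -subn1 oddB ?odd_char // ltnW // ltnW.
rewrite natrM -[p.+2]addn2 natrD (pcharf0 charFp) add0r mulrN1 -[RHS]mulrN1.
congr (_ * _); apply/eqP.
by rewrite -subr_eq0 opprK natr1 prednK ?(pcharf0 charFp) // ltnW // ltnW.
Qed.

Lemma double_half_char : (2 * h = p + 3)%N.
Proof. by have := odd_double_half p.+3; rewrite /= odd_char /= add0n -mul2n addn3. Qed.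

Lemma even_dvd_char k : (p %| k)%N -> ~~ odd k -> (k < 2 * p)%N -> k = 0%N.
Proof.
move=> /dvdnP[q ->]; rewrite oddM odd_char andbT ltn_pmul2r ?(ltnW (ltnW p_gt2)) //.
by case: q => [|[|]].
Qed.

(** The condition says that [2 #|A|] and [2 h = p + 3] are congruent modulo [p]. Their difference is
    even and, as [p > 3] and [#|A| <= p + 2], smaller than [2 p]; since [p] is odd it is zero. *)
Lemma deg_eq1 (A : {set 'I_N}) : ((2 * #|A|)%:R - N%:R == 1 :> F) = (#|A| == h).
Proof.
have cA : (#|A| <= p.+2)%N by rewrite -[X in (_ <= X)%N]card_ord max_card.
have hE : 1 + N%:R = (2 * h)%:R :> F by rewrite double_half_char addrC natr1 addn3.
rewrite subr_eq hE; apply/eqP/eqP => [E|-> //].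
have [le|/ltnW le] := leqP (2 * #|A|) (2 * h).
  have z : (2 * h - 2 * #|A|)%N = 0%N.
    apply: even_dvd_char.
    - by rewrite (dvdn_pcharf charFp) natrB // E subrr.
    - by rewrite oddB // !oddM.
    by rewrite double_half_char; lia.
  lia.
have z : (2 * #|A| - 2 * h)%N = 0%N.
  apply: even_dvd_char.
  - by rewrite (dvdn_pcharf charFp) natrB // E subrr.
  - by rewrite oddB // !oddM.
  by rewrite double_half_char; lia.
lia.
Qed.

Lemma nu_adj f : Pop (- ((-1 : F) + 2%:R)) f = Pop (-1 : F) f.
Proof. by congr (Pop _ f); ring. Qed.

Lemma prodspan_critical : prodspan (lker (Pop (-1 : F))) = fullv.
Proof.
(* With [#|A| = (p + 1)/2] the Euler degree [2 #|A| - N] is [-1], so [Pop (-1)] kills this extremal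
   monomial although it contains the last odd variable. Its complement is extremal without that
   variable and is killed too. *)
have /card_gt0P[A] : (0 < #|[set A : {set 'I_N} | #|A| == (p.+1)./2]|)%N.
  by rewrite card_draws card_ord bin_gt0; have := double_half_char; lia.
rewrite inE => /eqP cA; pose w := extmon charFp t_gt0 A.
have dw : (deg2 leNn w)%:R = -1 :> F.
  rewrite (extmon_deg charFp t_gt0) cA.
  have -> : (2 * p.+1./2 = p + 1)%N by have := double_half_char;
    rewrite -[p.+3./2]/(p.+1./2).+1; lia.
  by rewrite -[N]addn2 !natrD; ring.
have hw : mon F w \in lker (Pop (-1 : F)).
  by rewrite memv_ker (Pop_extremal dlP) ?extmon_ext // dw subrr scale0r.
have hc : mon F (compl_mon charFp t_gt0 w) \in lker (Pop (-1 : F)).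
  rewrite memv_ker (Pop_extremal dlP).
    by rewrite /partial_last partial_mon_basis /= !inE eqxx scaler0.
  apply: nonextN => k; rewrite /extremal compl_monE inE extmon_mem extmon_exp.
  by case: (k \in A); rewrite /= ?subn0 ?subnn.
exact: (prodspan_ker p_gt2 dlP nu_adj isT hw hc (mon_compl_neq0 charFp t_gt0 w)).
Qed.

Lemma SKOspaceE : SKOspace p t (((p.-1)./2)%:R : F) =
  (Dop leNn dtau @: (Pop ((-1)%R + 2%:R)%R @: prodspan (limg (Pop ((-1)%R + 2%:R)%R))))%VS.
Proof.
rewrite -(derived2_Dop p_gt2 dlP prodspan_critical) /SKOspace /SKO'space /SKO''space.
by rewrite (lker_div_lambda charFp p_gt2 t_gt0) critical_value.
Qed.

(** Sets of even and of odd size are equally many, and the excluded sets, those of size [h], all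
    have the same parity. Because of [x_(2N+1)], the parity of a monomial is opposite to that of its
    set. *)
Lemma card_ext_gap : (#|exts (odd h)| = #|exts (~~ odd h)| + 'C(N, h))%N.
Proof.
rewrite !(card_extp charFp t_gt0) negbK.
have e1 : #|[pred A : {set 'I_N} | (odd #|A| == ~~ odd h) && ((2 * #|A|)%:R - N%:R != 1 :> F)]| =
    #|[pred A : {set 'I_N} | odd #|A| == ~~ odd h]|.
  apply: eq_card => A; rewrite !inE deg_eq1.
  by case: (eqVneq #|A| h) => [->|_]; rewrite ?andbT // andbF; case: (odd h).
have e2 : (#|[pred A : {set 'I_N} | (odd #|A| == odd h) &&
      ((2 * #|A|)%:R - N%:R != 1 :> F)%R]| + 'C(N, h))%N =
    #|[pred A : {set 'I_N} | odd #|A| == odd h]|.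
  have -> : 'C(N, h) = #|[set A : {set 'I_N} | #|A| == h]| by rewrite card_draws card_ord.
  rewrite -[RHS](cardID [pred A : {set 'I_N} | #|A| != h]); congr (_ + _)%N;
    apply: eq_card => A; rewrite !inE.
    by rewrite deg_eq1.
  by case: (eqVneq #|A| h) => [->|_]; rewrite ?eqxx ?andbF.
by rewrite e1 e2 (card_odd_sets ord0) negbK.
Qed.

Lemma superdim_SKOspace : exists d0 d1,
  superdim (SKOspace p t (((p.-1)./2)%:R : F)) d0 d1 /\ (d0 + 3 <= d1 \/ d1 + 3 <= d0)%N.
Proof.
pose part := DRpart leNn dtau (-1 : F).
exists (\dim (part false)), (\dim (part true)); split.
  by rewrite SKOspaceE; exact: (@superdim_DR _ _ _ _ _ _ charFp p_gt2 t_gt0 _ dlP (-1)).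
(* Since [DKO] is injective, the only possible loss is the codimension of the span of products. *)
have bd d : (\dim (part d) <= #|leads true| + #|exts d|
    <= \dim (part d) + 1)%N.
  have lE : #|leads true| = #|leads d|.
    by case: d => //; exact: (card_leadp leNn charFp t_gt0 isT true).
  have v1 : (-1 : F) + 2%:R = 1 by ring.
  rewrite lE -(dim_Pop_ext charFp p_gt2 t_gt0) -(dim_Pop_Opar p_gt2 dlP) -v1.
  rewrite /part /DRpart (dim_DKO charFp p_gt2 t_gt0 isT).
  exact: (dim_R_cap p_gt2 dlP isT nu_adj d).
(* The binomial is at least [N = p + 2]. Even after the loss of one dimension, the gap exceeds the
   difference 2 allowed for H and SHO. *)
have C5 : (5 < 'C(N, h))%N.
  apply: leq_trans (leq_bin (n := N) (k := h) _); first by rewrite !ltnS.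
  by have := double_half_char; lia.
have := card_ext_gap; have := bd (odd h); have := bd (~~ odd h).
case: (odd h); move: (\dim _) (\dim _) #|_| #|_| #|_| 'C(_, _) C5; clear => *; lia.
Qed.

End SuperdimSKO.

Theorem corollary3p4 (F : fieldType) (p : nat) (charFp : p \in [pchar F])
    (p_gt3 : (3 < p)%N)
    (r : 'I_p.+2 -> nat) (r_gt0 : forall i, (0 < r i)%N)
    (m n : nat) (m_gt2 : (2 < m)%N) (n_gt2 : (2 < n)%N)
    (t : 'I_m -> nat) (t_gt0 : forall i, (0 < t i)%N) :
  let SKO := SKOspace p r (((p.-1)./2)%:R : F) in
  [/\ ~ lsa_isomorphic SKO (Wspace F p n t),
      ~~ odd m -> ~ lsa_isomorphic SKO (Hspace F p n t),
      ~ lsa_isomorphic SKO (KOspace F p t)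
    & ~ lsa_isomorphic SKO (SHOspace F p t)].
Proof.
have p_gt2 : (2 < p)%N by apply: ltnW.
have m_gt1 : (1 < m)%N by apply: ltnW.
have n_gt0 : (0 < n)%N by apply: leq_trans n_gt2.
have [d0 [d1 [sS gap]]] := superdim_SKOspace charFp p_gt3 r_gt0.
move=> SKO; split=> [iso|m_even iso|iso|iso].
- have [k sW] := superdim_Wspace charFp p_gt2 t_gt0 n_gt0.
  by have [E0 E1] := iso_superdim iso sS sW; move: gap; rewrite E0 E1; clear; lia.
- have [e0 [e1 [sH le0 le1]]] := superdim_Hspace charFp p_gt2 t_gt0 n_gt0 m_even.
  have [E0 E1] := iso_superdim iso sS sH; move: gap le0 le1; rewrite E0 E1; clear; lia.
- have [k sK] := superdim_KOspace charFp p_gt2 t_gt0 m_gt1.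
  by have [E0 E1] := iso_superdim iso sS sK; move: gap; rewrite E0 E1; clear; lia.
have [e0 [e1 [sH le0 le1]]] := superdim_SHOspace charFp p_gt2 t_gt0 m_gt1.
have [E0 E1] := iso_superdim iso sS sH; move: gap le0 le1; rewrite E0 E1; clear; lia.
Qed.
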